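(* Let $d\ge 2$, let $A\subset\mathbb{R}^d$ be compact, and let $B\subset A$ be a Borel set with $\overline{B}\subset A^o$ (the interior of $A$), such that $B$ is Riemann measurable with $|B|>0$. Put $f_0:=1/|A|$. Let $k\in\mathbb{N}$, $\tau>0$, $\beta\in\mathbb{R}$. Let $m:\mathbb{N}\to\mathbb{N}$ and assume $\tau_n:=m(n)/n\to\tau$ as $n\to\infty$. Then as $n\to\infty$ (through the integers), $$\mathbb{P}\big[n\theta_d f_0 R_{n,m(n),k}(B)^d-\log n-(k-1)\log\log n\le\beta\big]=\exp\left(-\frac{\tau_n e^{-\beta}(k-1)^2\log\log n}{(k-1)!\,\log n}\right)e^{-(\tau_n e^{-\beta})/(k-1)!}+O((\log n)^{-1}).$$ Also, as $t\to\infty$ (through the reals), $$\mathbb{P}\big[t\theta_d f_0 (R'_{t,\tau t,k}(B))^d-\log t-(k-1)\log\log t\le\beta\big]=\exp\left(-\frac{\tau e^{-\beta}(k-1)^2\log\log t}{(k-1)!\,\log t}\right)e^{-(\tau e^{-\beta})/(k-1)!}+O((\log t)^{-1}).$$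
   Context: Notation: $|D|$ is the Lebesgue measure of $D\subset\mathbb{R}^d$; $\theta_d$ is the volume of the unit Euclidean ball in $\mathbb{R}^d$; $B(x,r)$ is the closed Euclidean ball of radius $r$ centred at $x$; $\log\log t:=\log(\log t)$; for a point set $\mathcal{X}$ and $D\subset\mathbb{R}^d$, $\mathcal{X}(D)$ is the number of points of $\mathcal{X}$ in $D$. A bounded set $B$ is Riemann measurable if its boundary $\partial B$ is Lebesgue-null. Random objects: $X_1,Y_1,X_2,Y_2,\ldots$ are independent random vectors on a common probability space, with each $X_i$ uniformly distributed over $A$ and each $Y_i$ uniformly distributed over $B$. For $n\in\mathbb{N}$, $\mathcal{X}_n:=\{X_1,\ldots,X_n\}$ and $\mathcal{Y}_{n,B}:=\{Y_1,\ldots,Y_n\}$. For $n,m,k\in\mathbb{N}$, $$R_{n,m,k}(B):=\inf\{r>0:\mathcal{X}_n(B(y,r))\ge k\ \ \forall y\in\mathcal{Y}_{m,B}\},\qquad \inf\emptyset:=+\infty.$$ Let $(Z_t)_{t\ge0}$ and $(Z'_t)_{t\ge0}$ be unit rate Poisson counting processes, independent of each other and of $(X_1,Y_1,X_2,Y_2,\ldots)$. Put $\mathcal{P}_t:=\{X_1,\ldots,X_{Z_t}\}$ (a Poisson process with intensity measure $t$ times the uniform distribution on $A$) and $\mathcal{Q}_{t,B}:=\{Y_1,\ldots,Y_{Z'_t}\}$ (a Poisson process with intensity measure $t$ times the uniform distribution on $B$). For $t,u\in(0,\infty)$, $k\in\mathbb{N}$, $$R'_{t,u,k}(B):=\inf\{r>0:\mathcal{P}_t(B(y,r))\ge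 k\ \ \forall y\in\mathcal{Q}_{u,B}\}.$$ *)

(* Defs.v *)
From HB Require Import structures.
From mathcomp Require Import all_boot all_order all_algebra finmap.
From mathcomp Require Import all_classical all_reals all_analysis measurable_realfun.

Set Implicit Arguments.
Unset Strict Implicit.
Unset Printing Implicit Defensive.

Import Order.TTheory GRing.Theory Num.Theory.
Import numFieldTopology.Exports numFieldNormedType.Exports.

Local Open Scope classical_set_scope.
Local Open Scope ring_scope.

(* R^n is 'rV[R]_n; its library topology is that of the sup norm, hence the
   usual one, and it is equipped here with the Borel sigma-algebra. *)
Section borel_rV.
Context {R : realType} {n : nat}.

Definition rV_open : set (set 'rV[R]_n) := open.

Let borel0 : <<s rV_open >> set0.
Proof. exact: sigma_algebra0. Qed.

Let borelC (A : set 'rV[R]_n) : <<s rV_open >> A -> <<s rV_open >> (~` A).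
Proof. exact: sigma_algebraC. Qed.

Let borel_bigcup (F : (set 'rV[R]_n)^nat) :
  (forall i, <<s rV_open >> (F i)) -> <<s rV_open >> (\bigcup_i F i).
Proof. exact: sigma_algebra_bigcup. Qed.

HB.instance Definition _ := @isMeasurable.Build (sigma_display rV_open)
  'rV[R]_n <<s rV_open >> borel0 borelC borel_bigcup.

End borel_rV.

Section cons_measure.
Context {R : realType} (n : nat).
Variable m : {sigma_finite_measure set (n.-tuple (measurableTypeR R)) -> \bar R}.

Definition tuple_cons (p : measurableTypeR R * n.-tuple (measurableTypeR R)) :
  n.+1.-tuple (measurableTypeR R) := [tuple of p.1 :: p.2].

Lemma measurable_tuple_cons : measurable_fun [set: _] tuple_cons.
Proof. by apply: measurable_cons; [exact: measurable_fst|exact: measurable_snd]. Qed.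

Definition cons_measure : set (n.+1.-tuple (measurableTypeR R)) -> \bar R :=
  pushforward (@lebesgue_measure R \x m)%E tuple_cons.

Let mpre (A : set (n.+1.-tuple (measurableTypeR R))) :
  measurable A -> measurable (tuple_cons @^-1` A).
Proof. by move=> mA; rewrite -[X in measurable X]setTI; exact: measurable_tuple_cons. Qed.

Let cons_measure0 : cons_measure set0 = 0%E.
Proof. by rewrite /cons_measure /pushforward preimage_set0 measure0. Qed.

Let cons_measure_ge0 A : (0 <= cons_measure A)%E.
Proof. by rewrite /cons_measure /pushforward measure_ge0. Qed.

Let cons_measure_sigma_additive : semi_sigma_additive cons_measure.
Proof.
move=> F mF tF mUF; rewrite /cons_measure /pushforward preimage_bigcup.
apply: measure_semi_sigma_additive.
- by move=> i; exact: mpre.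
- apply/trivIsetP => /= i j _ _ ij; rewrite -preimage_setI.
  by move/trivIsetP : tF => /(_ _ _ _ _ ij) ->//; rewrite preimage_set0.
- by rewrite -preimage_bigcup; exact: mpre.
Qed.

HB.instance Definition _ := isMeasure.Build _ _ _ cons_measure
  cons_measure0 cons_measure_ge0 cons_measure_sigma_additive.

Let cons_measure_sigma_finite : sigma_finite [set: _] cons_measure.
Proof.
have /sigma_finiteP[F [TF ndF Foo]] := sigma_finiteT (@lebesgue_measure R).
have /sigma_finiteP[G [TG ndG Goo]] := sigma_finiteT m.
pose g (t : n.+1.-tuple (measurableTypeR R)) := (thead t, [tuple of behead t]).
have mg : measurable_fun [set: _] g.
  apply/measurable_fun_pair => /=; first exact: measurable_tnth.
  exact: measurable_behead.
have gK : g \o tuple_cons = id.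
  by apply/funext => -[x t]; rewrite /g /= theadE; congr pair; exact/val_inj.
exists (fun i => g @^-1` (F i `*` G i)).
  rewrite -preimage_bigcup -[LHS](preimage_setT g); congr (_ @^-1` _).
  rewrite -setXTT TF TG predeqE => -[x y]; split.
    move=> [/= [i _ Fix] [k _ Gky]]; exists (maxn i k) => //; split.
    - by move: x Fix; exact/subsetPset/ndF/leq_maxl.
    - by move: y Gky; exact/subsetPset/ndG/leq_maxr.
  by move=> [i _ []/= ? ?]; split; exists i.
move=> k; have [? ?] := Foo k; have [? ?] := Goo k; split.
  by rewrite -[X in measurable X]setTI; apply: mg => //; exact: measurableX.
rewrite /cons_measure /pushforward -comp_preimage gK preimage_id.
by rewrite product_measure1E// lte_mul_pinfty// ge0_fin_numE.
Qed.

HB.instance Definition _ := Measure_isSigmaFinite.Build _ _ _ cons_measure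
  cons_measure_sigma_finite.

End cons_measure.

Fixpoint lebesgue_tuple (R : realType) (n : nat) :
    {sigma_finite_measure set (n.-tuple (measurableTypeR R)) -> \bar R} :=
  match n with
  | 0 => \d_([tuple] : 0.-tuple (measurableTypeR R))
  | n'.+1 => cons_measure (lebesgue_tuple R n')
  end.

Lemma lebesgue_tuple_box (R : realType) (n : nat) (A : 'I_n -> set (measurableTypeR R)) :
  (forall i, measurable (A i)) ->
  lebesgue_tuple R n [set t | forall i, A i (tnth t i)] =
  \big[*%E/1%E]_(i < n) lebesgue_measure (A i).
Proof.
elim: n A => [|n IH] A mA.
  by rewrite big_ord0 /= diracE mem_set// => -[].
rewrite big_ord_recl -IH//= /cons_measure /pushforward.
set D := [set t | forall i, _ (lift ord0 i) _].
rewrite (_ : _ @^-1` _ = A ord0 `*` D).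
  rewrite product_measure1E// /D.
  rewrite (_ : [set t | _] = \bigcap_(i in [set: 'I_n])
      ((fun t : n.-tuple (measurableTypeR R) => tnth t i) @^-1` A (lift ord0 i))).
    apply: fin_bigcap_measurable => [|i _]; first exact: finite_finset.
    by rewrite -[X in measurable X]setTI; exact: measurable_tnth.
  by apply/seteqP; split=> [t h i _|t h i] /=; exact: h.
apply/seteqP; split=> [[x t] /= h|[x t] /= [h0 h] i].
  split=> [|i]; first exact: (h ord0).
  by have := h (lift ord0 i); rewrite tnthS.
have [j ->|->] := unliftP ord0 i; last exact: h0.
by rewrite tnthS; exact: h.
Qed.

Section lebesgue_rV.
Context {R : realType} {n : nat}.

Definition row_of_tuple (t : n.-tuple (measurableTypeR R)) : 'rV[R]_n :=
  \row_i tnth t i.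

Lemma measurable_row_of_tuple : measurable_fun [set: _] row_of_tuple.
Proof.
apply: (@measurability _ _ _ _ _ _ rV_open) => //.
move=> _ [U oU <-]; rewrite setTI.
pose V (p : 'rV[rat]_n * nat) : set (n.-tuple (measurableTypeR R)) :=
  [set t | forall i, ball (ratr (p.1 ord0 i) : R) p.2.+1%:R^-1 (tnth t i)].
pose S := [set p : 'rV[rat]_n * nat |
  [set v : 'rV[R]_n | forall i,
  ball (ratr (p.1 ord0 i) : R) p.2.+1%:R^-1 (v ord0 i)] `<=` U].
have -> : row_of_tuple @^-1` U = \bigcup_(p in S) V p.
  apply/seteqP; split=> [t /= Ut|t /= [p pU Vt]]; last first.
    by apply: pU => /= i; rewrite mxE; exact: Vt.
  have /nbhs_ballP[e /= e0 eU] : nbhs (row_of_tuple t) U by exact: open_nbhs_nbhs.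
  pose k := Num.truncn (2 / e).
  have ke : k.+1%:R^-1 < e / 2.
    by rewrite -[ltRHS]invrK ltf_pV2 ?posrE ?invr_gt0 ?divr_gt0// invf_div truncnS_gt.
  have k0 : 0 < k.+1%:R^-1 :> R by rewrite invr_gt0.
  have q i : {q : rat | `|ratr q - tnth t i| < k.+1%:R^-1}.
    apply: cid.
    have [|q] := @rat_in_itvoo R (tnth t i - k.+1%:R^-1) (tnth t i + k.+1%:R^-1).
      by rewrite ltrD2l gtrN.
    by rewrite in_itv/= => qi; exists q; rewrite ltr_distl.
  exists (\row_i sval (q i), k); last first.
    by move=> i /=; rewrite mxE /ball/=; exact: svalP (q i).
  move=> v /= hv; apply: eU; split=> // i j; rewrite ord1.
  have := hv j; rewrite !mxE /ball/= => hvj.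
  have := svalP (q j) => qj.
  rewrite (le_lt_trans (ler_distD (ratr (sval (q j))) _ _))//.
  by rewrite [e]splitr ltrD// ?(lt_trans hvj)// distrC (lt_trans qj).
rewrite bigcup_mkcond; apply: countable_bigcupT_measurable => // p.
case: ifPn => // _.
rewrite (_ : V p = \bigcap_(i in [set: 'I_n])
    ((fun t : n.-tuple (measurableTypeR R) => tnth t i) @^-1`
       ball (ratr (p.1 ord0 i) : R) p.2.+1%:R^-1)).
  apply: fin_bigcap_measurable => [|i _]; first exact: finite_finset.
  rewrite -[X in measurable X]setTI; apply: measurable_tnth => //.
  exact: measurable_ball.
by apply/seteqP; split=> [t h i _|t h i] /=; exact: h.
Qed.

Definition lebesgue_rV : set 'rV[R]_n -> \bar R :=
  pushforward (lebesgue_tuple R n) row_of_tuple.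

Let mpre (A : set 'rV[R]_n) : measurable A -> measurable (row_of_tuple @^-1` A).
Proof. by move=> mA; rewrite -[X in measurable X]setTI; exact: measurable_row_of_tuple. Qed.

Let lebesgue_rV0 : lebesgue_rV set0 = 0%E.
Proof. by rewrite /lebesgue_rV /pushforward preimage_set0 measure0. Qed.

Let lebesgue_rV_ge0 A : (0 <= lebesgue_rV A)%E.
Proof. by rewrite /lebesgue_rV /pushforward measure_ge0. Qed.

Let lebesgue_rV_sigma_additive : semi_sigma_additive lebesgue_rV.
Proof.
move=> F mF tF mUF; rewrite /lebesgue_rV /pushforward preimage_bigcup.
apply: measure_semi_sigma_additive.
- by move=> i; exact: mpre.
- apply/trivIsetP => /= i j _ _ ij; rewrite -preimage_setI.
  by move/trivIsetP : tF => /(_ _ _ _ _ ij) ->//; rewrite preimage_set0.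
- by rewrite -preimage_bigcup; exact: mpre.
Qed.

HB.instance Definition _ := isMeasure.Build _ _ _ lebesgue_rV
  lebesgue_rV0 lebesgue_rV_ge0 lebesgue_rV_sigma_additive.

Lemma lebesgue_rV_box (A : 'I_n -> set (measurableTypeR R)) :
  (forall i, measurable (A i)) ->
  lebesgue_rV [set v | forall i, A i (v ord0 i)] =
  \big[*%E/1%E]_(i < n) lebesgue_measure (A i).
Proof.
move=> mA; rewrite -lebesgue_tuple_box// /lebesgue_rV /pushforward.
congr (lebesgue_tuple R n _).
by apply/seteqP; split=> t /= h i; have := h i; rewrite mxE.
Qed.

Definition vol (D : set 'rV[R]_n) : R := fine (lebesgue_rV D).

(* The library norm on 'rV[R]_n is the sup norm. *)
Definition euclid_norm (v : 'rV[R]_n) : R :=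
  Num.sqrt (\sum_(i < n) v ord0 i ^+ 2).

Definition euclid_cball (x : 'rV[R]_n) (r : R) : set 'rV[R]_n :=
  [set y | euclid_norm (y - x) <= r].

Definition riemann_measurable (B : set 'rV[R]_n) : Prop :=
  bounded_set B /\ lebesgue_rV (closure B `\` interior B) = 0%E.

End lebesgue_rV.

Definition unit_ball_vol (R : realType) (d : nat) : R :=
  vol (euclid_cball (0 : 'rV[R]_d) 1).

Definition interleave (T : Type) (x y : nat -> T) (i : nat) : T :=
  if odd i then y i./2 else x i./2.

Section independence.
Context {R : realType} {dO : measure_display} {Omega : measurableType dO}.
Variable P : probability Omega R.

(* Independence of set systems; it is applied to sigma-algebras only. *)
Definition mutually_independent (I : choiceType) (G : I -> set (set Omega)) : Prop :=
  forall (J : {fset I}) (E : I -> set Omega),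
    (forall i, i \in J -> G i (E i)) ->
    P (\bigcap_(i in [set` J]) E i) = \big[*%E/1%E]_(i <- J) P (E i).

Definition sigma_of {d'} {T : measurableType d'} (X : Omega -> T) : set (set Omega) :=
  preimage_set_system [set: Omega] X measurable.

Definition sigma_of_family {d'} {T : measurableType d'} {I : Type} (D : set I)
    (X : I -> Omega -> T) : set (set Omega) :=
  <<s \bigcup_(i in D) sigma_of (X i) >>.

Definition independent3 (G1 G2 G3 : set (set Omega)) : Prop :=
  mutually_independent (tnth [tuple G1; G2; G3]).

Definition uniformly_distributed {n : nat} (X : Omega -> 'rV[R]_n)
    (A : set 'rV[R]_n) : Prop :=
  forall C, measurable C -> P (X @^-1` C) = (vol (C `&` A) / vol A)%:E.

(* The law is only stated for s < t: the library's poisson_pmf is 1 at rate 0.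
   The truncated subtraction is a true one by monotonicity. *)
Record unit_rate_poisson_process (Z : R -> Omega -> nat) : Prop := {
  poisson_process_start : forall w, Z 0 w = 0%N ;
  poisson_process_mono : forall w s t, 0 <= s -> s <= t -> (Z s w <= Z t w)%N ;
  poisson_process_rcont : forall w t, 0 <= t -> \forall s \near t^'+, Z s w = Z t w ;
  poisson_process_law : forall s t (j : nat), 0 <= s -> s < t ->
    P [set w | (Z t w - Z s w)%N = j] = (poisson_pmf (t - s) j)%:E ;
  poisson_process_indep : forall u : nat -> R, 0 <= u 0%N ->
    (forall i, u i <= u i.+1) ->
    mutually_independent
      (fun i => sigma_of (fun w => (Z (u i.+1) w - Z (u i) w)%N)) }.

End independence.

Section nearest_neighbours.
Context {R : realType} {d : nat}.

(* Sequences start at index 0: X_1, X_2, ... is x 0, x 1, ... *)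
Definition first_points (x : nat -> 'rV[R]_d) (n : nat) : set 'rV[R]_d := x @` `I_n.

(* fset_set is junk on infinite sets; S is always finite in the uses below. *)
Definition npoints (S D : set 'rV[R]_d) : nat := #|` fset_set (S `&` D)|.

Definition knn_radius (S T : set 'rV[R]_d) (k : nat) : \bar R :=
  ereal_inf [set r%:E | r in
    [set r : R | 0 < r /\ forall y, T y -> (k <= npoints S (euclid_cball y r))%N]].

End nearest_neighbours.

(* Lets the Landau notations be used at +oo. *)
Canonical pinfty_filter_on (R : numFieldType) :=
  FilterType (pinfty_nbhs R) (@proper_pinfty_nbhs R).

(* Main.v *)
From HB Require Import structures.
Require Import Defs.
From mathcomp Require Import all_boot all_order all_algebra finmap.
From mathcomp Require Import all_classical all_reals all_analysis measurable_realfun.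
From mathcomp Require Import ring lra zify.
Set Implicit Arguments.
Unset Strict Implicit.
Unset Printing Implicit Defensive.

Import Order.TTheory GRing.Theory Num.Theory.
Import numFieldTopology.Exports numFieldNormedType.Exports.
Local Open Scope classical_set_scope.
Local Open Scope ring_scope.

(* With r determined by n theta_d f_0 r^d = log n + (k-1) log log n + beta, the
   event says that each Y_j has at least k of the X_i within distance r.  Given
   the X_i this has probability (1 - V)^m, where V is the fraction of B whose
   points have fewer than k of the X_i within r.  (Poissonized:
   the mean over the random number of Y_j turns (1 - V)^m into e^{-u V} exactly.)
   The function x |-> e^{-m x} lies within 2 m^2 (x - p)^2 of its tangent at
   p = P(Poisson(n |B(0,r)|/|A|) < k), which is close to E V, so E[(1 - V)^m]
   differs from e^{-m p} by at most a multiple of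
   m |E V - p| + m^2 E[(V - p)^2] + m E[V^2], while
   n p = e^{-beta}/(k-1)! (1 + (k-1)^2 log log n / log n) + O(1/log n).
   If y and z both see fewer than k points, so does the part of
   B(z,r) outside B(y,r), disjointly from B(y,r); its volume is at least
   proportional to r^{d-1} min(|y - z|, r), so integrating over z gives
   m^2 E[(V - p)^2] = O(n (r / (n r^d))^d + 1/log n) = O(1/log n), because
   n r^d is of order log n and d >= 2. *)

(** * Independence and conditioning *)

(** Since [closure B] lies in the interior of the compact set [A], there is a margin [e] such that
    every ball of radius at most [e] about a point of [B] stays in [A]. Once [r <= e], a point of
    [B] is uncovered with a probability that does not depend on its position, so no boundary term
    appears; the estimates are made for [ln t] beyond an explicit threshold that forces this. Both
    assertions go through [key_estimate], stated for an arbitrary probability space and a measurable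
    set of pairs (outcome, point). It asks for the one-point probabilities up to a relative error
    [eta] and for an upper bound on the two-point ones. For a sample of fixed size, [eta] measures
    the discrepancy between multinomial and Poisson counts, of order (log n)^2 / n at the critical
    radius. For the Poisson sample, the number of points becomes an extra coordinate of the outcome,
    and counts in disjoint regions are independent Poisson variables, so that [eta = 0]. The radius
    counts a set of points, the probability computations count indices; the two agree off the null
    event that two of the [X i] coincide. *)

Section freezing.
Local Open Scope ereal_scope.
Context d0 d1 d2 (O : measurableType d0) (T1 : measurableType d1)
  (T2 : measurableType d2) (R : realType) (P : probability O R).
Variables (U : {RV P >-> T1}) (Y : {RV P >-> T2}).
Hypothesis UY : forall A B, measurable A -> measurable B ->
  P (U @^-1` A `&` Y @^-1` B) = P (U @^-1` A) * P (Y @^-1` B).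

(** By independence the law of the pair is the product of the two laws, and Tonelli applies. [T1] is
    left arbitrary so that [U] may be the identity into the sample space with a smaller
    sigma-algebra. *)
Lemma freezing (f : T1 * T2 -> \bar R) : measurable_fun setT f ->
  (forall z, 0 <= f z) ->
  \int[P]_w f (U w, Y w) = \int[P]_w \int[distribution P Y]_y f (U w, y).
Proof.
move=> mf f0.
pose g := fun w => (U w, Y w).
have mg : measurable_fun setT g by apply/measurable_fun_pair.
pose gmix := isMeasurableFun.Build _ _ _ _ _ mg.
pose G : {mfun O >-> (T1 * T2)%type} := HB.pack g gmix.
have -> : \int[P]_w f (U w, Y w) = \int[distribution P G]_z f z.
  by rewrite ge0_integral_distribution.
rewrite -(@eq_measure_integral _ _ _ _ _ (distribution P U \x distribution P Y)).
  rewrite fubini_tonelli1//= ge0_integral_distribution//.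
    exact: measurable_fun_fubini_tonelli_F.
  by move=> x; apply: integral_ge0.
by move=> A mA _; apply: product_measure_unique.
Qed.

End freezing.

Section independence_lemmas.
Local Open Scope ereal_scope.
Context d0 (O : measurableType d0) (R : realType) (P : probability O R).

(** Dynkin's pi-lambda argument: the events independent of [B] form a Dynkin system. *)
Lemma indep_g_sigma_algebra (G : set (set O)) (B : set O) :
  setI_closed G -> G `<=` measurable -> measurable B ->
  (forall A, G A -> P (A `&` B) = P A * P B) ->
  forall A, <<s G >> A -> P (A `&` B) = P A * P B.
Proof.
move=> GI Gm mB GB A.
rewrite -setI_closed_g_dynkin_g_sigma_algebra//.
suff : <<d G >> `<=` [set A | measurable A /\ P (A `&` B) = P A * P B].
  by move=> /[apply] -[].
apply: smallest_sub; last by move=> C GC; split; [exact: Gm|exact: GB].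
split.
- by split => //; rewrite setTI probability_setT mul1e.
- move=> C [mC PC]; split; first exact: measurableC.
  rewrite setIC -setDE measureD//; last first.
    by rewrite (le_lt_trans (probability_le1 _ mB)) ?ltry.
  rewrite [X in _ - X = _](_ : _ = P C * P B); last by rewrite setIC.
  rewrite probability_setC// muleBl ?mul1e// fin_num_measure//.
- move=> F tF FP; split; first by apply: bigcupT_measurable => n; case: (FP n).
  rewrite setI_bigcupl measure_bigcup//=; last 2 first.
  - by move=> i _; apply: measurableI => //; case: (FP i).
  - by apply/trivIsetP => i j _ _ ij; move/trivIsetP : tF => /(_ i j I I ij);
       rewrite setIACA setIid => ->; rewrite set0I.
  rewrite measure_bigcup//=; last by move=> i _; case: (FP i).
  rewrite -[in RHS](@fineK _ (P B)) ?fin_num_measure//.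
  rewrite muleC -nneseriesZl//.
  apply: eq_eseriesr => i _; rewrite fineK ?fin_num_measure// muleC.
  by case: (FP i).
Qed.

(** The finite intersections of events from the [G i], [i] in [D], form a generating pi-system, on
    which mutual independence of finite families gives the product formula. *)
Lemma mutually_independent_sigma (I : choiceType) (G : I -> set (set O))
    (D : set I) (j : I) (A B : set O) :
  (forall i, sigma_algebra setT (G i)) -> (forall i, G i `<=` measurable) ->
  mutually_independent P G -> ~ D j ->
  <<s \bigcup_(i in D) G i >> A -> G j B -> P (A `&` B) = P A * P B.
Proof.
move=> sG Gm PG Dj GA GB.
pose H := [set C | exists J : {fset I}, exists E : I -> set O,
  [/\ [set` J] `<=` D, forall i, G i (E i) & C = \bigcap_(i in [set` J]) E i]].
have GT i : G i setT by have [G0 GC _] := sG i; rewrite -setC0 -setTD; exact: GC.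
have mcap (J : {fset I}) (E : I -> set O) : (forall i, G i (E i)) ->
    measurable (\bigcap_(i in [set` J]) E i).
  by move=> GE; apply: fin_bigcap_measurable => // i _; exact: Gm.
apply: (@indep_g_sigma_algebra H) => //.
- move=> _ _ [J [E [JD GE ->]]] [J' [E' [JD' GE' ->]]].
  exists (J `|` J')%fset.
  (* Padding with [setT] lets two families with different finite index sets be intersected index by
     index. *)
  exists (fun i => (if i \in J then E i else setT) `&` (if i \in J' then E' i else setT)).
  split.
  - by move=> i /=; rewrite inE => /orP[/JD|/JD'].
  - move=> i; have /sigma_algebraP := sG i; case => // _ _ _ GI.
    by apply: GI; case: ifPn.
  - apply/seteqP; split.
      move=> w [h h'] i /=; rewrite inE => /orP[iJ|iJ]; split; case: ifPn => // iJ'.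
      - exact: h. - exact: h'. - exact: h. - exact: h'.
    move=> w h; split => i /= iJ; have := h i; rewrite /= inE iJ ?orbT.
    - by case => //.
    - by case => //.
- by move=> _ [J [E [_ GE ->]]]; exact: mcap.
- exact: Gm GB.
- move=> _ [J [E [JD GE ->]]].
  pose E' i := if i == j then B else E i.
  have jJ : j \notin J by apply/negP => /JD.
  have JE : \bigcap_(i in [set` J]) E i = \bigcap_(i in [set` J]) E' i.
    apply: eq_bigcapr => i /= iJ; rewrite /E'; case: eqP => // ij.
    by rewrite -ij iJ in jJ.
  have E'G i : G i (E' i) by rewrite /E'; case: eqP => // ->.
  have -> : (\bigcap_(i in [set` J]) E i) `&` B = \bigcap_(i in [set` (j |` J)%fset]) E' i.
    rewrite JE; apply/seteqP; split => [w [h Bw] i /=|w h].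
      by rewrite !inE => /orP[/eqP ->|iJ]; [rewrite /E' eqxx|exact: h].
    split; last by have := h j; rewrite /= fset1U1 /E' eqxx; exact.
    by move=> i /= iJ; apply: h; rewrite /= inE iJ orbT.
  rewrite PG// big_fsetU1//= {1}/E' eqxx muleC JE PG//.
- apply: sub_sigma_algebra2 GA => C [i Di GC].
  exists [fset i]%fset; exists (fun k => if k == i then C else setT); split.
  - by move=> k /=; rewrite inE => /eqP ->.
  - by move=> k; case: eqP => // ->.
  - apply/seteqP; split => [w Cw k /=|w /(_ i) /=].
      by rewrite inE => /eqP ->; rewrite eqxx.
    by rewrite inE eqxx; exact.
Qed.

End independence_lemmas.

Lemma measurable_fun_coarser (O : pointedType) d' (T : measurableType d')
    (S S' : set (set O)) (f : O -> T) :
  <<s S >> `<=` <<s S' >> ->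
  measurable_fun [set: g_sigma_algebraType S] (f : g_sigma_algebraType S -> T) ->
  measurable_fun [set: g_sigma_algebraType S'] (f : g_sigma_algebraType S' -> T).
Proof. by move=> SS' mf mD B mB; apply: SS'; exact: mf. Qed.

Lemma measurable_set_coarser (O : pointedType) d' (T : measurableType d')
    (S S' : set (set O)) (N : set (O * T)) :
  <<s S >> `<=` <<s S' >> ->
  measurable (N : set (g_sigma_algebraType S * T)) ->
  measurable (N : set (g_sigma_algebraType S' * T)).
Proof.
move=> SS' mN.
pose f (z : g_sigma_algebraType S' * T) : g_sigma_algebraType S * T := z.
have mf : measurable_fun setT f.
  apply/measurable_fun_pairP; split; last exact: measurable_snd.
  move=> _ B mB; have := @measurable_fst _ _ (g_sigma_algebraType S') T.
  by move=> /(_ measurableT B); apply; exact: SS'.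
by rewrite -[N]/(f @^-1` N) -[X in measurable X]setTI; exact: mf.
Qed.

Section conditionally_iid.
Local Open Scope ereal_scope.
Context d0 (O : measurableType d0) d' (T : measurableType d') (R : realType)
  (P : probability O R).
Variables (Y : nat -> {RV P >-> T}) (S : nat -> set (set O)).
Variable mu : probability T R.
Hypothesis Sm : forall j, <<s S j >> `<=` measurable.
Hypothesis SS : forall j, <<s S j >> `<=` <<s S j.+1 >>.
Hypothesis YS : forall j B, measurable B -> <<s S j.+1 >> (Y j @^-1` B).
Hypothesis SY : forall j A B, <<s S j >> A -> measurable B ->
  P (A `&` Y j @^-1` B) = P A * P (Y j @^-1` B).
Hypothesis Ymu : forall j B, measurable B -> P (Y j @^-1` B) = mu B.
Variable N : set (g_sigma_algebraType (S 0%N) * T).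
Hypothesis mN : measurable N.

Let S0 j : <<s S 0%N >> `<=` <<s S j >>.
Proof. by elim: j => // j IH A /IH; exact: SS. Qed.

Let W (w : O) : \bar R := mu (xsection N w).

Let mW j : measurable_fun [set: g_sigma_algebraType (S j)]
  (W : g_sigma_algebraType (S j) -> \bar R).
Proof.
apply: (measurable_fun_coarser (@S0 j)).
exact: (measurable_fun_xsection mu mN).
Qed.

Let mWX j l : measurable_fun [set: g_sigma_algebraType (S j)]
  (fun w : g_sigma_algebraType (S j) => W w ^+ l).
Proof.
elim: l => [|l IH]; first exact: measurable_cst.
rewrite (_ : (fun _ => _) = (fun w => W w * W w ^+ l)).
  exact: emeasurable_funM.
by apply/funext => w; rewrite expeS.
Qed.

(** [F] and the first argument of [N] depend on the past [S j] only, and [Y j] is independent of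
    that past, so [Y j] can be integrated out first. *)
Lemma freezing_step j (F : O -> \bar R) :
  measurable_fun [set: g_sigma_algebraType (S j)]
    (F : g_sigma_algebraType (S j) -> \bar R) ->
  (forall w, 0 <= F w) ->
  \int[P]_w (F w * (\1_N (w, Y j w))%:E) = \int[P]_w (F w * W w).
Proof.
move=> mF F0.
(* The identity into [O] with the sigma-algebra generated by [S j]: its independence of [Y j] is the
   independence of the past from [Y j]. *)
pose u : O -> g_sigma_algebraType (S j) := fun w => w.
have mu' : measurable_fun setT u by move=> _ B mB; rewrite setTI; exact: Sm mB.
pose umix := isMeasurableFun.Build _ _ _ _ _ mu'.
pose U : {RV P >-> g_sigma_algebraType (S j)} := HB.pack u umix.
pose f (z : g_sigma_algebraType (S j) * T) : \bar R := F z.1 * (\1_N (z : O * T))%:E.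
have mNj : measurable (N : set (g_sigma_algebraType (S j) * T)).
  exact: measurable_set_coarser (@S0 j) mN.
have mf : measurable_fun setT f.
  apply: emeasurable_funM; first exact: measurableT_comp.
  by apply/measurable_EFinP; exact: measurable_indic.
have f0 z : 0 <= f z by rewrite mule_ge0// lee_fin.
have := @freezing _ _ _ _ _ _ _ P U (Y j) _ f mf f0.
move=> -> //; last by move=> A B mA mB; exact: SY.
apply: eq_integral => w _ /=.
rewrite (eq_measure_integral mu); last by move=> A mA _ /=; rewrite -(Ymu j).
have mx := measurable_xsection (w : g_sigma_algebraType (S 0%N)) mN.
transitivity (\int[mu]_y (F w * (\1_(xsection N w) y)%:E)).
  by apply: eq_integral => y _; rewrite /f /= !indicE mem_xsection.
rewrite ge0_integralZl//.
- by rewrite integral_indic ?setIT.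
- exact/measurable_EFinP/measurable_indic.
Qed.

Let C m := [set w | forall j, (j < m)%N -> N (w, Y j w)].

Let mC m : <<s S m >> (C m).
Proof.
elim: m => [|m IH].
  rewrite (_ : C _ = setT); first exact: (@measurableT _ (g_sigma_algebraType (S 0%N))).
  by apply/seteqP; split.
have -> : C m.+1 = C m `&` [set w | N (w, Y m w)].
  apply/seteqP; split => [w h|w [h hm] j].
    by split => [j jm|]; apply: h => //; exact: ltnW.
  by rewrite ltnS leq_eqVlt => /orP[/eqP ->//|]; exact: h.
apply: (@measurableI _ (g_sigma_algebraType (S m.+1))); first exact: SS.
pose g (w : g_sigma_algebraType (S m.+1)) : g_sigma_algebraType (S m.+1) * T := (w, Y m w).
have mg : measurable_fun setT g.
  apply/measurable_fun_pair => //= _ B mB; rewrite setTI; exact: YS.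
have := @mg measurableT N; rewrite setTI; apply.
exact: measurable_set_coarser (@S0 m.+1) mN.
Qed.

(** In its application [S 0] carries the whole sample [X], and [S j] adds the first [j] of the [Y].
    Given [S 0] the [Y j] are independent with law [mu], hence the power; they are integrated out
    one at a time, the last one first. *)
Lemma conditionally_iid m :
  P [set w | forall j, (j < m)%N -> N (w, Y j w)] = \int[P]_w (mu (xsection N w) ^+ m).
Proof.
(* Each [Y j] that is integrated out leaves a factor [W], so the induction needs an arbitrary power
   of [W] in the integrand. *)
suff H l : \int[P]_w ((\1_(C m) w)%:E * W w ^+ l) = \int[P]_w (W w ^+ (m + l)).
  rewrite -[LHS](_ : \int[P]_w (\1_(C m) w)%:E = _).
    rewrite -[RHS](_ : \int[P]_w (W w ^+ (m + 0)) = _); last by rewrite addn0.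
    by rewrite -H; apply: eq_integral => w _; rewrite expe0 mule1.
  by rewrite integral_indic ?setIT//; exact: (@Sm m).
elim: m l => [|m IH] l.
  apply: eq_integral => w _; rewrite add0n.
  by rewrite indicE mem_set ?mul1e.
rewrite addSnnS -IH.
transitivity (\int[P]_w ((\1_(C m) w)%:E * W w ^+ l * (\1_N (w, Y m w))%:E)).
  apply: eq_integral => w _; rewrite muleAC -EFinM; congr (_%:E * _).
  rewrite !indicE -natrM mulnb; congr (nat_of_bool _)%:R.
  apply/idP/andP.
    rewrite !inE => h; split; last exact: h.
    by move=> j jm; apply: h; exact: ltnW.
  rewrite !inE => -[h hm] j; rewrite ltnS leq_eqVlt => /orP[/eqP ->//|]; exact: h.
rewrite freezing_step//.
- by apply: eq_integral => w _; rewrite -muleA [X in _ * X]muleC -expeS.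
- apply: emeasurable_funM.
    by apply/measurable_EFinP/measurable_indic; exact: mC.
  exact: mWX.
- by move=> w; rewrite mule_ge0 ?lee_fin// expe_ge0.
Qed.

End conditionally_iid.

(** * Second moment of the uncovered fraction *)

Section exponential_inequalities.
Context {R : realType}.
Implicit Types x a v : R.

Lemma expR_le_quadratic x : x <= 1 -> expR x <= 1 + x + 2 * x ^+ 2.
Proof.
move=> x1.
have h0 : 0 < 1 - x / 2 by lra.
have h : expR (x / 2) <= (1 - x / 2)^-1.
  rewrite -[expR _]invrK -expRN lef_pV2 ?posrE ?expR_gt0//.
  exact: expR_ge1Dx.
have -> : expR x = expR (x / 2) ^+ 2 by rewrite -expRM_natr; congr expR; lra.
have /le_trans : expR (x / 2) ^+ 2 <= (1 - x / 2)^-1 ^+ 2.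
  by rewrite lerXn2r// nnegrE ?expR_ge0// invr_ge0 ltW.
apply; rewrite exprVn -[leLHS]mul1r ler_pdivrMr ?exprn_gt0//.
(* [(1 - x / 2) ^+ 2 * (1 + x + 2 * x ^+ 2)] exceeds 1 by exactly half of this product. *)
have : 0 <= x ^+ 2 * ((1 - x) * (5/2 - x)) by rewrite mulr_ge0 ?sqr_ge0 ?mulr_ge0//; lra.
nra.
Qed.

(** For [a - x <= 1] the quadratic bound at [a - x] is scaled by [expR (- a) <= 1]. For [a - x > 1]
    the tangent is positive and the square term alone exceeds 1, hence [expR (- x)]. *)
Lemma expRN_tangent_le x a : 0 <= x -> 0 <= a ->
  expR (- x) <= expR (- a) - expR (- a) * (x - a) + 2 * (x - a) ^+ 2.
Proof.
move=> x0 a0.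
have ea0 : 0 < expR (- a) by rewrite expR_gt0.
have ea1 : expR (- a) <= 1 by rewrite expR_le1; lra.
have [h|h] := lerP (a - x) 1.
  have -> : expR (- x) = expR (- a) * expR (a - x) by rewrite -expRD; congr expR; lra.
  apply: le_trans (ler_wpM2l (ltW ea0) (expR_le_quadratic h)) _.
  have : 0 <= (a - x) ^+ 2 * (1 - expR (- a)) by rewrite mulr_ge0 ?sqr_ge0// subr_ge0.
  nra.
have : expR (- x) <= 1 by rewrite expR_le1; lra.
move=> /le_trans; apply.
have : 0 <= expR (- a) * (1 + (a - x)) by rewrite mulr_ge0 ?expR_ge0//; lra.
nra.
Qed.

Lemma expRN_tangent_ge x a :
  expR (- a) - expR (- a) * (x - a) <= expR (- x).
Proof.
have -> : expR (- x) = expR (- a) * expR (a - x) by rewrite -expRD; congr expR; lra.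
by have := ler_wpM2l (expR_ge0 (- a)) (expR_ge1Dx (a - x)); lra.
Qed.

Lemma bernoulli_ineq x n : 0 <= x <= 1 -> 1 - n%:R * x <= (1 - x) ^+ n.
Proof.
move=> /andP[x0 x1]; elim: n => [|n IH]; first by rewrite mul0r subr0 expr0.
rewrite exprS; apply: le_trans (ler_wpM2l (_ : 0 <= 1 - x) IH); last by lra.
have : 0 <= n%:R * x ^+ 2 :> R by rewrite mulr_ge0 ?sqr_ge0.
rewrite -natr1; nra.
Qed.

Lemma onem_expr_le v n : v <= 1 -> (1 - v) ^+ n <= expR (- (n%:R * v)).
Proof.
move=> v1; rewrite -mulrN mulrC expRM_natr lerXn2r ?nnegrE ?expR_ge0 ?subr_ge0//.
exact: expR_ge1Dx.
Qed.

(** From [1 + v <= expR v] comes [(1 - v ^+ 2) * expR (- v) <= 1 - v]; Bernoulli's inequality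
    handles the power of the first factor. *)
Lemma onem_expr_ge v n : 0 <= v <= 1 ->
  expR (- (n%:R * v)) - n%:R * v ^+ 2 <= (1 - v) ^+ n.
Proof.
move=> /andP[v0 v1].
have v2 : 0 <= v ^+ 2 <= 1 by rewrite sqr_ge0 expr_le1.
have H : (1 - v ^+ 2) * expR (- v) <= 1 - v.
  have -> : 1 - v ^+ 2 = (1 - v) * (1 + v) by ring.
  rewrite -mulrA ler_piMr ?subr_ge0// expRN ler_pdivrMr ?expR_gt0// mul1r.
  exact: expR_ge1Dx.
have e0 : 0 <= 1 - v ^+ 2 by rewrite subr_ge0 (andP v2).2.
have : ((1 - v ^+ 2) * expR (- v)) ^+ n <= (1 - v) ^+ n.
  by rewrite lerXn2r// nnegrE ?subr_ge0// mulr_ge0// expR_ge0.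
apply: le_trans; rewrite exprMn -expRM_natr mulNr [v * _]mulrC.
apply: le_trans (ler_wpM2r (expR_ge0 _) (bernoulli_ineq n v2)).
rewrite mulrBl mul1r lerD2l lerN2 ler_piMr ?mulr_ge0 ?sqr_ge0//.
by rewrite expR_le1 oppr_le0 mulr_ge0.
Qed.

End exponential_inequalities.

Section second_moment.
Context d0 d' (O : measurableType d0) (T : measurableType d') (R : realType)
  (P : probability O R) (mu : probability T R).
Variable G : set (O * T).
Hypothesis mG : measurable G.

Let V (w : O) : R := fine (mu (xsection G w)).

Let VE w : (V w)%:E = mu (xsection G w).
Proof. by rewrite fineK// fin_num_measure//; exact: measurable_xsection. Qed.

Let V01 w : 0 <= V w <= 1.
Proof.
by rewrite -!lee_fin VE measure_ge0 probability_le1//; exact: measurable_xsection.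
Qed.

Let mV : measurable_fun [set: O] V.
Proof.
apply/measurable_EFinP; rewrite (_ : _ \o _ = mu \o xsection G).
  exact: (measurable_fun_xsection mu mG).
by apply/funext => w /=; rewrite VE.
Qed.

Lemma integral_section_measure :
  (\int[P]_w (V w)%:E = \int[mu]_y P (ysection G y))%E.
Proof.
under eq_integral do rewrite VE.
transitivity ((P \x^ mu)%E G); last by [].
by apply: product_measure_unique => //= ? ? ? ?; rewrite product_measure2E.
Qed.

Lemma section_measure_fin w : (V w)%:E = mu (xsection G w).
Proof. exact: VE. Qed.

Lemma section_measure01 w : 0 <= V w <= 1.
Proof. exact: V01. Qed.

Lemma measurable_section_measure : measurable_fun [set: O] V.
Proof. exact: mV. Qed.

End second_moment.

Section joint_section_measure.
Context d0 d' (O : measurableType d0) (T : measurableType d') (R : realType)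
  (P : probability O R) (mu : probability T R) (G : set (O * T)).
Hypothesis mG : measurable G.

Let G2 : set (O * (T * T)) := [set z | G (z.1, z.2.1) /\ G (z.1, z.2.2)].

Let mG2 : measurable G2.
Proof.
apply: measurableI.
  pose f (z : O * (T * T)) := (z.1, z.2.1).
  have mf : measurable_fun setT f.
    apply: measurable_fun_pair; first exact: measurable_fst.
    by apply: measurableT_comp => //; exact: measurableT_comp.
  by rewrite -[X in measurable X]setTI; exact: mf.
pose f (z : O * (T * T)) := (z.1, z.2.2).
have mf : measurable_fun setT f.
  apply: measurable_fun_pair; first exact: measurable_fst.
  by apply: measurableT_comp => //; exact: measurableT_comp.
by rewrite -[X in measurable X]setTI; exact: mf.
Qed.

Let ysectionG2 (z : T * T) : ysection G2 z = ysection G z.1 `&` ysection G z.2.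
Proof. by apply/seteqP; split => w /=; rewrite /ysection /= !inE /G2 /=. Qed.

Lemma measurable_joint_section :
  measurable_fun setT (fun z : T * T => P (ysection G z.1 `&` ysection G z.2)).
Proof.
rewrite (_ : (fun _ => _) = (fun z => P (ysection G2 z))).
  exact: (measurable_fun_ysection P mG2).
by apply/funext => z; rewrite ysectionG2.
Qed.

(** The square of the measure of a section is the product measure of the section times itself, so
    Tonelli turns the second moment into an average over pairs of points. *)
Lemma integral_section_measure2 :
  (\int[P]_w (fine (mu (xsection G w)) ^+ 2)%:E =
   \int[mu]_y \int[mu]_y' P (ysection G y `&` ysection G y'))%E.
Proof.
transitivity (\int[mu \x mu]_z P (ysection G2 z))%E; last first.
  rewrite fubini_tonelli1//=; last exact: measurable_fun_ysection.
  by apply: eq_integral => y _; apply: eq_integral => y' _; rewrite ysectionG2.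
rewrite -integral_section_measure//; apply: eq_integral => w _.
rewrite section_measure_fin// [in LHS]expr2 EFinM section_measure_fin//.
have -> : xsection G2 w = xsection G w `*` xsection G w.
  by apply/seteqP; split => -[y y']; rewrite /xsection /= !inE /G2 /= ?inE.
by apply/esym; apply: product_measure1E; exact: measurable_xsection.
Qed.

End joint_section_measure.

Section exponential_moments.
Context d0 (O : measurableType d0) (R : realType) (P : probability O R).
Variable V : O -> R.
Hypothesis mV : measurable_fun [set: O] V.
Hypothesis V01 : forall w, 0 <= V w <= 1.

Let integrableb (f : O -> R) (M : R) : measurable_fun setT f ->
  (forall w, `|f w| <= M) -> P.-integrable setT (EFin \o f).
Proof.
move=> mf fM; apply: measurable_bounded_integrable => //.
  by rewrite /= probability_setT ltry.
exists M; split; first exact: num_real.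
by move=> N MN w _; exact: le_trans (fM w) (ltW MN).
Qed.

Let iV : P.-integrable setT (EFin \o V).
Proof. by apply: (@integrableb _ 1) => // w; rewrite ger0_norm; case/andP: (V01 w). Qed.

Let iV2 : P.-integrable setT (EFin \o (fun w => V w ^+ 2)).
Proof.
apply: (@integrableb _ 1); first exact: measurable_funX.
by move=> w; rewrite ger0_norm ?sqr_ge0// expr_le1//; case/andP: (V01 w).
Qed.

Let iexp m : 0 <= m -> P.-integrable setT (EFin \o (fun w => expR (- (m * V w)))).
Proof.
move=> m0; apply: (@integrableb _ 1).
  by apply: measurableT_comp => //; apply: measurableT_comp => //; exact: measurable_funM.
move=> w; rewrite ger0_norm ?expR_ge0// expR_le1 oppr_le0 mulr_ge0//.
by case/andP: (V01 w).
Qed.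

Let ipow n : P.-integrable setT (EFin \o (fun w => (1 - V w) ^+ n)).
Proof.
apply: (@integrableb _ 1).
  by apply: measurable_funX; exact: measurable_funB.
move=> w; have /andP[V0 V1] := V01 w.
by rewrite ger0_norm ?exprn_ge0 ?subr_ge0// exprn_ile1 ?subr_ge0//; lra.
Qed.

Let e1 := (\int[P]_w V w)%R.
Let e2 := (\int[P]_w (V w ^+ 2))%R.

Lemma Rintegral_quadratic (a b c : R) :
  \int[P]_w (a + b * V w + c * V w ^+ 2) = a + b * e1 + c * e2.
Proof.
have ic : P.-integrable setT (EFin \o (fun _ : O => a)).
  by apply: (@integrableb _ `|a|).
have ib : P.-integrable setT (EFin \o (fun w => b * V w)).
  by apply: eq_integrable (integrableZl measurableT b iV).
have icc : P.-integrable setT (EFin \o (fun w => c * V w ^+ 2)).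
  by apply: eq_integrable (integrableZl measurableT c iV2).
have iab : P.-integrable setT (EFin \o (fun w => a + b * V w)).
  by apply: eq_integrable (integrableD measurableT ic ib).
rewrite RintegralD// RintegralD// !RintegralZl// Rintegral_cst//.
by rewrite /= probability_setT mulr1.
Qed.

Let iquad (a b c : R) : P.-integrable setT (EFin \o (fun w => a + b * V w + c * V w ^+ 2)).
Proof.
apply: (@integrableb _ (`|a| + `|b| + `|c|)).
  by apply: measurable_funD; [apply: measurable_funD => //|]; apply: measurable_funM => //; exact: measurable_funX.
move=> w; have /andP[V0 V1] := V01 w.
rewrite (le_trans (ler_normD _ _))// lerD//.
  rewrite (le_trans (ler_normD _ _))// lerD2l normrM ler_piMr//.
  by rewrite ger0_norm.
by rewrite normrM ler_piMr// ger0_norm ?sqr_ge0// expr_le1.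
Qed.

(** Integrates the tangent inequalities at [a] with [x = m * V w]. The linear term drops its factor
    [expR (- a) <= 1], and the bracket is the mean of [(m * V - a) ^+ 2]. *)
Lemma exponential_moment_le (m a : R) : 0 <= m -> 0 <= a ->
  `|\int[P]_w expR (- (m * V w)) - expR (- a)| <=
  `|m * e1 - a| + 2 * (m ^+ 2 * e2 - 2 * a * (m * e1) + a ^+ 2).
Proof.
move=> m0 a0; set q := 2 * _.
have ea0 : 0 < expR (- a) by rewrite expR_gt0.
have ea1 : expR (- a) <= 1 by rewrite expR_le1; lra.
have up : \int[P]_w expR (- (m * V w)) <= expR (- a) - expR (- a) * (m * e1 - a) + q.
  have -> : expR (- a) - expR (- a) * (m * e1 - a) + q =
    (expR (- a) * (1 + a) + 2 * a ^+ 2) + (- expR (- a) * m - 4 * a * m) * e1 + (2 * m ^+ 2) * e2.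
    by rewrite /q; ring.
  rewrite -Rintegral_quadratic; apply: le_Rintegral => //; first exact: iexp.
  move=> w _; have /andP[V0 V1] := V01 w.
  have := @expRN_tangent_le _ (m * V w) a (mulr_ge0 m0 V0) a0.
  by move=> /le_trans; apply; rewrite le_eqVlt; apply/orP; left; apply/eqP; ring.
have lo : expR (- a) - expR (- a) * (m * e1 - a) <= \int[P]_w expR (- (m * V w)).
  have -> : expR (- a) - expR (- a) * (m * e1 - a) =
    (expR (- a) * (1 + a)) + (- expR (- a) * m) * e1 + 0 * e2 by ring.
  rewrite -Rintegral_quadratic; apply: le_Rintegral => //; first exact: iexp.
  move=> w _; have := @expRN_tangent_ge _ (m * V w) a.
  by apply: le_trans; rewrite le_eqVlt; apply/orP; left; apply/eqP; ring.
have h : `|expR (- a) * (m * e1 - a)| <= `|m * e1 - a|.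
  by rewrite normrM ler_piMl// ger0_norm// ltW.
move: h; rewrite !ler_norml => /andP[h1 h2].
by apply/andP; split; lra.
Qed.

Lemma binomial_moment_le (n : nat) :
  `|\int[P]_w (1 - V w) ^+ n - \int[P]_w expR (- (n%:R * V w))| <= n%:R * e2.
Proof.
have n0 : 0 <= n%:R :> R by [].
have up : \int[P]_w (1 - V w) ^+ n <= \int[P]_w expR (- (n%:R * V w)).
  apply: le_Rintegral => //; first exact: iexp.
  by move=> w _; apply: onem_expr_le; case/andP: (V01 w).
have lo : \int[P]_w expR (- (n%:R * V w)) <= \int[P]_w (1 - V w) ^+ n + n%:R * e2.
  have in2 : P.-integrable setT (EFin \o (fun w => n%:R * V w ^+ 2)).
    by apply: eq_integrable (integrableZl measurableT n%:R iV2).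
  rewrite -RintegralZl// -RintegralD//; apply: le_Rintegral => //.
  - exact: iexp.
  - by apply: eq_integrable (integrableD measurableT (ipow n) in2).
  - by move=> w _; rewrite -lerBlDr onem_expr_ge.
rewrite ler_norml; apply/andP; split; lra.
Qed.

End exponential_moments.

(** * Multinomial and Poisson counts *)

Section trinomial.
Context {R : realType}.

(* Probability of a points in a region of mass q1 and b points in a disjoint
   region of mass q2, for n independent points. *)
Definition trinom (n a b : nat) (q1 q2 : R) : R :=
  'C(n, a)%:R * 'C(n - a, b)%:R * q1 ^+ a * q2 ^+ b * (1 - q1 - q2) ^+ (n - a - b).

(** Conditions on the region that receives the last of the [n.+1] points. *)
Lemma trinom_rec n a b (q1 q2 : R) : trinom n.+1 a b q1 q2 =
  q1 * (if a is a'.+1 then trinom n a' b q1 q2 else 0)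
  + q2 * (if b is b'.+1 then trinom n a b' q1 q2 else 0)
  + (1 - q1 - q2) * trinom n a b q1 q2.
Proof.
rewrite /trinom; set s := 1 - q1 - q2.
(* For [a1 + b1 > n] the truncated exponents no longer match, but a binomial coefficient vanishes on
   both sides. *)
have H0 a1 b1 : s * ('C(n, a1)%:R * 'C(n - a1, b1)%:R * q1 ^+ a1 * q2 ^+ b1 * s ^+ (n - a1 - b1)) =
   'C(n, a1)%:R * 'C(n - a1, b1)%:R * q1 ^+ a1 * q2 ^+ b1 * s ^+ (n.+1 - a1 - b1).
  have [h|h] := leqP (a1 + b1) n.
    rewrite -!subnDA subSn// exprS; ring.
  have [ha|ha] := leqP a1 n; last by rewrite bin_small// !mul0r mulr0.
  by rewrite (@bin_small (n - a1)%N) ?ltn_subLR// !(mulr0, mul0r).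
rewrite H0.
case: a => [|a].
  rewrite !bin0 !subn0 !expr0 !mulr1 !mul1r mulr0 add0r.
  case: b => [|b].
    by rewrite !bin0 !subn0 mulr0 add0r.
  rewrite binS natrD subSS exprS; ring.
rewrite binS natrD !subSS exprS.
case: b => [|b].
  by rewrite !bin0 !expr0 !subn0; ring.
have H1 : 'C(n, a.+1)%:R * 'C(n - a, b.+1)%:R =
    'C(n, a.+1)%:R * ('C(n - a.+1, b)%:R + 'C(n - a.+1, b.+1)%:R) :> R.
  have [h|h] := ltnP a n; last by rewrite bin_small// !mul0r.
  by rewrite -[(n - a)%N](@prednK) ?subn_gt0// -subnS binS natrD addrC.
have -> : (n - a.+1 - b = n - a - b.+1)%N by lia.
rewrite [in LHS]mulrDl H1 (exprS q2); ring.
Qed.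

Lemma trinom00 a b (q1 q2 : R) : trinom 0 a b q1 q2 = ((a == 0%N) && (b == 0%N))%:R.
Proof.
by case: a b => [|a] [|b]; rewrite /trinom !sub0n !bin0n /= ?expr0 ?mulr1 ?mulr0 ?mul0r.
Qed.

End trinomial.

Section counts.
Context d0 (O : measurableType d0) d' (T : measurableType d') (R : realType)
  (P : probability O R).
Variables (X : nat -> {RV P >-> T}) (S : nat -> set (set O)).
Hypothesis Sm : forall j, <<s S j >> `<=` measurable.
Hypothesis SS : forall j, <<s S j >> `<=` <<s S j.+1 >>.
Hypothesis XS : forall j B, measurable B -> <<s S j.+1 >> (X j @^-1` B).
Hypothesis SX : forall j A B, <<s S j >> A -> measurable B ->
  P (A `&` X j @^-1` B) = (P A * P (X j @^-1` B))%E.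

(** Counts indices, so that coinciding points count repeatedly, whereas [npoints] counts the points
    of a set. The two agree when the points are distinct. *)
Definition count_in (D : set T) (n : nat) (w : O) : nat :=
  \sum_(i < n) (X i w \in D).

Lemma count_inS D n w : count_in D n.+1 w = (count_in D n w + (X n w \in D))%N.
Proof. by rewrite /count_in big_ord_recr. Qed.

Variables (D1 D2 : set T) (q1 q2 : R).
Hypothesis mD1 : measurable D1.
Hypothesis mD2 : measurable D2.
Hypothesis D12 : D1 `&` D2 = set0.
Hypothesis PD1 : forall j, P (X j @^-1` D1) = q1%:E.
Hypothesis PD2 : forall j, P (X j @^-1` D2) = q2%:E.

Let E n a b := [set w | count_in D1 n w = a /\ count_in D2 n w = b].

Let E1 n a b := if a is a'.+1 then E n a' b `&` X n @^-1` D1 else set0.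
Let E2 n a b := if b is b'.+1 then E n a b' `&` X n @^-1` D2 else set0.
Let E3 n a b := E n a b `&` X n @^-1` (~` (D1 `|` D2)).

Let ES n a b : E n.+1 a b = (E1 n a b `|` E2 n a b) `|` E3 n a b.
Proof.
apply/seteqP; split => w; rewrite /E /E1 /E2 /E3 /=.
- rewrite !count_inS => -[<- <-].
  have [h1|h1] := boolP (X n w \in D1).
    have /negbTE -> : X n w \notin D2.
      by apply/negP; rewrite !inE in h1 * => h2; have : (D1 `&` D2) (X n w) by []; rewrite D12.
    by left; left; rewrite addn1 addn0; split => //=; rewrite inE in h1.
  have [h2|h2] := boolP (X n w \in D2).
    by left; right; rewrite addn1 addn0; split => //=; rewrite inE in h2.
  right; rewrite !addn0; split => //= -[]; rewrite -[X in X -> _]in_setE.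
    by rewrite (negbTE h1).
  by rewrite (negbTE h2).
- case; [case|].
  + case: a => // a [] [<- <-] /= h1; rewrite !count_inS mem_set// addn1; split => //.
    rewrite memNset ?addn0// => h2.
    by have : (D1 `&` D2) (X n w) by []; rewrite D12.
  + case: b => // b [] [<- <-] /= h1; rewrite !count_inS (mem_set h1) addn1; split => //.
    rewrite memNset ?addn0// => h2.
    by have : (D1 `&` D2) (X n w) by []; rewrite D12.
  + move=> [] [<- <-] /= /not_orP[h1 h2]; rewrite !count_inS.
    by rewrite !memNset// !addn0.
Qed.

Let SE n a b : <<s S n >> (E n a b).
Proof.
have mI m := @measurableI _ (g_sigma_algebraType (S m)).
have mU m := @measurableU _ (g_sigma_algebraType (S m)).
have m0 m := @measurable0 _ (g_sigma_algebraType (S m)).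
elim: n a b => [|n IH] a b.
  rewrite (_ : E _ _ _ = if (a == 0%N) && (b == 0%N) then setT else set0).
    by case: ifP => _; [exact: (@measurableT _ (g_sigma_algebraType (S 0)))|exact: m0].
  apply/seteqP; split => w; rewrite /E /= /count_in !big_ord0.
    by move=> [<- <-].
  by case: ifP => // /andP[/eqP -> /eqP ->].
rewrite ES; apply: (mU _); first apply: (mU _).
- case: a => [|a]; [exact: m0|]; apply: (mI _); last exact: XS.
  by apply: SS; exact: IH.
- case: b => [|b]; [exact: m0|]; apply: (mI _); last exact: XS.
  by apply: SS; exact: IH.
- apply: (mI _); first by apply: SS; exact: IH.
  by apply: XS; apply: measurableC; exact: measurableU.
Qed.

(** The three events of [ES] mirror the recursion [trinom_rec]; the only independence used is that
    of the last point from the counts of the earlier ones. *)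
Lemma prob_count_eq n a b :
  P [set w | count_in D1 n w = a /\ count_in D2 n w = b] = (trinom n a b q1 q2)%:E.
Proof.
rewrite -/(E n a b); elim: n a b => [a b|n IH].
  rewrite trinom00 (_ : E _ _ _ = if (a == 0%N) && (b == 0%N) then setT else set0).
    by case: ifP => _; rewrite ?probability_setT ?measure0.
  apply/seteqP; split => w; rewrite /E /= /count_in !big_ord0.
    by move=> [<- <-].
  by case: ifP => // /andP[/eqP -> /eqP ->].
have mE m a' b' : measurable (E m a' b') by exact: Sm (@SE m a' b').
have mX D : measurable D -> measurable (X n @^-1` D).
  by move=> mD; rewrite -[X in measurable X]setTI; exact: measurable_funP.
have mE1 a b : measurable (E1 n a b).
  by rewrite /E1; case: a => // a; apply: measurableI => //; exact: mX.
have mE2 a b : measurable (E2 n a b).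
  by rewrite /E2; case: b => // b; apply: measurableI => //; exact: mX.
have mE3 a b : measurable (E3 n a b).
  by apply: measurableI => //; apply: mX; apply: measurableC; exact: measurableU.
have PE1 a b : P (E1 n a b) = (q1 * (if a is a'.+1 then trinom n a' b q1 q2 else 0))%:E.
  rewrite /E1; case: a => [|a]; first by rewrite measure0 mulr0.
  by rewrite SX// IH PD1 muleC.
have PE2 a b : P (E2 n a b) = (q2 * (if b is b'.+1 then trinom n a b' q1 q2 else 0))%:E.
  rewrite /E2; case: b => [|b]; first by rewrite measure0 mulr0.
  by rewrite SX// IH PD2 muleC.
have PE3 a b : P (E3 n a b) = ((1 - q1 - q2) * trinom n a b q1 q2)%:E.
  rewrite /E3 SX//; last by apply: measurableC; exact: measurableU.
  rewrite IH muleC -preimage_setC probability_setC; last exact/mX/measurableU.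
  suff -> : P (X n @^-1` (D1 `|` D2)) = (q1 + q2)%:E.
    by rewrite -EFinB -EFinM opprD addrA.
  transitivity (P (X n @^-1` D1) + P (X n @^-1` D2))%E; last by rewrite PD1 PD2.
  rewrite preimage_setU; apply: measureU; [exact: mX|exact: mX|].
  by rewrite -preimage_setI D12 preimage_set0.
move=> a b; rewrite ES trinom_rec !EFinD -PE1 -PE2 -PE3 measureU//; last 2 first.
- exact: measurableU.
- apply/seteqP; split => // w [] [].
    by rewrite /E1; case: a => // a [_ h1] [_ /= []]; left.
  by rewrite /E2; case: b => // b [_ h1] [_ /= []]; right.
congr (_ + _)%E; rewrite measureU//.
apply/seteqP; split => // w [].
rewrite /E1 /E2; case: a => // a [_ h1].
case: b => // b [_ h2].
by have : (D1 `&` D2) (X n w) by []; rewrite D12.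
Qed.

Lemma prob_count_lt n k :
  P [set w | (count_in D1 n w < k)%N /\ (count_in D2 n w < k)%N] =
  (\sum_(a < k) \sum_(b < k) trinom n a b q1 q2)%:E.
Proof.
have mE m a' b' : measurable (E m a' b') by exact: Sm (@SE m a' b').
rewrite (_ : [set w | _] = \bigcup_(z in [set: 'I_k * 'I_k]) E n z.1 z.2); last first.
  apply/seteqP; split => w /= => [[h1 h2]|[[a b] _ [/= -> ->]]]; last by split.
  by exists (Ordinal h1, Ordinal h2).
rewrite measure_fin_bigcup//; last 2 first.
- exact: finite_finset.
- move=> [a b] [a' b'] _ _ /= [w [[h1 h2] [/= h1' h2']]].
  by congr pair; apply: val_inj; rewrite /= -?h1' -?h2' ?h1 ?h2.
rewrite (fsbigE (index_enum _))//; last 2 first.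
- exact: index_enum_uniq.
- by move=> z _; rewrite mem_index_enum.
rewrite pair_bigA /= -sumEFin; apply: eq_big => [z|z _]; first by rewrite in_setT.
by rewrite -prob_count_eq.
Qed.

End counts.

Section poisson_tail.
Context {R : realType}.
Implicit Types x y : R.

(** Correct at rate 0 too, which is the rate of an empty second region; [poisson_pmf] is 1 there. *)
Definition pois x (a : nat) : R := expR (- x) * x ^+ a / a`!%:R.

Definition pois_lt (k : nat) x : R := \sum_(a < k) pois x a.

Lemma fact_gt0R a : 0 < a`!%:R :> R.
Proof. by rewrite ltr0n fact_gt0. Qed.

Lemma pois_ge0 x a : 0 <= x -> 0 <= pois x a.
Proof. by move=> x0; rewrite /pois !mulr_ge0 ?expR_ge0 ?exprn_ge0 ?invr_ge0. Qed.

Lemma poisM_ge0 x y a b : 0 <= x -> 0 <= y -> 0 <= pois x a * pois y b.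
Proof. by move=> x0 y0; apply: mulr_ge0; exact: pois_ge0. Qed.

Lemma pois_lt_ge0 k x : 0 <= x -> 0 <= pois_lt k x.
Proof. by move=> x0; apply: sumr_ge0 => a _; exact: pois_ge0. Qed.

Lemma expr_fact_le_expR x a : 0 <= x -> x ^+ a / a`!%:R <= expR x.
Proof.
move=> x0; case: a => [|a].
  by rewrite expr0 fact0 divr1 -expR0 ler_expR.
by apply: le_trans (expR_ge1Dxn a x0); rewrite lerDr.
Qed.

(** Half of the exponential absorbs the power: [x ^+ a] over the factorial of [a] is at most
    [2 ^+ a * expR (x / 2)]. *)
Lemma pois_lt_le k x : 0 <= x ->
  pois_lt k x <= k%:R * 2 ^+ k * expR (- (x / 2)).
Proof.
move=> x0.
have -> : k%:R * 2 ^+ k * expR (- (x / 2)) = \sum_(a < k) (2 ^+ k * expR (- (x / 2))).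
  by rewrite sumr_const card_ord -[RHS]mulr_natl mulrA.
apply: ler_sum => a _; rewrite /pois.
have -> : expR (- x) = expR (- (x / 2)) * expR (- (x / 2)) by rewrite -expRD; congr expR; lra.
have x2 : 0 <= x / 2 by lra.
have := expr_fact_le_expR a x2.
rewrite -[expR (x / 2)]invrK -expRN => h.
have {}h : (x / 2) ^+ a / a`!%:R * expR (- (x / 2)) <= 1.
  by rewrite -ler_pdivlMr ?expR_gt0// div1r.
have -> : expR (- (x / 2)) * expR (- (x / 2)) * x ^+ a / a`!%:R =
   2 ^+ a * ((x / 2) ^+ a / a`!%:R * expR (- (x / 2))) * expR (- (x / 2)).
  rewrite expr_div_n; field; rewrite ?expf_neq0//=.
  by rewrite gt_eqF ?fact_gt0R.
rewrite ler_wpM2r ?expR_ge0//.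
apply: (@le_trans _ _ (2 ^+ a)); first by rewrite ler_piMr ?exprn_ge0.
by rewrite ler_eXn2l// ?ltr1n// ltnW.
Qed.

End poisson_tail.

Section trinomial_bounds.
Context {R : realType}.

Lemma bin2_fact_le n a b : ('C(n, a) * 'C(n - a, b) * (a`! * b`!) <= n ^ (a + b))%N.
Proof.
have ffle p c : (p ^_ c <= p ^ c)%N.
  elim: c p => [|c IH] p; first by rewrite ffactn0 expn0.
  rewrite ffactnSr expnSr leq_mul// leq_subr//.
have -> : ('C(n, a) * 'C(n - a, b) * (a`! * b`!) = ('C(n, a) * a`!) * ('C(n - a, b) * b`!))%N by lia.
rewrite !bin_ffact expnD leq_mul//.
rewrite (leq_trans (ffle _ _))//; case: b => // b.
by rewrite leq_exp2r ?leq_subr.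
Qed.

Lemma trinom_ge0 n a b (q1 q2 : R) : 0 <= q1 -> 0 <= q2 -> q1 + q2 <= 1 ->
  0 <= trinom n a b q1 q2.
Proof.
by move=> q10 q20 q12; rewrite /trinom !mulr_ge0 ?exprn_ge0//; lra.
Qed.

(** The coefficients are at most [n ^ (a + b)] over the factorials. The last power has exponent
    [n - a - b] instead of [n]; making up for the [a + b] missing factors costs the leading
    exponential. *)
Lemma trinom_le n a b (q1 q2 : R) : 0 <= q1 -> 0 <= q2 -> q1 + q2 <= 1 ->
  trinom n a b q1 q2 <=
  expR ((a + b)%:R * (q1 + q2)) * (pois (n%:R * q1) a * pois (n%:R * q2) b).
Proof.
move=> q10 q20 q12.
have [h|h] := leqP (a + b) n; last first.
  rewrite [leLHS](_ : _ = 0).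
    by apply: mulr_ge0; [exact: expR_ge0|apply: poisM_ge0; exact: mulr_ge0].
  rewrite /trinom; have [ha|ha] := leqP a n; last by rewrite bin_small// !mul0r.
  by rewrite (@bin_small (n - a)%N) ?ltn_subLR// !(mulr0, mul0r).
have af := fact_gt0R (R := R) a.
have bf := fact_gt0R (R := R) b.
have H : (1 - q1 - q2) ^+ (n - a - b) <=
    expR ((a + b)%:R * (q1 + q2)) * expR (- (n%:R * q1)) * expR (- (n%:R * q2)).
  rewrite -!expRD; have := @onem_expr_le R (q1 + q2) (n - a - b) q12.
  rewrite opprD addrA => /le_trans; apply; rewrite ler_expR.
  by rewrite -subnDA natrB// le_eqVlt; apply/orP; left; apply/eqP; ring.
have C : ('C(n, a)%:R * 'C(n - a, b)%:R : R) <= n%:R ^+ a * n%:R ^+ b / (a`!%:R * b`!%:R).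
  rewrite ler_pdivlMr ?mulr_gt0// -exprD -!natrM -natrX ler_nat.
  exact: bin2_fact_le.
rewrite /trinom /pois !exprMn.
have s0 : 0 <= (1 - q1 - q2) ^+ (n - a - b) by rewrite exprn_ge0//; lra.
apply: le_trans (ler_wpM2l _ H) _; first by rewrite !mulr_ge0 ?exprn_ge0.
have E0 : 0 <= q1 ^+ a * q2 ^+ b * (expR ((a + b)%:R * (q1 + q2)) * expR (- (n%:R * q1)) * expR (- (n%:R * q2))).
  by rewrite !mulr_ge0 ?exprn_ge0 ?expR_ge0.
have := ler_wpM2r E0 C; rewrite invfM !mulrA => /le_trans; apply.
by rewrite le_eqVlt; apply/orP; left; apply/eqP; ring.
Qed.

Lemma sum_trinom_le n k (q1 q2 : R) : 0 <= q1 -> 0 <= q2 -> q1 + q2 <= 1 ->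
  \sum_(a < k) \sum_(b < k) trinom n a b q1 q2 <=
  expR ((2 * k)%:R * (q1 + q2)) * (pois_lt k (n%:R * q1) * pois_lt k (n%:R * q2)).
Proof.
move=> q10 q20 q12; rewrite /pois_lt mulr_suml mulr_sumr.
apply: ler_sum => a _; rewrite mulr_sumr mulr_sumr; apply: ler_sum => b _.
apply: le_trans (trinom_le _ _ _ _ _ _) _ => //.
rewrite ler_wpM2r//; first by apply: poisM_ge0; exact: mulr_ge0.
rewrite ler_expR ler_wpM2r ?addr_ge0//.
by rewrite ler_nat; have := ltn_ord a; have := ltn_ord b; lia.
Qed.

Lemma sum_trinom0 n k (q : R) : (0 < k)%N ->
  \sum_(a < k) \sum_(b < k) trinom n a b q 0 =
  \sum_(a < k) 'C(n, a)%:R * q ^+ a * (1 - q) ^+ (n - a).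
Proof.
case: k => // k _; apply: eq_bigr => a _; rewrite big_ord_recl big1 ?addr0.
  by rewrite /trinom bin0 expr0 !mulr1 subr0 subn0.
by move=> b _; rewrite /trinom /= expr0n /= !(mulr0, mul0r).
Qed.

(** The falling factorial is [n ^ a] times the factors [1 - i / n] for [i < a], whose deficits add
    up to at most [a ^ 2 / n]. *)
Lemma bin_fact_ge n a : (0 < n)%N ->
  (1 - a%:R ^+ 2 / n%:R) * n%:R ^+ a <= ('C(n, a) * a`!)%:R :> R.
Proof.
move=> n0; have n0R : 0 < n%:R :> R by rewrite ltr0n.
rewrite bin_ffact; elim: a => [|a IH].
  by rewrite expr0n /= mul0r subr0 expr0 mulr1.
have [h|h] := lerP (1 - a.+1%:R ^+ 2 / n%:R : R) 0.
  by apply: le_trans (ler0n _ _); rewrite mulr_le0_ge0// exprn_ge0.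
have an : (a <= n)%N.
  rewrite leqNgt; apply/negP => na; move: h; rewrite subr_gt0 ltr_pdivrMr// mul1r.
  rewrite -natrX ltr_nat; nia.
rewrite ffactnSr natrM natrB//.
have a0 : 0 <= n%:R - a%:R :> R by rewrite subr_ge0 ler_nat.
apply: le_trans (ler_wpM2r a0 IH).
have -> : (1 - a%:R ^+ 2 / n%:R) * n%:R ^+ a * (n%:R - a%:R) =
  (1 - a%:R ^+ 2 / n%:R) * (1 - a%:R / n%:R) * n%:R ^+ a.+1 :> R.
  by rewrite [n%:R ^+ a.+1]exprSr; field; rewrite gt_eqF.
rewrite ler_wpM2r ?exprn_ge0// //.
rewrite -natr1; set u := _^-1.
have u0 : 0 <= u by rewrite invr_ge0 ltW.
have : 0 <= a%:R ^+ 2 * u * (a%:R * u) by rewrite !mulr_ge0 ?sqr_ge0.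
have : 0 <= a%:R * u by rewrite mulr_ge0.
lra.
Qed.

(** A relative form of [onem_expr_ge]: the error has to stay proportional to the small Poisson
    weight that it will multiply. *)
Lemma onem_expr_ge_expR (q : R) n : 0 <= q <= 1 ->
  expR (- (n%:R * q)) * (1 - n%:R * q ^+ 2) <= (1 - q) ^+ n.
Proof.
move=> /andP[v0 v1].
have v2 : 0 <= q ^+ 2 <= 1 by rewrite sqr_ge0 expr_le1.
have H : (1 - q ^+ 2) * expR (- q) <= 1 - q.
  have -> : 1 - q ^+ 2 = (1 - q) * (1 + q) by ring.
  rewrite -mulrA ler_piMr ?subr_ge0// expRN ler_pdivrMr ?expR_gt0// mul1r.
  exact: expR_ge1Dx.
have e0 : 0 <= 1 - q ^+ 2 by rewrite subr_ge0 (andP v2).2.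
have : ((1 - q ^+ 2) * expR (- q)) ^+ n <= (1 - q) ^+ n.
  by rewrite lerXn2r// nnegrE ?subr_ge0// mulr_ge0// expR_ge0.
apply: le_trans; rewrite exprMn -expRM_natr mulNr [q * _]mulrC [leLHS]mulrC.
by apply: ler_wpM2r; [exact: expR_ge0|exact: bernoulli_ineq].
Qed.

(** [k ^ 2 / n] is the loss in replacing falling factorials by powers, [n * q ^ 2] the loss in
    replacing [(1 - q) ^ n] by an exponential. *)
Lemma sum_binom_ge n k (q : R) : (0 < n)%N -> 0 <= q <= 1 ->
  (1 - k%:R ^+ 2 / n%:R - n%:R * q ^+ 2) * pois_lt k (n%:R * q) <=
  \sum_(a < k) 'C(n, a)%:R * q ^+ a * (1 - q) ^+ (n - a).
Proof.
move=> n0 /[dup] q01 /andP[q0 q1]; rewrite /pois_lt mulr_sumr; apply: ler_sum => a _.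
have n0R : 0 < n%:R :> R by rewrite ltr0n.
have af := fact_gt0R (R := R) a.
set x := k%:R ^+ 2 / n%:R; set y := n%:R * q ^+ 2.
have x0 : 0 <= x by rewrite divr_ge0 ?sqr_ge0.
have y0 : 0 <= y by rewrite mulr_ge0 ?sqr_ge0.
have [h|h] := lerP (1 - x - y) 0.
  apply: (@le_trans _ _ 0).
    by apply: mulr_le0_ge0 => //; apply: pois_ge0; exact: mulr_ge0.
  by rewrite !mulr_ge0 ?exprn_ge0// subr_ge0.
have H : expR (- (n%:R * q)) * (1 - y) <= (1 - q) ^+ (n - a).
  apply: le_trans (onem_expr_ge_expR n q01) _.
  by rewrite ler_wiXn2l ?leq_subr// ?subr_ge0//; lra.
have C : (1 - x) * (n%:R ^+ a / a`!%:R) <= 'C(n, a)%:R :> R.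
  rewrite mulrA ler_pdivrMr// -natrM; apply: le_trans (bin_fact_ge a n0).
  rewrite ler_wpM2r ?exprn_ge0 // lerD2l lerN2 ler_wpM2r ?invr_ge0 //.
  by rewrite lerXn2r ?nnegrE ?ler_nat// ltnW.
apply: (@le_trans _ _ ((1 - x) * (n%:R ^+ a / a`!%:R) * q ^+ a * (expR (- (n%:R * q)) * (1 - y)))).
  have -> : (1 - x) * (n%:R ^+ a / a`!%:R) * q ^+ a * (expR (- (n%:R * q)) * (1 - y)) =
    ((1 - x) * (1 - y)) * pois (n%:R * q) a by rewrite /pois exprMn; ring.
  rewrite ler_wpM2r//; first by apply: pois_ge0; exact: mulr_ge0.
  have : 0 <= x * y by exact: mulr_ge0.
  lra.
rewrite ler_pM// ?mulr_ge0 ?exprn_ge0 ?expR_ge0 ?divr_ge0 //; try lra.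
by rewrite ler_wpM2r// exprn_ge0.
Qed.

End trinomial_bounds.

Section poisson_mixing.
Context {R : realType}.
Local Open Scope ereal_scope.

Lemma integral_nat (kappa : {measure set nat -> \bar R}) (f : nat -> \bar R) :
  (forall n, 0 <= f n) ->
  \int[kappa]_n f n = \sum_(n <oo) f n * kappa [set n].
Proof.
move=> f0.
have -> : [set: nat] = \bigcup_n [set n] by apply/seteqP; split => // n _; exists n.
rewrite ge0_integral_bigcup//.
- apply: eq_eseriesr => n _.
  transitivity (\int[kappa]_(x in [set n]) (cst (f n) x)); last by rewrite integral_cst.
  by apply: eq_integral => x; rewrite inE => ->.
- by apply/trivIsetP => i j _ _ /eqP ij; apply/seteqP; split => // x [/= xi xj]; apply: ij; rewrite -xi.
Qed.

Lemma sum_poisson_pmf (t : R) : (0 < t)%R -> \sum_(n <oo) (poisson_pmf t n)%:E = 1.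
Proof.
move=> t0; have := @probability_setT _ _ _ (poisson_prob t 0).
rewrite /= /poisson_prob t0 => <-.
by rewrite nneseries_esumT// => n; rewrite lee_fin poisson_pmf_ge0.
Qed.

(** Thinning: a Poisson number of independent points puts independent Poisson numbers into disjoint
    regions. With [n = j + (a + b)], the sum over [j] is that of the Poisson weights of the
    remaining region. *)
Lemma sum_trinom_poisson (t q1 q2 : R) a b :
  (0 < t)%R -> (0 <= q1)%R -> (0 <= q2)%R -> (q1 + q2 < 1)%R ->
  \sum_(n <oo) (trinom n a b q1 q2 * poisson_pmf t n)%:E =
  (pois (t * q1) a * pois (t * q2) b)%:E.
Proof.
move=> t0 q10 q20 q12.
have g0 n : 0 <= (trinom n a b q1 q2 * poisson_pmf t n)%:E.
  by rewrite lee_fin mulr_ge0 ?poisson_pmf_ge0// trinom_ge0// ltW.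
rewrite (@nneseries_split _ _ 0 (a + b))//= add0n.
rewrite big1_seq ?add0e; last first.
  move=> n /andP[_]; rewrite mem_index_iota leq0n /= => nab.
  rewrite /trinom; have [ha|ha] := leqP a n; last by rewrite bin_small// !mul0r.
  by rewrite (@bin_small (n - a)%N) ?ltn_subLR// !(mulr0, mul0r).
rewrite -nneseries_addn//.
set c := (pois (t * q1) a * pois (t * q2) b)%R.
set s := (1 - q1 - q2)%R.
(* The weights [poisson_pmf (t * s)] sum to 1 only at a positive rate; at rate 0 they are all 1. *)
have s0 : (0 < s)%R by rewrite /s; lra.
under eq_eseriesr => j _.
  have -> : (trinom (j + (a + b)) a b q1 q2 * poisson_pmf t (j + (a + b)) =
     c * poisson_pmf (t * s) j)%R.
    rewrite /poisson_pmf t0 mulr_gt0// /trinom -/s.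
    have -> : (j + (a + b) - a = j + b)%N by lia.
    have -> : (j + b - b = j)%N by lia.
    have e : expR (- t) = (expR (- (t * q1)) * expR (- (t * q2)) * expR (- (t * s)))%R.
      by rewrite -!expRD; congr expR; rewrite /s; ring.
    have h : ('C(j + (a + b), a)%:R * 'C(j + b, b)%:R * (a`!%:R * b`!%:R * j`!%:R) = (j + (a + b))`!%:R :> R)%R.
      rewrite -!natrM; congr (_%:R)%R.
      have h1 := @bin_fact (j + (a + b)) a ltac:(lia).
      have h2 := @bin_fact (j + b) b ltac:(lia).
      have e1 : (j + (a + b) - a = j + b)%N by lia.
      have e2 : (j + b - b = j)%N by lia.
      by rewrite -h1 e1 -h2 e2; lia.
    rewrite e -h /c /pois.
    have af := gt_eqF (fact_gt0R (R := R) a).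
    have bf := gt_eqF (fact_gt0R (R := R) b).
    have jf := gt_eqF (fact_gt0R (R := R) j).
    have C1 : ('C(j + (a + b), a)%:R == 0 :> R)%R = false.
      by rewrite pnatr_eq0 eqn0Ngt bin_gt0; lia.
    have C2 : ('C(j + b, b)%:R == 0 :> R)%R = false.
      by rewrite pnatr_eq0 eqn0Ngt bin_gt0; lia.
    rewrite !exprMn !exprD; field.
    by rewrite C1 C2 af bf jf.
  rewrite EFinM; over.
rewrite nneseriesZl; last by move=> j _; rewrite lee_fin poisson_pmf_ge0.
by rewrite sum_poisson_pmf ?mule1// mulr_gt0.
Qed.

Lemma sum_sum_trinom_poisson (t q1 q2 : R) k :
  (0 < t)%R -> (0 <= q1)%R -> (0 <= q2)%R -> (q1 + q2 < 1)%R ->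
  \sum_(n <oo) ((\sum_(a < k) \sum_(b < k) trinom n a b q1 q2) * poisson_pmf t n)%:E =
  (pois_lt k (t * q1) * pois_lt k (t * q2))%:E.
Proof.
move=> t0 q10 q20 q12.
have g0 n a b : (0 <= trinom n a b q1 q2 * poisson_pmf t n)%R.
  by rewrite mulr_ge0 ?poisson_pmf_ge0// trinom_ge0// ltW.
rewrite /pois_lt mulr_suml -sumEFin.
transitivity (\sum_(n <oo) \sum_(a < k) \sum_(b < k) (trinom n a b q1 q2 * poisson_pmf t n)%:E).
  apply: eq_eseriesr => n _; rewrite mulr_suml -sumEFin; apply: eq_bigr => a _.
  by rewrite mulr_suml -sumEFin.
rewrite nneseries_sum; last by move=> a n _; apply: sume_ge0 => b _; rewrite lee_fin.
apply: eq_bigr => a _; rewrite nneseries_sum; last by move=> b n _; rewrite lee_fin.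
rewrite mulr_sumr -sumEFin; apply: eq_bigr => b _.
exact: sum_trinom_poisson.
Qed.

Lemma sum_poisson_pgf (u x : R) : (0 < u)%R -> (0 <= x <= 1)%R ->
  \sum_(n <oo) (poisson_pmf u n * x ^+ n)%:E = (expR (- (u * (1 - x))))%:E.
Proof.
move=> u0 /andP[x0 x1]; have [->|xn0] := eqVneq x 0%R.
  rewrite (@nneseries_split _ _ 0 1)//=; last first.
    by move=> n _; rewrite lee_fin mulr_ge0 ?poisson_pmf_ge0 ?exprn_ge0.
  rewrite add0n big_nat1 eseries0 ?adde0; last first.
    by move=> [|n]// _ _; rewrite expr0n mulr0.
  by rewrite /poisson_pmf u0 !expr0 fact0 invr1 !mul1r mulr1 subr0 mulr1.
have xp : (0 < x)%R by rewrite lt_def xn0.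
(* [x ^+ n] is the probability that none of [n] points hits a region of mass [1 - x]; [x = 0] was
   treated apart because this mass must be below 1. *)
have := @sum_trinom_poisson u (1 - x) 0 0 0 u0.
rewrite subr_ge0 addr0 => /(_ x1 (lexx _)).
have -> : (1 - x < 1)%R by lra.
move=> /(_ isT); rewrite mulr0 /pois !expr0 oppr0 expR0 fact0 !divr1 !mulr1 => <-.
apply: eq_eseriesr => n _.
rewrite /trinom !bin0 !expr0 !mulr1 !subn0 mul1r subr0 mulrC.
by congr ((_ ^+ n * _)%:E); lra.
Qed.

End poisson_mixing.

(** * Asymptotics of the Poisson tail at the critical mean *)

Section asymptotics.
Context {R : realType}.
Implicit Types L e x : R.

Lemma onepX_approx e n : `|e| <= 1 -> `|(1 + e) ^+ n - 1 - n%:R * e| <= 4 ^+ n * e ^+ 2.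
Proof.
move=> e1; elim: n => [|n IH].
  by rewrite expr0 subrr mul0r subr0 normr0 mul1r sqr_ge0.
have -> : (1 + e) ^+ n.+1 - 1 - n.+1%:R * e =
    (1 + e) * ((1 + e) ^+ n - 1 - n%:R * e) + n%:R * e ^+ 2.
  by rewrite [_ ^+ n.+1]exprS -natr1; ring.
have ne0 : 0 <= n%:R * e ^+ 2 by rewrite mulr_ge0 ?sqr_ge0.
apply: le_trans (ler_normD _ _) _; rewrite normrM (ger0_norm ne0).
have h1 : `|1 + e| <= 2 by rewrite (le_trans (ler_normD _ _))// normr1; lra.
have h2 : `|1 + e| * `|(1 + e) ^+ n - 1 - n%:R * e| <= 2 * (4 ^+ n * e ^+ 2).
  by rewrite ler_pM.
have h3 : n%:R * e ^+ 2 <= 4 ^+ n * e ^+ 2.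
  rewrite ler_wpM2r ?sqr_ge0// -natrX ler_nat.
  by rewrite ltnW// ltn_expl.
have h4 : 0 <= 4 ^+ n * e ^+ 2 by rewrite mulr_ge0 ?sqr_ge0 ?exprn_ge0.
rewrite [4 ^+ n.+1]exprS; lra.
Qed.

Lemma ln_le_2sqrt L : 1 <= L -> ln L <= 2 * Num.sqrt L.
Proof.
move=> L1; have s0 : 0 < Num.sqrt L by rewrite sqrtr_gt0; lra.
rewrite -{1}[L]sqr_sqrtr; last lra.
by rewrite lnXn// -mulr_natl; have := ln_sublinear s0; lra.
Qed.

Lemma ln_sqr_le L : 1 <= L -> ln L ^+ 2 <= 4 * L.
Proof.
move=> L1; have l0 : 0 <= ln L by rewrite ln_ge0.
have := ln_le_2sqrt L1 => h.
have -> : 4 * L = (2 * Num.sqrt L) ^+ 2 by rewrite exprMn sqr_sqrtr; lra.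
by rewrite lerXn2r// nnegrE mulr_ge0 ?sqrtr_ge0.
Qed.

Variables (K : nat) (beta : R).

(** With [L = ln t] and [K = k - 1], this is the mean number of sample points in a ball of the
    critical radius. *)
Definition rho L : R := L + K%:R * ln L + beta.

(** [64 * K ^ 2] makes [8 * K <= sqrt L], so that [K * ln L <= 2 * K * sqrt L <= L / 4]; the summand
    in [beta] makes the absolute value of [beta] at most [L / 4]. *)
Definition L_min : R := 64 * K%:R ^+ 2 + 4 * `|beta| + 4.

Lemma rho_bounds L : L_min <= L ->
  [/\ `|(K%:R * ln L + beta) / L| <= 1, L / 2 <= rho L & rho L <= 2 * L].
Proof.
rewrite /L_min => LL.
have K0 : 0 <= K%:R :> R by [].
have K2 : 0 <= K%:R ^+ 2 :> R by rewrite sqr_ge0.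
have b0 := normr_ge0 beta.
have L1 : 1 <= L by lra.
have l0 : 0 <= ln L by rewrite ln_ge0.
have h : K%:R * ln L <= L / 4.
  apply: le_trans (ler_wpM2l K0 (ln_le_2sqrt L1)) _.
  have s : 8 * K%:R <= Num.sqrt L.
    have -> : 8 * K%:R = Num.sqrt ((8 * K%:R) ^+ 2) :> R.
      by rewrite sqrtr_sqr ger0_norm// mulr_ge0.
    by rewrite ler_wsqrtr//; lra.
  have s0 := sqrtr_ge0 L.
  have e : Num.sqrt L * Num.sqrt L = L by rewrite -expr2 sqr_sqrtr; lra.
  have := ler_wpM2r s0 s; lra.
have kl0 : 0 <= K%:R * ln L by rewrite mulr_ge0.
have bb : - `|beta| <= beta <= `|beta| by rewrite -ler_norml.
move/andP: bb => [b1 b2].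
split.
- rewrite normrM [ `|L^-1|]ger0_norm ?invr_ge0; last lra.
  rewrite ler_pdivrMr; last lra.
  by rewrite mul1r ler_norml; apply/andP; split; lra.
- rewrite /rho; lra.
- rewrite /rho; lra.
Qed.

(** [expR (L - rho L)] equals [expR (- beta) / L ^+ K], which balances the growth of [rho L ^+ K]:
    only the term [a = K] survives as [L] grows. *)
Lemma expR_pois_rho L a : 0 < L -> (a <= K)%N ->
  expR L * pois (rho L) a =
  expR (- beta) / a`!%:R * (1 + (K%:R * ln L + beta) / L) ^+ a / L ^+ (K - a).
Proof.
move=> L0 aK; have af := gt_eqF (fact_gt0R (R := R) a).
have -> : 1 + (K%:R * ln L + beta) / L = rho L / L.
  by rewrite /rho; field; rewrite gt_eqF.
have -> : expR L * pois (rho L) a = expR (- beta) / a`!%:R * rho L ^+ a / L ^+ K.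
  have -> : L ^+ K = expR (K%:R * ln L) by rewrite expRM_natl lnK.
  rewrite /pois mulrA mulrA -expRD -expRN /rho.
  have -> : expR (L - (L + K%:R * ln L + beta)) = expR (- beta) * expR (- (K%:R * ln L)).
    by rewrite -expRD; congr expR; ring.
  by ring.
rewrite -{1}(subnKC aK) exprD expr_div_n; field.
by rewrite !expf_neq0 ?gt_eqF//= af.
Qed.

(** Terms with [a < K] keep a factor [1 / L]. In the term [a = K] the power [(1 + e) ^+ K] is
    expanded to first order: one factor [K] of [K ^ 2 * ln L / L] is the binomial coefficient, the
    other is the coefficient of [ln L] in [rho]. The remainder [e ^+ 2] is [O(1 / L)] because
    [ln L ^+ 2 <= 4 * L]. *)
Lemma expR_pois_lt_rho : exists2 C, 0 <= C & forall L, L_min <= L ->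
  `|expR L * pois_lt K.+1 (rho L) -
    expR (- beta) / K`!%:R * (1 + K%:R ^+ 2 * ln L / L)| <= C / L.
Proof.
pose c : R := expR (- beta) / K`!%:R.
have c0 : 0 <= c by rewrite divr_ge0 ?expR_ge0.
exists (K%:R * (2 ^+ K * expR (- beta)) + c * (4 ^+ K * (8 * K%:R ^+ 2 + 2 * beta ^+ 2) + K%:R * `|beta|)).
  have [k2 b2] := (sqr_ge0 (K%:R : R), sqr_ge0 beta).
  apply: addr_ge0; first by rewrite !mulr_ge0 ?exprn_ge0 ?expR_ge0.
  apply: mulr_ge0 => //; apply: addr_ge0; last exact: mulr_ge0.
  by apply: mulr_ge0; [exact: exprn_ge0|apply: addr_ge0; exact: mulr_ge0].
move=> L HL; have [h1 h2 h3] := rho_bounds HL.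
have b0 := normr_ge0 beta.
have K2 : 0 <= K%:R ^+ 2 :> R by rewrite sqr_ge0.
have L4 : 4 <= L by move: HL; rewrite /L_min; lra.
have L0 : 0 < L by lra.
have Lw : 0 <= L by lra.
have Li : 0 < L^-1 by rewrite invr_gt0.
have Liw := ltW Li.
set e := (K%:R * ln L + beta) / L in h1 *.
have ebd : `|1 + e| <= 2 by rewrite (le_trans (ler_normD _ _))// normr1; lra.
rewrite /pois_lt big_ord_recr /= mulrDr mulr_sumr (expR_pois_rho L0 (leqnn K)) subnn expr0 divr1 -/e -/c.
set S := \sum_(i < K) _.
have HS : `|S| <= K%:R * (2 ^+ K * expR (- beta)) / L.
  apply: le_trans (ler_norm_sum _ _ _) _.
  have -> : K%:R * (2 ^+ K * expR (- beta)) / L = \sum_(i < K) (2 ^+ K * expR (- beta) / L).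
    by rewrite sumr_const card_ord -[RHS]mulr_natl !mulrA.
  apply: ler_sum => a _; rewrite (expR_pois_rho L0 (ltnW (ltn_ord a))) -/e.
  rewrite !normrM !normfV normrX [ `|expR _|]ger0_norm ?expR_ge0//.
  rewrite [ `|L ^+ _|]ger0_norm ?exprn_ge0// [ `|a`!%:R|]ger0_norm//.
  have -> : expR (- beta) / a`!%:R * `|1 + e| ^+ a / L ^+ (K - a) =
    (`|1 + e| ^+ a) * expR (- beta) / (a`!%:R * L ^+ (K - a)) by rewrite invfM; ring.
  apply: ler_pM.
  - by rewrite mulr_ge0 ?exprn_ge0 ?expR_ge0.
  - by rewrite invr_ge0 mulr_ge0// exprn_ge0.
  - rewrite ler_wpM2r ?expR_ge0//.
    apply: (@le_trans _ _ (2 ^+ a)); first by rewrite lerXn2r ?nnegrE.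
    by rewrite ler_eXn2l ?ltr1n// ltnW.
  rewrite lef_pV2 ?posrE ?mulr_gt0 ?exprn_gt0 ?fact_gt0R//.
  have f1 : 1 <= a`!%:R :> R by rewrite ler1n fact_gt0.
  have l1 : L <= L ^+ (K - a).
    have -> : (K - a = (K - a).-1.+1)%N by rewrite prednK// subn_gt0.
    by rewrite exprS ler_peMr// exprn_ege1//; lra.
  by apply: le_trans l1 _; rewrite ler_peMl// exprn_ge0.
have He : e ^+ 2 <= (8 * K%:R ^+ 2 + 2 * beta ^+ 2) / L.
  have L1 : 1 <= L by lra.
  have := ln_sqr_le L1 => hl.
  rewrite /e expr_div_n [L ^+ 2]expr2 invfM mulrA ler_wpM2r//.
  rewrite ler_pdivrMr//.
  have s1 : (K%:R * ln L + beta) ^+ 2 <= 2 * (K%:R ^+ 2 * ln L ^+ 2) + 2 * beta ^+ 2.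
    have := sqr_ge0 (K%:R * ln L - beta); nra.
  have s2 := ler_wpM2l K2 hl.
  have s3 : beta ^+ 2 <= beta ^+ 2 * L by rewrite ler_peMr ?sqr_ge0.
  lra.
have H := onepX_approx K h1.
have -> : S + c * (1 + e) ^+ K - c * (1 + K%:R ^+ 2 * ln L / L) =
   S + c * (((1 + e) ^+ K - 1 - K%:R * e) + K%:R * beta / L).
  by rewrite /e; field; rewrite gt_eqF.
apply: le_trans (ler_normD _ _) _.
rewrite [leRHS]mulrDl lerD// normrM (ger0_norm c0) -[leRHS]mulrA; apply: ler_wpM2l => //.
apply: le_trans (ler_normD _ _) _; rewrite mulrDl lerD//.
  by apply: le_trans H _; rewrite -[leRHS]mulrA; apply: ler_wpM2l => //; exact: exprn_ge0.
by rewrite !normrM normfV (ger0_norm (ler0n R K)) (ger0_norm Lw).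
Qed.

End asymptotics.

(** * Lebesgue measure of Euclidean balls *)

Lemma lebesgue_measure_affine (R : realType) (c x : R) (A : set (measurableTypeR R)) :
  0 < c -> measurable A ->
  (c%:E * lebesgue_measure [set t : measurableTypeR R | A (c * t + x)%R] = lebesgue_measure A)%E.
Proof.
move=> c0 mA.
pose g (t : measurableTypeR R) : measurableTypeR R := c * t + x.
have mg : measurable_fun setT g.
  by apply: measurable_funD => //; exact: measurable_funM.
have c0' : 0 <= c by exact: ltW.
pose nu := mscale (NngNum c0') (pushforward lebesgue_measure g).
apply/esym; rewrite -[RHS]/(nu mg A).
apply: lebesgue_measure_unique => // _ [[a b] _ <-].
rewrite /nu /= /mscale /= /pushforward.
have -> : g @^-1` `]a, b] = [set` `](a - x) / c, (b - x) / c]].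
  apply/seteqP; split => t /=; rewrite /g !in_itv /= ltr_pdivrMr// ler_pdivlMr//.
    by rewrite ltrBlDr lerBrDr ![t * c]mulrC.
  by rewrite ltrBlDr lerBrDr ![t * c]mulrC.
rewrite !lebesgue_measure_itv /= !lte_fin ltr_pM2r ?invr_gt0// ltrD2r.
case: ifP => _; last by rewrite mule0.
by rewrite -!EFinD -EFinM; congr EFin; field; rewrite gt_eqF.
Qed.

Section rV_rectangles.
Context {R : realType} {n : nat}.
Implicit Types B : set 'rV[R]_n.

Lemma measurable_coord (i : 'I_n) :
  measurable_fun [set: 'rV[R]_n] (fun v : 'rV[R]_n => v ord0 i : measurableTypeR R).
Proof.
apply: (measurability _ (RGenOpens.measurableE R)) => _ [U oU <-]; rewrite setTI.
apply: sub_sigma_algebra; rewrite /rV_open.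
apply: (@open_comp _ _ (fun v : 'rV[R]_n => v ord0 i)) => [v _|].
  exact: coord_continuous.
by case: oU => x [y ->]; exact: interval_open.
Qed.

Lemma measurable_fun_rV d (T : measurableType d) (f : T -> 'rV[R]_n) :
  (forall i, measurable_fun setT (fun t => f t ord0 i : measurableTypeR R)) ->
  measurable_fun setT f.
Proof.
move=> mf.
pose h t : n.-tuple (measurableTypeR R) := [tuple f t ord0 i | i < n].
have mh : measurable_fun setT h.
  apply/measurable_fun_tnthP => i.
  by rewrite (_ : _ \o _ = fun t => f t ord0 i)//; apply/funext => t /=; rewrite tnth_mktuple.
have -> : f = row_of_tuple \o h.
  by apply/funext => t; apply/rowP => i; rewrite mxE tnth_mktuple.
by apply: measurableT_comp => //; exact: measurable_row_of_tuple.
Qed.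

Definition rectangle : set (set 'rV[R]_n) :=
  [set B | exists2 A : 'I_n -> set (measurableTypeR R), (forall i, measurable (A i)) &
    B = [set v : 'rV[R]_n | forall i, A i (v ord0 i)]].

Lemma measurable_rectangle : rectangle `<=` measurable.
Proof.
move=> _ [A mA ->].
rewrite (_ : [set v | _] = \bigcap_(i in [set: 'I_n])
    ((fun v : 'rV[R]_n => v ord0 i) @^-1` A i)); last first.
  by apply/seteqP; split=> [v h i _|v h i] /=; exact: h.
apply: fin_bigcap_measurable => [|i _]; first exact: finite_finset.
by rewrite -[X in measurable X]setTI; exact: measurable_coord.
Qed.

Lemma measurable_rV_rectangle : @measurable _ 'rV[R]_n = <<s rectangle >>.
Proof.
apply/seteqP; split; last first.
  by apply: smallest_sub; [exact: sigma_algebra_measurable|exact: measurable_rectangle].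
move=> B mB.
(* The identity from the rectangle sigma-algebra is Borel measurable because its coordinates are
   measurable. *)
pose id' (v : g_sigma_algebraType rectangle) : 'rV[R]_n := v.
have mid : measurable_fun setT id'.
  apply: measurable_fun_rV => i _ A mA; rewrite setTI.
  apply: sub_sigma_algebra; exists (fun j => if j == i then A else setT).
    by move=> j; case: ifP.
  apply/seteqP; split => [v Av j|v /(_ i)] /=; last by rewrite eqxx.
  by case: eqP => // ->.
by have := mid measurableT B mB; rewrite setTI.
Qed.

(** Rectangles form a generating pi-system, and the centred cubes of integer half-side exhaust the
    space. *)
Lemma rV_measure_unique (m1 m2 : {measure set 'rV[R]_n -> \bar R}) :
  (forall A : 'I_n -> set (measurableTypeR R), (forall i, measurable (A i)) ->
    m1 [set v : 'rV[R]_n | forall i, A i (v ord0 i)] = m2 [set v : 'rV[R]_n | forall i, A i (v ord0 i)]) ->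
  (forall r : R, 0 < r ->
    (m1 [set v : 'rV[R]_n | forall i, `[(- r)%R, r]%classic (v ord0 i)] < +oo)%E) ->
  forall B, measurable B -> m1 B = m2 B.
Proof.
move=> m12 m1fin B mB.
apply: (@measure_unique _ _ _ rectangle
  (fun k => [set v : 'rV[R]_n | forall i, `[- k.+1%:R, k.+1%:R]%classic (v ord0 i)])) => //.
- exact: measurable_rV_rectangle.
- move=> _ _ [A mA ->] [A' mA' ->]; exists (fun i => A i `&` A' i).
    by move=> i; exact: measurableI.
  by apply/seteqP; split => [v [h h'] i|v h]; [split|split => i; case: (h i)].
- by move=> k; exists (fun=> `[- k.+1%:R, k.+1%:R]%classic) => // i; exact: measurable_itv.
- apply/seteqP; split => // v _.
  exists (Num.truncn (\sum_i `|v ord0 i|)) => // i /=; rewrite in_itv /= -ler_norml.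
  apply: (@le_trans _ _ (\sum_i `|v ord0 i|)).
    by rewrite (bigD1 i)//= lerDl sumr_ge0.
  exact/ltW/truncnS_gt.
- by move=> _ [A mA ->]; exact: m12.
- by move=> k; exact: m1fin.
Qed.

Lemma lebesgue_rV_cube (r : R) : 0 < r ->
  lebesgue_rV [set v : 'rV[R]_n | forall i, `[- r, r]%classic (v ord0 i)] = ((2 * r) ^+ n)%:E.
Proof.
move=> r0; pose A (i : 'I_n) : set (measurableTypeR R) := `[- r, r]%classic.
have := @lebesgue_rV_box R n A (fun i => measurable_itv _) => /= ->.
under eq_bigr do rewrite /A lebesgue_measure_itv /= lte_fin gtrN// -EFinD opprK -mulr2n -mulr_natl.
by elim: (n) => [|k IH]; rewrite ?big_ord0// big_ord_recl IH -EFinM exprS.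
Qed.

Lemma lebesgue_rV_affine (c : R) (x : 'rV[R]_n) B : 0 < c -> measurable B ->
  (lebesgue_rV B = (c ^+ n)%:E * lebesgue_rV [set v | B (c *: v + x)%R])%E.
Proof.
move=> c0 mB.
pose g (v : 'rV[R]_n) : 'rV[R]_n := c *: v + x.
have mg : measurable_fun setT g.
  apply: measurable_fun_rV => i.
  rewrite (_ : (fun _ => _) = (fun v : 'rV[R]_n => c * v ord0 i + x ord0 i)).
    apply: measurable_funD => //; apply: measurable_funM => //; exact: measurable_coord.
  by apply/funext => v; rewrite /g !mxE.
have c0' : 0 <= c ^+ n by rewrite exprn_ge0// ltW.
pose nu := mscale (NngNum c0') (pushforward lebesgue_rV g).
rewrite -[RHS]/(nu mg B).
apply: rV_measure_unique => // [A mA|r r0].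
  rewrite /nu /= /mscale /= /pushforward lebesgue_rV_box//.
  have -> : g @^-1` [set v : 'rV[R]_n | forall i, A i (v ord0 i)] =
      [set v : 'rV[R]_n | forall i, [set t : measurableTypeR R | A i (c * t + x ord0 i)] (v ord0 i)].
    by apply/seteqP; split => v /= h i; have := h i; rewrite /g !mxE.
  rewrite (@lebesgue_rV_box _ _ (fun i => [set t : measurableTypeR R | A i (c * t + x ord0 i)])); last first.
    move=> i; pose f (t : measurableTypeR R) : measurableTypeR R := c * t + x ord0 i.
    have mf : measurable_fun setT f.
      by apply: measurable_funD => //; exact: measurable_funM.
    by have := mf measurableT _ (mA i); rewrite setTI.
  have -> : (c ^+ n)%:E = (\big[*%E/1%E]_(i < n) c%:E)%E.
    by elim: (n) => [|k IH]; rewrite ?big_ord0// big_ord_recl -IH -EFinM exprS.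
  rewrite -big_split /=; apply: eq_bigr => i _.
  by rewrite lebesgue_measure_affine.
by have := ltry ((2 * r) ^+ n); rewrite -(lebesgue_rV_cube r0).
Qed.

End rV_rectangles.

Section euclid_norm_theory.
Context {R : realType} {n : nat}.
Implicit Types u v x y : 'rV[R]_n.

Lemma euclid_norm_sum_ge0 v : 0 <= \sum_(i < n) v ord0 i ^+ 2.
Proof. by apply: sumr_ge0 => i _; exact: sqr_ge0. Qed.

Lemma euclid_norm_ge0 v : 0 <= euclid_norm v.
Proof. exact: sqrtr_ge0. Qed.

Lemma euclid_norm_sqr v : euclid_norm v ^+ 2 = \sum_(i < n) v ord0 i ^+ 2.
Proof. by rewrite sqr_sqrtr// euclid_norm_sum_ge0. Qed.

Lemma euclid_norm_le v (r : R) : 0 <= r ->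
  (euclid_norm v <= r) = (\sum_(i < n) v ord0 i ^+ 2 <= r ^+ 2).
Proof.
move=> r0; rewrite -euclid_norm_sqr ler_pXn2r// nnegrE//; exact: euclid_norm_ge0.
Qed.

Lemma euclid_normZ (c : R) v : euclid_norm (c *: v) = `|c| * euclid_norm v.
Proof.
rewrite /euclid_norm -sqrtr_sqr -sqrtrM ?sqr_ge0//; congr Num.sqrt.
by rewrite mulr_sumr; apply: eq_bigr => i _; rewrite mxE exprMn.
Qed.

Lemma euclid_normN v : euclid_norm (- v) = euclid_norm v.
Proof. by rewrite -scaleN1r euclid_normZ normrN1 mul1r. Qed.

Lemma euclid_norm0 : euclid_norm (0 : 'rV[R]_n) = 0.
Proof. by rewrite -(scale0r 0) euclid_normZ normr0 mul0r. Qed.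

Lemma euclid_distC x y : euclid_norm (x - y) = euclid_norm (y - x).
Proof. by rewrite -euclid_normN opprB. Qed.

Lemma coord_le_euclid_norm v i : `|v ord0 i| <= euclid_norm v.
Proof.
rewrite -sqrtr_sqr ler_wsqrtr// (bigD1 i)//= lerDl.
by apply: sumr_ge0 => j _; exact: sqr_ge0.
Qed.

Lemma euclid_norm_eq0 v : (euclid_norm v == 0) = (v == 0).
Proof.
apply/eqP/eqP => [v0|->]; last exact: euclid_norm0.
apply/rowP => i; rewrite mxE; apply/eqP; rewrite -normr_le0 -v0.
exact: coord_le_euclid_norm.
Qed.

Lemma cauchy_schwarz_sum u v :
  \sum_(i < n) u ord0 i * v ord0 i <= euclid_norm u * euclid_norm v.
Proof.
have [/eqP|u0] := eqVneq (euclid_norm u) 0.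
  rewrite euclid_norm_eq0 => /eqP ->; rewrite euclid_norm0 mul0r big1// => i _.
  by rewrite mxE mul0r.
have [/eqP|v0] := eqVneq (euclid_norm v) 0.
  rewrite euclid_norm_eq0 => /eqP ->; rewrite euclid_norm0 mulr0 big1// => i _.
  by rewrite mxE mulr0.
have u1 : 0 < euclid_norm u by rewrite lt_def u0 euclid_norm_ge0.
have v1 : 0 < euclid_norm v by rewrite lt_def v0 euclid_norm_ge0.
set a := euclid_norm u in u0 u1 *; set b := euclid_norm v in v0 v1 *.
(* Sums [0 <= (b * u_i - a * v_i) ^ 2], where [a] and [b] are the two norms. *)
have : \sum_(i < n) (2 * (a * b)) * (u ord0 i * v ord0 i) <=
    \sum_(i < n) (b ^+ 2 * u ord0 i ^+ 2 + a ^+ 2 * v ord0 i ^+ 2).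
  by apply: ler_sum => i _; have := sqr_ge0 (b * u ord0 i - a * v ord0 i); nra.
rewrite big_split /= -!mulr_sumr -!euclid_norm_sqr -/a -/b.
have -> : b ^+ 2 * a ^+ 2 + a ^+ 2 * b ^+ 2 = (2 * (a * b)) * (a * b) by ring.
by rewrite ler_pM2l// mulr_gt0// mulr_gt0.
Qed.

Lemma euclid_normD u v : euclid_norm (u + v) <= euclid_norm u + euclid_norm v.
Proof.
rewrite euclid_norm_le; last by rewrite addr_ge0 ?euclid_norm_ge0.
have -> : \sum_(i < n) (u + v) ord0 i ^+ 2 =
   euclid_norm u ^+ 2 + 2 * \sum_(i < n) u ord0 i * v ord0 i + euclid_norm v ^+ 2.
  rewrite !euclid_norm_sqr mulr_sumr -!big_split /=; apply: eq_bigr => i _.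
  by rewrite mxE; ring.
by have := cauchy_schwarz_sum u v; lra.
Qed.

Lemma euclid_norm_le_cube v (r : R) : 0 <= r -> (forall i, `|v ord0 i| <= r) ->
  euclid_norm v <= n%:R * r.
Proof.
move=> r0 vr; rewrite euclid_norm_le ?mulr_ge0//.
apply: (@le_trans _ _ (\sum_(i < n) r ^+ 2)).
  by apply: ler_sum => i _; rewrite -real_normK ?num_real// lerXn2r ?nnegrE.
rewrite sumr_const card_ord exprMn -[leLHS]mulr_natl ler_wpM2r ?sqr_ge0//.
by rewrite -natrX ler_nat; nia.
Qed.

Lemma measurable_euclid_dist d (T : measurableType d) (f g : T -> 'rV[R]_n) :
  measurable_fun setT f -> measurable_fun setT g ->
  measurable_fun setT (fun t => euclid_norm (f t - g t) : measurableTypeR R).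
Proof.
move=> mf mg; rewrite (_ : (fun t => _) =
    Num.sqrt \o (fun t => \sum_(i < n) (f t - g t) ord0 i ^+ 2 : R))//.
apply: measurableT_comp.
  by apply: continuous_measurable_fun; exact: sqrt_continuous.
apply: measurable_sum => i; apply: measurable_funX.
rewrite (_ : (fun _ => _) = (fun t => f t ord0 i - g t ord0 i)).
  by apply: measurable_funB; (apply: (measurableT_comp (f := fun v : 'rV[R]_n => v ord0 i)); [exact: measurable_coord|]).
by apply/funext => t; rewrite !mxE.
Qed.

Lemma measurable_euclid_cball x (r : R) : measurable (euclid_cball x r).
Proof.
pose f (y : 'rV[R]_n) : measurableTypeR R := euclid_norm (y - x).
have mf : measurable_fun setT f by exact: measurable_euclid_dist.
have := mf measurableT `]-oo, r]%classic (measurable_itv _).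
by rewrite setTI.
Qed.

Lemma lebesgue_rV_translate x (B : set 'rV[R]_n) : measurable B ->
  lebesgue_rV [set v | B (v + x)] = lebesgue_rV B.
Proof.
move=> mB; rewrite (@lebesgue_rV_affine _ _ 1 x B)// expr1n mul1e.
by congr lebesgue_rV; apply/seteqP; split => v /=; rewrite scale1r.
Qed.

Lemma measurable_cube (r : R) :
  measurable [set v : 'rV[R]_n | forall i, `[- r, r]%classic (v ord0 i)].
Proof.
apply: measurable_rectangle.
by exists (fun=> `[- r, r]%classic) => // i; exact: measurable_itv.
Qed.

Lemma lebesgue_rV_lty (B : set 'rV[R]_n) (r : R) : measurable B ->
  (forall v, B v -> forall i, `|v ord0 i| <= r) -> (lebesgue_rV B < +oo)%E.
Proof.
move=> mB Br.
have r0 : 0 < `|r| + 1 by have := normr_ge0 r; lra.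
have := ltry ((2 * (`|r| + 1)) ^+ n); rewrite -(lebesgue_rV_cube r0).
apply: le_lt_trans; apply: le_measure; rewrite ?inE//.
  exact: measurable_cube.
move=> v /Br h i /=; rewrite in_itv /= -ler_norml.
by have := h i; have := ler_norm r; lra.
Qed.

Lemma lebesgue_euclid_cball_lty x (r : R) : (lebesgue_rV (euclid_cball x r) < +oo)%E.
Proof.
apply: (@lebesgue_rV_lty _ (euclid_norm x + r)); first exact: measurable_euclid_cball.
move=> v vr i; apply: le_trans (coord_le_euclid_norm _ _) _.
have -> : v = x + (v - x) by rewrite addrC subrK.
by apply: le_trans (euclid_normD _ _) _; rewrite lerD2l.
Qed.

Lemma unit_ball_volE :
  lebesgue_rV (euclid_cball (0 : 'rV[R]_n) 1) = (unit_ball_vol R n)%:E.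
Proof.
by rewrite /unit_ball_vol /vol fineK// ge0_fin_numE ?measure_ge0// lebesgue_euclid_cball_lty.
Qed.

Lemma lebesgue_euclid_cball x (r : R) : 0 < r ->
  lebesgue_rV (euclid_cball x r) = (unit_ball_vol R n * r ^+ n)%:E.
Proof.
move=> r0; rewrite (@lebesgue_rV_affine _ _ r x)//; last exact: measurable_euclid_cball.
rewrite mulrC EFinM -unit_ball_volE; congr (_ * lebesgue_rV _)%E.
apply/seteqP; split => v; rewrite /euclid_cball /= subr0 addrK euclid_normZ gtr0_norm//.
  by rewrite -ler_pdivlMl// mulVf// gt_eqF.
by rewrite -[X in _ -> _ <= X]mulr1 ler_pM2l.
Qed.

Lemma unit_ball_vol_gt0 : (0 < n)%N -> 0 < unit_ball_vol R n.
Proof.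
move=> n0; rewrite -lte_fin -unit_ball_volE.
have n1 : 0 < n%:R^-1 :> R by rewrite invr_gt0 ltr0n.
apply: (@lt_le_trans _ _ (((2 * n%:R^-1) ^+ n)%:E : \bar R)).
  by rewrite lte_fin exprn_gt0// mulr_gt0.
rewrite -(lebesgue_rV_cube n1); apply: le_measure; rewrite ?inE.
- exact: measurable_cube.
- exact: measurable_euclid_cball.
move=> v vn; rewrite /euclid_cball /= subr0.
apply: le_trans (@euclid_norm_le_cube v n%:R^-1 (ltW n1) _) _.
  by move=> i; have := vn i; rewrite /= in_itv /= -ler_norml.
by rewrite mulfV// gt_eqF// ltr0n.
Qed.

Lemma lebesgue_rV_set1 x : (0 < n)%N -> lebesgue_rV [set x] = 0%E.
Proof.
move=> n0; have -> : [set x] = [set v : 'rV[R]_n | forall i, [set x ord0 i] (v ord0 i)].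
  apply/seteqP; split => v /=; first by move=> ->.
  by move=> h; apply/rowP => i; exact: h.
rewrite (@lebesgue_rV_box _ _ (fun i => [set x ord0 i])); last by move=> i; exact: measurable_set1.
by case: n n0 x => // k _ x; rewrite big_ord_recl lebesgue_measure_set1 mul0e.
Qed.

End euclid_norm_theory.

Section ball_differences.
Context {R : realType} {n : nat}.
Implicit Types (x y z : 'rV[R]_n) (r : R).

Lemma euclid_cball_far x y r : 2 * r < euclid_norm (y - x) ->
  euclid_cball y r `\` euclid_cball x r = euclid_cball y r.
Proof.
move=> h; apply/seteqP; split => [v []//|v vy]; split => //; rewrite /euclid_cball /= in vy * => vx.
have := euclid_normD (y - v) (v - x); rewrite addrA subrK.
by rewrite (euclid_distC y v); lra.
Qed.

Lemma lebesgue_cball_far x y r : 0 < r -> 2 * r < euclid_norm (y - x) ->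
  lebesgue_rV (euclid_cball y r `\` euclid_cball x r) = (unit_ball_vol R n * r ^+ n)%:E.
Proof. by move=> r0 h; rewrite euclid_cball_far// lebesgue_euclid_cball. Qed.

Lemma measurable_cballD x y r : measurable (euclid_cball y r `\` euclid_cball x r).
Proof. by apply: measurableD; exact: measurable_euclid_cball. Qed.

Lemma lebesgue_cballD_translate x y z r :
  lebesgue_rV (euclid_cball (y + z) r `\` euclid_cball (x + z) r) =
  lebesgue_rV (euclid_cball y r `\` euclid_cball x r).
Proof.
rewrite -(lebesgue_rV_translate z); last exact: measurable_cballD.
by congr lebesgue_rV; apply/seteqP; split => v; rewrite /euclid_cball /= ![y + z]addrC ![x + z]addrC !opprD !addrA !addrK.
Qed.

Lemma lebesgue_cballD_chain x z r N :
  (lebesgue_rV (euclid_cball (x + z *+ N) r `\` euclid_cball x r) <=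
   N%:R%:E * lebesgue_rV (euclid_cball (x + z) r `\` euclid_cball x r))%E.
Proof.
elim: N => [|N IH].
  by rewrite mulr0n addr0 setDv measure0 mul0e.
set B := euclid_cball (x + z *+ N) r.
apply: (@le_trans _ _ (lebesgue_rV ((B `\` euclid_cball x r) `|`
    (euclid_cball (x + z *+ N.+1) r `\` B)))%E).
  apply: le_measure; rewrite ?inE.
  - exact: measurable_cballD.
  - by apply: measurableU; exact: measurable_cballD.
  - by move=> v [h1 h2]; have [h|h] := pselect (B v); [left|right].
apply: le_trans (measureU2 _ _ _) _; try exact: measurable_cballD.
rewrite -natr1 EFinD ge0_muleDl// mul1e leeD//.
have -> : x + z *+ N.+1 = (x + z) + z *+ N by rewrite mulrS addrA.
by rewrite le_eqVlt; apply/orP; left; apply/eqP; exact: lebesgue_cballD_translate.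
Qed.

Lemma lebesgue_cballD_lty x y r : (lebesgue_rV (euclid_cball y r `\` euclid_cball x r) < +oo)%E.
Proof.
apply: le_lt_trans (lebesgue_euclid_cball_lty y r); apply: le_measure; rewrite ?inE.
- exact: measurable_cballD.
- exact: measurable_euclid_cball.
- exact: subDsetl.
Qed.

(* Moving the ball along N equal steps covers it by N translates of the same
   difference set, so no geometry beyond the triangle inequality is needed. *)
Lemma lebesgue_cballD_ge x y r : 0 < r -> euclid_norm (y - x) <= 2 * r ->
  ((unit_ball_vol R n * r ^+ n * (euclid_norm (y - x) / (4 * r)))%:E <=
   lebesgue_rV (euclid_cball y r `\` euclid_cball x r))%E.
Proof.
move=> r0 h; set s := euclid_norm (y - x) in h *.
have [s0|s0] := eqVneq s 0; first by rewrite s0 mul0r mulr0 measure_ge0.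
have s1 : 0 < s by rewrite lt_def s0 euclid_norm_ge0.
(* Enough steps of length [s] to move the ball further than [2 * r], off the original one;
   [s <= 2 * r] then gives [N <= 4 * r / s], the origin of the 4 in the statement. *)
pose N := (Num.truncn (2 * r / s)).+1.
have N1 : 2 * r < N%:R * s by rewrite -ltr_pdivrMr// truncnS_gt.
have N2 : N%:R <= 4 * r / s.
  have h1 : (Num.truncn (2 * r / s))%:R <= 2 * r / s :> R.
    by rewrite truncn_le; apply: divr_ge0; [lra|exact: ltW].
  have h2 : 1 <= 2 * r / s by rewrite ler_pdivlMr// mul1r.
  by rewrite /N -natr1; lra.
have N0 : 0 < N%:R :> R by rewrite ltr0n.
have := lebesgue_cballD_chain x (y - x) r N.
rewrite lebesgue_cball_far//; last first.
  by rewrite [x + _]addrC addrK -(scaler_nat N) euclid_normZ ger0_norm.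
rewrite [x + (y - x)]addrC subrK.
have D_fin : lebesgue_rV (euclid_cball y r `\` euclid_cball x r) \is a fin_num.
  by rewrite ge0_fin_numE ?measure_ge0// lebesgue_cballD_lty.
rewrite -(fineK D_fin); set D := fine _.
rewrite -EFinM !lee_fin => H.
have D0 : 0 <= D by rewrite fine_ge0// measure_ge0.
rewrite mulrA ler_pdivrMr ?mulr_gt0//.
have := ler_wpM2r (ltW s1) H => /le_trans; apply.
have N3 : N%:R * s <= 4 * r by rewrite -ler_pdivlMr.
by have := ler_wpM2l D0 N3; lra.
Qed.

End ball_differences.

Section interior_balls.
Context {R : realType} {n : nat}.
Implicit Types (A B : set 'rV[R]_n).

Lemma compact_measurable_rV A : compact A -> measurable A.
Proof.
move=> /compact_closed => /(_ (@norm_hausdorff _ _)) cA.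
rewrite -[A]setCK; apply: measurableC; apply: sub_sigma_algebra.
by rewrite /rV_open openC.
Qed.

Lemma compact_lebesgue_rV_lty A : compact A -> (lebesgue_rV A < +oo)%E.
Proof.
move=> cA; have [M [_ Mb]] := compact_bounded cA.
apply: (@lebesgue_rV_lty _ _ _ (M + 1)); first exact: compact_measurable_rV.
move=> v Av i; apply: (le_trans _ (Mb (M + 1) _ v Av)); last by rewrite ltrDl.
by rewrite [leRHS]/Num.norm /= mx_normrE; apply/bigmax_geP; right => /=; exists (ord0, i).
Qed.

(** Compactness of [closure B] makes the radius uniform. The sets [ball] are those of the sup norm,
    which the Euclidean norm dominates. *)
Lemma interior_margin A B : compact A -> closure B `<=` interior A ->
  exists2 e : R, 0 < e & forall y, B y -> euclid_cball y e `<=` A.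
Proof.
move=> cA BA.
have cB : compact (closure B).
  apply: subclosed_compact cA _; first exact: closed_closure.
  exact: subset_trans BA (@interior_subset _ _).
have /compact_near_coveringP := cB.
move=> /(_ R (0^'+) (fun e y => ball y e `<=` A) _) [].
  move=> x /BA /nbhs_ballP[e /= e0 eA].
  have e20 : 0 < e / 2 by rewrite divr_gt0.
  exists (ball x (e / 2), [set e' : R | e' < e / 2]) => /=.
    split; first exact: nbhsx_ballx.
    exact: nbhs_right_lt.
  move=> [x' e'] /= [xx' ee'] z xz; apply: eA.
  rewrite [e]splitr; apply: ball_triangle xx' _.
  exact: le_ball (ltW ee') _ xz.
move=> e /= e0 H; exists (e / 4); first by rewrite divr_gt0.
have e20 : 0 < e / 2 by rewrite divr_gt0.
have eA : closure B `<=` [set y | ball y (e / 2) `<=` A].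
  apply: (H (e / 2)) => //=; rewrite /ball_ /= sub0r normrN gtr0_norm//; lra.
move=> y /(@subset_closure _ B) /eA yA v vy; apply: yA; split => // i j.
rewrite (ord1 i) /ball /= distrC; have := coord_le_euclid_norm (v - y) j.
by rewrite !mxE; rewrite /euclid_cball /= in vy; lra.
Qed.

End interior_balls.

Section shells.
Context {R : realType}.

Lemma geometric_sum_le (q : R) J : 0 <= q < 1 -> \sum_(j < J) q ^+ j <= (1 - q)^-1.
Proof.
move=> /andP[q0 q1]; have q1' : 0 < 1 - q by lra.
rewrite -[leRHS]mul1r ler_pdivlMr//.
suff -> : (\sum_(j < J) q ^+ j) * (1 - q) = 1 - q ^+ J by rewrite gerBl exprn_ge0.
elim: J => [|J IH]; first by rewrite big_ord0 mul0r expr0 subrr.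
by rewrite big_ord_recr /= mulrDl IH exprS; ring.
Qed.

(** Half of the exponent beats the power of [j.+1] up to a constant; the other half leaves a
    geometric series. *)
Lemma sum_expr_expRN_bounded (kappa : R) n : 0 < kappa ->
  exists2 S : R, 0 <= S &
    forall J, \sum_(j < J) j.+1%:R ^+ n * expR (- (kappa * j%:R)) <= S.
Proof.
move=> k0; set q := expR (- (kappa / 2)).
have q1 : 0 <= q < 1 by rewrite expR_ge0 expR_lt1; lra.
pose D : R := n`!%:R * (2 / kappa) ^+ n * expR kappa.
have D0 : 0 <= D.
  by rewrite /D !mulr_ge0 ?expR_ge0// exprn_ge0// divr_ge0// ltW.
exists (D * (1 - q)^-1).
  by rewrite mulr_ge0// invr_ge0; case/andP: q1; lra.
move=> J; apply: le_trans (ler_wpM2l D0 (geometric_sum_le J q1)).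
rewrite mulr_sumr; apply: ler_sum => j _.
have x0 : 0 <= kappa / 2 * j.+1%:R by rewrite mulr_ge0// divr_ge0// ltW.
have := expr_fact_le_expR n x0.
rewrite ler_pdivrMr ?fact_gt0R// exprMn => h.
have -> : q ^+ j = expR (- (kappa / 2 * j%:R)) by rewrite -expRM_natr mulNr.
have k2 : 0 <= (2 / kappa) ^+ n by rewrite exprn_ge0// divr_ge0// ltW.
have := ler_wpM2l k2 h; rewrite mulrA -exprMn.
have -> : 2 / kappa * (kappa / 2) = 1 by field; rewrite gt_eqF.
rewrite expr1n mul1r => /(ler_wpM2r (expR_ge0 (- (kappa * j%:R)))) /le_trans; apply.
have -> : (2 / kappa) ^+ n * (expR (kappa / 2 * j.+1%:R) * n`!%:R) * expR (- (kappa * j%:R)) =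
  (n`!%:R * (2 / kappa) ^+ n) * (expR (kappa / 2 * j.+1%:R) * expR (- (kappa * j%:R))) by ring.
rewrite /D -[leRHS]mulrA; apply: ler_wpM2l; first by rewrite mulr_ge0.
by rewrite -!expRD ler_expR -[j.+1%:R]natr1; lra.
Qed.

(** The summand [j = Num.truncn u] alone dominates the left side. *)
Lemma expRN_le_shells (kappa u : R) J : 0 <= kappa -> 0 <= u -> u < J%:R ->
  expR (- (kappa * u)) <= \sum_(j < J) expR (- (kappa * j%:R)) * (u <= j.+1%:R)%R%:R.
Proof.
move=> k0 u0 uJ.
have tJ : (Num.truncn u < J)%N.
  by rewrite -(ltr_nat R); apply: le_lt_trans uJ; rewrite truncn_le.
rewrite (bigD1 (Ordinal tJ))//= (ltW (truncnS_gt u)) mulr1.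
apply: ler_wpDr.
  by apply: sumr_ge0 => j _; rewrite mulr_ge0 ?expR_ge0.
by rewrite ler_expR lerN2 ler_wpM2l// truncn_le.
Qed.

(** The integrand decays on the scale [r / rh], so the integral has the size of the mass of a ball
    of that radius. [S] is chosen before the measure and the radii, which makes the bound uniform in
    them. *)
Lemma shell_integral n (kappa : R) : 0 < kappa -> exists2 S : R, 0 <= S &
  forall (mu : probability 'rV[R]_n R) (M : R),
  (forall y s, 0 < s -> (mu (euclid_cball y s) <= (M * s ^+ n)%:E)%E) ->
  forall y (r rh : R), 0 < r -> 0 < rh ->
  (\int[mu]_z (expR (- (kappa * (rh * euclid_norm (z - y) / r))) *
     (euclid_norm (z - y) <= 2 * r)%R%:R)%:E <= (S * M * (r / rh) ^+ n)%:E)%E.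
Proof.
move=> k0; have [S S0 HS] := sum_expr_expRN_bounded n k0; exists S => //.
move=> mu M muM y r rh r0 rh0.
(* The cut-off at distance [2 * r] keeps [rh * s / r] below [J], so finitely many shells suffice. *)
pose J := (Num.truncn (2 * rh)).+1.
have rr : 0 < r / rh by rewrite divr_gt0.
pose Bj (j : nat) := euclid_cball y (j.+1%:R * (r / rh)).
have mBj j : measurable (Bj j) by exact: measurable_euclid_cball.
have mdist : measurable_fun setT (fun z : 'rV[R]_n => euclid_norm (z - y)).
  exact: measurable_euclid_dist.
have HJ : \sum_(j < J) expR (- (kappa * j%:R)) * (M * (j.+1%:R * (r / rh)) ^+ n) <= S * M * (r / rh) ^+ n.
  have M0 : 0 <= M.
    have := muM y 1 ltr01; rewrite expr1n mulr1 -lee_fin; apply: le_trans.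
    exact: measure_ge0.
  have -> : \sum_(j < J) expR (- (kappa * j%:R)) * (M * (j.+1%:R * (r / rh)) ^+ n) =
     (M * (r / rh) ^+ n) * \sum_(j < J) j.+1%:R ^+ n * expR (- (kappa * j%:R)).
    by rewrite mulr_sumr; apply: eq_bigr => j _; rewrite exprMn; ring.
  rewrite [leRHS](_ : _ = (M * (r / rh) ^+ n) * S); last by ring.
  by rewrite ler_wpM2l// mulr_ge0// exprn_ge0// ltW.
apply: (@le_trans _ _ (\int[mu]_z \sum_(j < J) (expR (- (kappa * j%:R)))%:E * (\1_(Bj j) z)%:E)%E).
  apply: ge0_le_integral => //.
  - apply/measurable_EFinP; apply: measurable_funM.
      apply: measurableT_comp => //; apply: measurableT_comp => //.
      by apply: measurable_funM => //; apply: measurable_funM => //; exact: measurable_funM.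
    rewrite (_ : (fun _ => _) = (\1_(euclid_cball y (2 * r)) : 'rV[R]_n -> R)).
      by apply: measurable_indic; exact: measurable_euclid_cball.
    by apply/funext => z; rewrite indicE mem_setE.
  - apply: emeasurable_sum => j _; apply: emeasurable_funM => //.
    by apply/measurable_EFinP; exact: measurable_indic.
  move=> z _; set s := euclid_norm _.
  have s0 : 0 <= s by exact: euclid_norm_ge0.
  under eq_bigr do rewrite -EFinM.
  rewrite sumEFin lee_fin.
  have [h|h] := leP s (2 * r); last first.
    by rewrite mulr0; apply: sumr_ge0 => j _; rewrite mulr_ge0 ?expR_ge0.
  rewrite mulr1; have u0 : 0 <= rh * s / r by rewrite divr_ge0// ?mulr_ge0//; exact: ltW.
  have uJ : rh * s / r < J%:R.
    apply: le_lt_trans (truncnS_gt (2 * rh)).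
    by rewrite ler_pdivrMr//; have := ler_wpM2l (ltW rh0) h; lra.
  apply: le_trans (expRN_le_shells (ltW k0) u0 uJ) _; apply: ler_sum => j _.
  rewrite ler_wpM2l ?expR_ge0// indicE; case: (leP (rh * s / r) _) => //= hj.
  rewrite mem_set// /Bj /euclid_cball /= -/s.
  by rewrite mulrA ler_pdivlMr// mulrC -ler_pdivrMr.
rewrite ge0_integral_sum//; last first.
  move=> j; apply: emeasurable_funM => //.
  by apply/measurable_EFinP; exact: measurable_indic.
apply: (@le_trans _ _ (\sum_(j < J) (expR (- (kappa * j%:R)) * (M * (j.+1%:R * (r / rh)) ^+ n))%:E)%E).
  apply: lee_sum => j _; rewrite ge0_integralZl//; last first.
    by apply/measurable_EFinP; exact: measurable_indic.
  rewrite integral_indic ?setIT// EFinM lee_wpmul2l ?lee_fin ?expR_ge0//.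
  by apply: muM; rewrite mulr_gt0.
by rewrite sumEFin lee_fin.
Qed.

End shells.

(** * The moment estimate on an abstract probability space *)

Section key_estimate.
Context {R : realType} {n : nat}.

(** Balls with centres further apart than [2 * r] are disjoint and give [pois_lt k rh] exactly.
    Otherwise [lebesgue_cballD_ge] contributes a factor 1/4 to the exponent and [pois_lt_le] a
    factor 1/2, whence [8^-1]. *)
Lemma pois_lt_cballD_le k (y z : 'rV[R]_n) (r c rh s : R) : 0 < r -> 0 <= c ->
  rh = c * (unit_ball_vol R n * r ^+ n) -> s = euclid_norm (z - y) ->
  pois_lt k (c * vol (euclid_cball z r `\` euclid_cball y r)) <=
  pois_lt k rh + k%:R * 2 ^+ k * (expR (- (8^-1 * (rh * s / r))) * (s <= 2 * r)%R%:R).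
Proof.
move=> r0 c0 rhE sE.
have rh0 : 0 <= rh.
  rewrite rhE mulr_ge0// mulr_ge0//; last by rewrite exprn_ge0// ltW.
  by rewrite /unit_ball_vol fine_ge0// measure_ge0.
have [h|h] := leP s (2 * r); last first.
  by rewrite /vol lebesgue_cball_far -?sE//= mulr0 mulr0 addr0 rhE.
rewrite mulr1; set D := vol _.
have D_fin : lebesgue_rV (euclid_cball z r `\` euclid_cball y r) \is a fin_num.
  by rewrite ge0_fin_numE ?measure_ge0// lebesgue_cballD_lty.
have HD : unit_ball_vol R n * r ^+ n * (s / (4 * r)) <= D.
  by rewrite -lee_fin /D /vol fineK//; rewrite sE; apply: lebesgue_cballD_ge; rewrite -?sE.
have D0 : 0 <= D by rewrite /D fine_ge0// measure_ge0.
apply: le_trans (pois_lt_le k (mulr_ge0 c0 D0)) _.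
apply: ler_wpDl; first exact: pois_lt_ge0.
rewrite ler_wpM2l ?mulr_ge0 ?exprn_ge0// ler_expR lerN2.
have := ler_wpM2l c0 HD.
have -> : c * (unit_ball_vol R n * r ^+ n * (s / (4 * r))) = rh * s / r / 4.
  by rewrite rhE; field; rewrite gt_eqF.
lra.
Qed.

Context d0 (O : measurableType d0) (P : probability O R) (mu : probability 'rV[R]_n R).
Variables (B : set 'rV[R]_n) (G : set (O * 'rV[R]_n)) (r M rh p eta c1 : R).
Hypotheses (mG : measurable G) (mB : measurable B) (muB : mu B = 1%E).
Hypotheses (r0 : 0 < r) (rh0 : 0 < rh) (p0 : 0 <= p) (eta0 : 0 <= eta) (c10 : 0 <= c1).
Hypothesis HM : forall y s, 0 < s -> (mu (euclid_cball y s) <= (M * s ^+ n)%:E)%E.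
Hypothesis HG1 : forall y, B y -> ((p * (1 - eta))%:E <= P (ysection G y) <= (p * (1 + eta))%:E)%E.
Hypothesis HG2 : forall y z, B y -> B z ->
  (P (ysection G y `&` ysection G z) <=
   ((1 + eta) * p * (p + c1 * (expR (- (8^-1 * (rh * euclid_norm (z - y) / r))) * (euclid_norm (z - y) <= 2 * r)%R%:R)))%:E)%E.
Variable S : R.
Hypothesis S0 : 0 <= S.
Hypothesis HS : forall y,
  (\int[mu]_z (expR (- (8^-1 * (rh * euclid_norm (z - y) / r))) *
     (euclid_norm (z - y) <= 2 * r)%R%:R)%:E <= (S * M * (r / rh) ^+ n)%:E)%E.

Let V w := fine (mu (xsection G w)).
Let e1 := (\int[P]_w V w)%R.
Let e2 := (\int[P]_w (V w ^+ 2))%R.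

Let mV : measurable_fun setT V := measurable_section_measure mu mG.
Let V01 := section_measure01 mu mG.

(** The bounds on the probability of being uncovered are known only on [B], which has full measure
    for [mu]. *)
Let aeB (Q : 'rV[R]_n -> Prop) : (forall y, B y -> Q y) -> {ae mu, forall y, Q y}.
Proof.
move=> BQ; exists (~` B); split.
- exact: measurableC.
- by rewrite probability_setC// muB subee.
- by move=> y /= nQ By; apply: nQ; exact: BQ.
Qed.

Let integrableb (f : O -> R) : measurable_fun setT f ->
  (forall w, 0 <= f w <= 1) -> ((\int[P]_w f w)%R)%:E = (\int[P]_w (f w)%:E)%E.
Proof.
move=> mf f01; rewrite /Rintegral fineK//.
apply: integrable_fin_num => //; apply: measurable_bounded_integrable => //.
  by rewrite /= probability_setT ltry.
exists 1; split; first exact: num_real.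
move=> N MN w _; have /andP[f0 f1] := f01 w.
have fM : `|f w| <= 1 by rewrite ger0_norm.
exact: le_trans fM (ltW MN).
Qed.

Let e1E : e1%:E = (\int[mu]_y P (ysection G y))%E.
Proof. by rewrite -integral_section_measure// -integrableb. Qed.

Let e2E : e2%:E = (\int[mu]_y \int[mu]_z P (ysection G y `&` ysection G z))%E.
Proof.
rewrite -integral_section_measure2// -integrableb//; first exact: measurable_funX.
by move=> w; have /andP[f0 f1] := V01 w; rewrite sqr_ge0 expr_le1.
Qed.

Let measurable_P : measurable_fun setT (fun y => P (ysection G y)).
Proof. exact: (measurable_fun_ysection P mG). Qed.

Let e1_le : e1 <= p * (1 + eta).
Proof.
rewrite -lee_fin e1E.
apply: (@le_trans _ _ (\int[mu]_y (cst (p * (1 + eta))%:E) y)%E); last first.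
  by rewrite integral_cst//= probability_setT mule1.
apply: ae_ge0_le_integral => //.
- by move=> y _; rewrite lee_fin mulr_ge0// addr_ge0.
- by apply: aeB => y By _; case/andP: (HG1 By).
Qed.

Let e1_ge : p * (1 - eta) <= e1.
Proof.
have [h|h] := leP (p * (1 - eta)) 0.
  apply: le_trans h _; rewrite /e1; apply: Rintegral_ge0 => w _.
  by case/andP: (V01 w).
rewrite -lee_fin e1E.
apply: (@le_trans _ _ (\int[mu]_y (cst (p * (1 - eta))%:E) y)%E).
  by rewrite integral_cst//= probability_setT mule1.
apply: ae_ge0_le_integral => //.
- by move=> y _; rewrite lee_fin ltW.
- by apply: aeB => y By _; case/andP: (HG1 By).
Qed.

(** [HS] bounds the integral over the second point uniformly in the first, so the outer integral
    adds nothing. *)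
Lemma second_moment_le :
  e2 <= (1 + eta) * p * (p + c1 * (S * M * (r / rh) ^+ n)).
Proof.
have ep0 : 0 <= (1 + eta) * p by rewrite mulr_ge0// addr_ge0.
rewrite -lee_fin e2E.
pose g (y z : 'rV[R]_n) := expR (- (8^-1 * (rh * euclid_norm (z - y) / r))) * (euclid_norm (z - y) <= 2 * r)%R%:R.
have g0 y z : 0 <= g y z by rewrite mulr_ge0 ?expR_ge0.
have mg y : measurable_fun setT (g y).
  apply: measurable_funM.
    apply: measurableT_comp => //; apply: measurableT_comp => //.
    apply: measurable_funM => //; apply: measurable_funM => //; apply: measurable_funM => //.
    exact: measurable_euclid_dist.
  rewrite (_ : (fun _ => _) = (\1_(euclid_cball y (2 * r)) : 'rV[R]_n -> R)).
    by apply: measurable_indic; exact: measurable_euclid_cball.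
  by apply/funext => z; rewrite indicE mem_setE.
pose W : R := (1 + eta) * p * (p + c1 * (S * M * (r / rh) ^+ n)).
have inner y : B y -> (\int[mu]_z P (ysection G y `&` ysection G z) <= W%:E)%E.
  move=> By.
  apply: (@le_trans _ _ (\int[mu]_z ((1 + eta) * p * (p + c1 * g y z))%:E)%E).
    apply: ae_ge0_le_integral => //.
    - exact: (measurable_fun_pair2 y (measurable_joint_section P mG)).
    - by move=> z _; rewrite lee_fin mulr_ge0// addr_ge0// mulr_ge0.
    - apply/measurable_EFinP; apply: measurable_funM => //; apply: measurable_funD => //.
      exact: measurable_funM.
    - by apply: aeB => z Bz _; exact: HG2.
  under eq_integral do rewrite EFinM.
  rewrite ge0_integralZl//; last 2 first.
  - apply/measurable_EFinP; apply: measurable_funD => //; exact: measurable_funM.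
  - by move=> z _; rewrite lee_fin addr_ge0// mulr_ge0.
  rewrite /W [leRHS]EFinM; apply: lee_wpmul2l; first by rewrite lee_fin.
  under eq_integral do rewrite EFinD EFinM.
  rewrite ge0_integralD//; last 2 first.
  - by move=> z _; rewrite mule_ge0 ?lee_fin.
  - by apply: emeasurable_funM => //; exact/measurable_EFinP.
  rewrite integral_cst//= probability_setT mule1 [leRHS]EFinD leeD2l//.
  rewrite ge0_integralZl//; last 2 first.
  - exact/measurable_EFinP.
  - by move=> z _; rewrite lee_fin.
  by rewrite [leRHS]EFinM; apply: lee_wpmul2l; [rewrite lee_fin|exact: HS].
apply: (@le_trans _ _ (\int[mu]_y (cst W%:E) y)%E); last first.
  by rewrite integral_cst//= probability_setT mule1.
apply: ae_ge0_le_integral => //.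
- by move=> y _; apply: integral_ge0.
- exact: (measurable_fun_fubini_tonelli_F _ (measurable_joint_section P mG)).
- move=> y _; rewrite lee_fin; apply: mulr_ge0 => //; apply: addr_ge0 => //.
  have M0 : 0 <= M.
    have := HM 0 ltr01; rewrite expr1n mulr1 -lee_fin; apply: le_trans.
    exact: measure_ge0.
  apply: mulr_ge0 => //; apply: mulr_ge0; first exact: mulr_ge0.
  by apply: exprn_ge0; apply: divr_ge0; exact: ltW.
- by apply: aeB => y By _; exact: inner.
Qed.

(** In [e2 - 2 * p * e1 + p ^ 2] the multiples of [p ^ 2] add up to at most
    [(1 + eta) - 2 * (1 - eta) + 1 = 3 * eta]; what remains besides is the correlation of nearby
    points. *)
Lemma key_estimate (m : R) : 0 <= m ->
  `|\int[P]_w expR (- (m * V w)) - expR (- (m * p))| <=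
  m * p * eta + 2 * (3 * eta * (m * p) ^+ 2 +
    (1 + eta) * c1 * (m * p) * (m * (S * M * (r / rh) ^+ n))).
Proof.
move=> m0.
have mp0 : 0 <= m * p by rewrite mulr_ge0.
have := @exponential_moment_le _ _ _ P V mV V01 m (m * p) m0 mp0.
move=> /le_trans; apply.
have h1 : `|m * e1 - m * p| <= m * p * eta.
  rewrite -mulrBr normrM ger0_norm// -mulrA ler_wpM2l// ler_norml.
  by apply/andP; split; [have := e1_ge|have := e1_le]; lra.
rewrite -/e1 -/e2 lerD// ler_wpM2l//.
have h2 := ler_wpM2l (sqr_ge0 m) second_moment_le.
have h3 := ler_wpM2l (mulr_ge0 (mulr_ge0 m0 m0) p0) e1_ge.
lra.
Qed.

End key_estimate.

(** * Covering events *)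

Section knn_radius_theory.
Context {R : realType} {n : nat}.
Implicit Types (x : nat -> 'rV[R]_n) (S T D : set 'rV[R]_n).

Lemma first_pointsS x N : first_points x N.+1 = first_points x N `|` [set x N].
Proof.
apply/seteqP; split => [y [i /= iN <-]|y [[i /= iN <-]|->]].
- move: iN; rewrite ltnS leq_eqVlt => /orP[/eqP ->|iN]; [by right|].
  by left; exists i.
- by exists i => //=; exact: ltnW.
- by exists N => /=.
Qed.

Lemma finite_first_points x N : finite_set (first_points x N).
Proof. exact/finite_image/finite_II. Qed.

(** Each point of the set is counted at the first index at which it occurs. *)
Lemma npoints_first_points x N D :
  npoints (first_points x N) D =
  (\sum_(i < N) ((x i \in D) && (x i \notin first_points x i)))%N.
Proof.
elim: N => [|N IH].
  rewrite big_ord0 /npoints (_ : _ `&` _ = set0) ?fset_set0 ?cardfs0//.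
  by apply/seteqP; split => // y [[i]].
rewrite big_ord_recr /= -IH first_pointsS /npoints setIUl.
have fD : finite_set (first_points x N `&` D).
  exact: finite_setIl (finite_first_points _ _).
have [xD|xD] := boolP (x N \in D) => /=; last first.
  rewrite addn0 (_ : [set x N] `&` D = set0) ?setU0//.
  by apply/seteqP; split => // y [/= -> yD]; move: xD; rewrite notin_setE.
have -> : [set x N] `&` D = [set x N].
  by apply/setIidPl => y /= ->; move: xD; rewrite in_setE.
rewrite setUC fset_setU1// cardfsU1 addnC; congr (_ + nat_of_bool _)%N.
apply/idP/idP; apply: contra; rewrite in_fset_set// !inE; last by case.
by move=> h; split => //; move: xD; rewrite in_setE.
Qed.

Lemma knn_radius_ge0 S T k : (0 <= knn_radius S T k)%E.
Proof. by apply: le_ereal_inf_tmp => _ [r [r0 _] <-]; rewrite lee_fin ltW. Qed.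

(** Only finitely many distances occur, so a slightly larger ball about [y] contains no further
    point. Hence a count reached at radii arbitrarily close above [r] is reached at [r] itself, as
    the infimum in [knn_radius] requires. *)
Lemma exists_gap x N y (r : R) : exists2 r', r < r' &
  forall i, (i < N)%N -> euclid_norm (x i - y) <= r' -> euclid_norm (x i - y) <= r.
Proof.
elim: N => [|N [r' rr' H]]; first by exists (r + 1); rewrite ?ltrDl.
have [h|h] := leP (euclid_norm (x N - y)) r.
  exists r' => // i; rewrite ltnS leq_eqVlt => /orP[/eqP ->//|]; exact: H.
pose r'' := Num.min r' ((r + euclid_norm (x N - y)) / 2).
have h2 : (r + euclid_norm (x N - y)) / 2 < euclid_norm (x N - y) by lra.
exists r''; first by rewrite lt_min rr' /=; lra.
move=> i; rewrite ltnS leq_eqVlt => /orP[/eqP ->|iN].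
  by rewrite le_min => /andP[_ h3]; lra.
by rewrite le_min => /andP[h3 _]; exact: H.
Qed.

Lemma knn_radius_le x N T k (r : R) : 0 < r ->
  (knn_radius (first_points x N) T k <= r%:E)%E <->
  forall y, T y -> (k <= npoints (first_points x N) (euclid_cball y r))%N.
Proof.
move=> r0; split; last first.
  by move=> h; apply: ereal_inf_lbound; exists r.
move=> h y Ty; have [r' rr' gap] := exists_gap x N y r.
have : (knn_radius (first_points x N) T k < r'%:E)%E by apply: le_lt_trans h _; rewrite lte_fin.
move=> /ereal_inf_lt[_ [s [s0 sk] <-]]; rewrite lte_fin => sr'.
apply: leq_trans (sk y Ty) _.
have fS := finite_first_points x N.
apply: fsubset_leq_card; rewrite -fset_set_sub; try exact: finite_setIl.
move=> _ [[i /= iN <-] hi]; split; first by exists i.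
by apply: gap => //; apply: le_trans hi (ltW sr').
Qed.

Lemma knn_event x N T k (a b1 b2 b3 r : R) : (0 < n)%N -> 0 < a -> 0 < r ->
  a * r ^+ n = b1 + b2 + b3 ->
  ((a%:E * knn_radius (first_points x N) T k ^+ n - b1%:E - b2%:E <= b3%:E)%E : Prop) <->
  forall y, T y -> (k <= npoints (first_points x N) (euclid_cball y r))%N.
Proof.
move=> n0 a0 r0 ar; rewrite -knn_radius_le//.
have := knn_radius_ge0 (first_points x N) T k.
case: knn_radius => [s| |//].
  rewrite lee_fin => s0; rewrite -EFin_expe -EFinM -!EFinB !lee_fin.
  have -> : (a * s ^+ n - b1 - b2 <= b3) = (a * s ^+ n <= a * r ^+ n) by rewrite ar; lra.
  by rewrite ler_pM2l// ler_pXn2r// nnegrE ltW.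
(* An infinite radius: since [n] and [a] are positive the left side stays infinite, and both
   inequalities fail. *)
move=> _; have -> : (+oo ^+ n = +oo :> \bar R)%E.
  by case: n n0 => // j _; elim: j => // j IH; rewrite expeS IH mulyy.
by rewrite gt0_muley ?lte_fin// -!EFinN !addye//; split; rewrite leye_eq.
Qed.

End knn_radius_theory.

Lemma measurable_count_ge d (O : measurableType d) (b : nat -> O -> bool) k N :
  (forall i, measurable [set w | b i w]) ->
  measurable [set w | (k <= \sum_(i < N) b i w)%N].
Proof.
move=> mb; elim: N k => [|N IH] k.
  have [->|k0] := eqVneq k 0%N.
    by rewrite (_ : [set w | _] = setT)//; apply/seteqP; split.
  rewrite (_ : [set w | _] = set0)//; apply/seteqP; split => // w /=.
  by rewrite big_ord0 leqn0 (negbTE k0).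
rewrite (_ : [set w | _] = [set w | (k <= \sum_(i < N) b i w)%N] `|`
    ([set w | (k.-1 <= \sum_(i < N) b i w)%N] `&` [set w | b N w])).
  by apply: measurableU => //; exact: measurableI.
apply/seteqP; split => w /=; rewrite big_ord_recr /=.
  case: (b N w) => /=; last by rewrite addn0; left.
  by move=> h; right; split => //; lia.
by case=> [|[h ->]]; lia.
Qed.

Section measurable_points.
Context {R : realType} {n : nat} d (O : measurableType d).
Implicit Types f g : O -> 'rV[R]_n.

Lemma measurable_in_euclid_cball f g r :
  measurable_fun setT f -> measurable_fun setT g ->
  measurable [set w | f w \in euclid_cball (g w) r].
Proof.
move=> mf mg; have := measurable_euclid_dist mf mg => /(_ measurableT `]-oo, r]%classic (measurable_itv _)).
rewrite setTI; congr measurable; apply/seteqP.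
by split => w /=; rewrite in_setE /euclid_cball in_itv.
Qed.

Lemma measurable_rV_eq f g : measurable_fun setT f -> measurable_fun setT g ->
  measurable [set w | f w = g w].
Proof.
move=> mf mg; have := measurable_in_euclid_cball 0 mf mg; congr measurable.
apply/seteqP; split => w /=; rewrite in_setE /euclid_cball /=.
  move=> h; apply/eqP; rewrite -subr_eq0 -euclid_norm_eq0 eq_le h.
  exact: euclid_norm_ge0.
by move=> ->; rewrite subrr euclid_norm0.
Qed.

Variable X : nat -> O -> 'rV[R]_n.
Hypothesis mX : forall i, measurable_fun setT (X i).

Lemma measurable_new_point i :
  measurable [set w | X i w \notin first_points (X ^~ w) i].
Proof.
rewrite (_ : [set w | _] = \bigcap_(j in `I_i) ~` [set w | X j w = X i w]).
  apply: fin_bigcap_measurable => [|j _]; first exact: finite_II.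
  by apply: measurableC; exact: measurable_rV_eq.
apply/seteqP; split => w /=.
  by rewrite notin_setE => h j ji /= e; apply: h; exists j.
by move=> h; rewrite notin_setE => -[j ji e]; exact: (h j ji).
Qed.

Lemma measurable_npoints_ge (g : O -> 'rV[R]_n) (r : R) k N : measurable_fun setT g ->
  measurable [set w | (k <= npoints (first_points (X ^~ w) N) (euclid_cball (g w) r))%N].
Proof.
move=> mg.
have := @measurable_count_ge _ O (fun i w => (X i w \in euclid_cball (g w) r) &&
  (X i w \notin first_points (X ^~ w) i)) k N.
have mb i : measurable [set w | (X i w \in euclid_cball (g w) r) &&
    (X i w \notin first_points (X ^~ w) i)].
  rewrite (_ : [set w | _] = [set w | X i w \in euclid_cball (g w) r] `&`
     [set w | X i w \notin first_points (X ^~ w) i]).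
    by apply: measurableI; [exact: measurable_in_euclid_cball|exact: measurable_new_point].
  by apply/seteqP; split => w /= => [/andP|] [-> ->].
move=> /(_ mb); congr measurable.
by apply/seteqP; split => w /=; rewrite npoints_first_points.
Qed.

Definition covered (Y : nat -> O -> 'rV[R]_n) (N M k : nat) (r : R) : set O :=
  [set w | forall y, first_points (Y ^~ w) M y ->
    (k <= npoints (first_points (X ^~ w) N) (euclid_cball y r))%N].

Lemma measurable_covered (Y : nat -> O -> 'rV[R]_n) N M k r :
  (forall i, measurable_fun setT (Y i)) -> measurable (covered Y N M k r).
Proof.
move=> mY.
rewrite (_ : covered _ _ _ _ _ = \bigcap_(j in `I_M)
  [set w | (k <= npoints (first_points (X ^~ w) N) (euclid_cball (Y j w) r))%N]).
  apply: fin_bigcap_measurable => [|j _]; first exact: finite_II.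
  exact: measurable_npoints_ge.
apply/seteqP; split => w h; first by move=> j jM; apply: h; exists j.
by move=> _ [j jM <-]; exact: h.
Qed.

End measurable_points.

Lemma measurable_count_in_ge (R : realType) n d (O : measurableType d)
    (X : nat -> O -> 'rV[R]_n) (r : R) k N : (forall i, measurable_fun setT (X i)) ->
  measurable [set z : O * 'rV[R]_n |
    (k <= \sum_(i < N) (X i z.1 \in euclid_cball z.2 r))%N].
Proof.
move=> mX.
apply: (@measurable_count_ge _ (O * 'rV[R]_n)%type
  (fun i z => X i z.1 \in euclid_cball z.2 r)) => i.
refine (@measurable_in_euclid_cball R n _ (O * 'rV[R]_n)%type (fun z => X i z.1) snd r _ _).
  exact: measurableT_comp.
exact: measurable_snd.
Qed.

Lemma measure_eq_mod_null d (O : measurableType d) (R : realType) (P : probability O R)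
    (E F Z : set O) : measurable E -> measurable F -> measurable Z -> P Z = 0%E ->
  E `&` ~` Z = F `&` ~` Z -> P E = P F.
Proof.
move=> mE mF mZ PZ EF.
have H (C : set O) : measurable C -> P C = P (C `&` ~` Z).
  move=> mC; rewrite -setDE measureD//; last by rewrite (le_lt_trans (probability_le1 _ mC)) ?ltry.
  rewrite [X in (_ - X)%E](_ : _ = 0%E) ?sube0//.
  apply/eqP; rewrite eq_le measure_ge0 andbT -PZ; apply: le_measure; rewrite ?inE//.
  exact: measurableI.
by rewrite H// EF -H.
Qed.

Lemma sigma_algebra_sigma_of d d' (O : measurableType d) (T : measurableType d')
  (f : O -> T) : sigma_algebra setT (sigma_of f).
Proof. by apply: sigma_algebra_preimage; exact: sigma_algebra_measurable. Qed.

Lemma sigma_of_measurable d d' (O : measurableType d) (T : measurableType d')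
  (f : O -> T) : measurable_fun setT f -> sigma_of f `<=` measurable.
Proof. by move=> mf _ [C mC <-]; exact: mf. Qed.

Lemma sigma_of_preimage d d' (O : measurableType d) (T : measurableType d')
  (f : O -> T) (C : set T) : measurable C -> sigma_of f (f @^-1` C).
Proof. by move=> mC; exists C => //; rewrite setTI. Qed.

Section two_samples.
Context {R : realType} {n : nat} {dO : measure_display} {O : measurableType dO}
  (P : probability O R).
Variables (X Y : nat -> {RV P >-> 'rV[R]_n}) (A B : set 'rV[R]_n).
Hypothesis mA : measurable A.
Hypothesis n0 : (0 < n)%N.
Hypothesis hX : forall i, uniformly_distributed P (X i) A.
Hypothesis hY : forall i, uniformly_distributed P (Y i) B.
Hypothesis hXY : mutually_independent P (fun i => sigma_of (interleave X Y i)).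

Let xi : nat -> {RV P >-> 'rV[R]_n} := interleave X Y.

Let xiX i : xi i.*2 = X i.
Proof. by rewrite /xi /interleave odd_double doubleK. Qed.

Let xiY i : xi i.*2.+1 = Y i.
Proof. by rewrite /xi /interleave /= odd_double /= uphalf_double. Qed.

Let family (I : set nat) := \bigcup_(i in I) sigma_of (xi i).

Let family_measurable I : <<s family I >> `<=` measurable.
Proof.
apply: smallest_sub; first exact: sigma_algebra_measurable.
by move=> C [i _]; apply: sigma_of_measurable; exact: measurable_funP.
Qed.

Let family_sub I J : I `<=` J -> <<s family I >> `<=` <<s family J >>.
Proof. by move=> IJ; apply: sub_sigma_algebra2; exact: bigcup_subset. Qed.

Let family_preimage (I : set nat) i C : I i -> measurable C -> <<s family I >> (xi i @^-1` C).
Proof.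
by move=> Ii mC; apply: sub_sigma_algebra; exists i => //; exact: sigma_of_preimage.
Qed.

Let family_indep (I : set nat) i E C : ~ I i -> <<s family I >> E -> measurable C ->
  (P (E `&` xi i @^-1` C) = P E * P (xi i @^-1` C))%E.
Proof.
move=> Ii IE mC.
apply: (@mutually_independent_sigma _ _ _ P _ (fun i => sigma_of (xi i)) I i) => //.
- by move=> j; exact: sigma_algebra_sigma_of.
- by move=> j; apply: sigma_of_measurable; exact: measurable_funP.
- exact: sigma_of_preimage.
Qed.

(** [interleave] puts [X] at the even and [Y] at the odd indices: [SX j] records the first [j] of
    the [X], while [SY j] records all of the [X] and the first [j] of the [Y]. *)
Let SX j := family [set i | ~~ odd i /\ (i < j.*2)%N].
Let SY j := family [set i | ~~ odd i \/ (i < j.*2)%N].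

Let muY : probability 'rV[R]_n R := distribution P (Y 0).

Let muYE i C : measurable C -> P (Y i @^-1` C) = muY C.
Proof. by move=> mC; rewrite /muY /= /distribution /pushforward !hY. Qed.

Section fixed_sizes.
Variables (N k : nat) (r : R).

Definition uncovered : set (O * 'rV[R]_n) :=
  [set z | (count_in X (euclid_cball z.2 r) N z.1 < k)%N].

Lemma uncoveredC : ~` uncovered =
  [set z | (k <= \sum_(i < N) (X i z.1 \in euclid_cball z.2 r))%N].
Proof.
by apply/seteqP; split => z /=; rewrite /uncovered /= /count_in; [move/negP; rewrite -leqNgt|rewrite leqNgt => /negP].
Qed.

Lemma measurable_uncovered : measurable uncovered.
Proof.
rewrite -[uncovered]setCK; apply: measurableC; rewrite uncoveredC.
exact: (@measurable_count_in_ge R n _ O (fun i => X i)).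
Qed.

Let measurable_uncoveredC_SY :
  measurable (~` uncovered : set (g_sigma_algebraType (SY 0) * 'rV[R]_n)).
Proof.
rewrite uncoveredC.
apply: (@measurable_count_in_ge R n _ (g_sigma_algebraType (SY 0)) (fun i => X i)).
by move=> i _ C mC; rewrite setTI -xiX; apply: family_preimage => //=; rewrite odd_double; left.
Qed.

(** Freezing one of the two points leaves the law of the other on a singleton, which is Lebesgue
    null in positive dimension. *)
Lemma prob_same_point i j : i != j -> P [set w | X i w = X j w] = 0%E.
Proof.
move=> ij.
pose D : set ('rV[R]_n * 'rV[R]_n) := [set z | z.1 = z.2].
have mD : measurable D by exact: measurable_rV_eq measurable_fst measurable_snd.
have ind E C : measurable E -> measurable C ->
    (P (X i @^-1` E `&` X j @^-1` C) = P (X i @^-1` E) * P (X j @^-1` C))%E.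
  move=> mE mC; rewrite -!xiX; apply: (@family_indep [set i.*2]) => //.
    by move=> /= /eqP; rewrite eq_sym (inj_eq double_inj) (negbTE ij).
  by apply: family_preimage.
have f0 z : (0 <= (\1_D z)%:E :> \bar R)%E by rewrite lee_fin.
have mf : measurable_fun setT (fun z => (\1_D z)%:E : \bar R).
  by apply/measurable_EFinP; exact: measurable_indic.
have := @freezing _ _ _ _ _ _ R P (X i) (X j) ind _ mf f0.
have mE : measurable [set w | X i w = X j w] by exact: measurable_rV_eq.
have -> : (\int[P]_w (\1_D (X i w, X j w))%:E = P [set w | X i w = X j w])%E.
  transitivity (\int[P]_w (\1_[set w | X i w = X j w] w)%:E)%E.
    by apply: eq_integral => w _; rewrite !indicE.
  by rewrite integral_indic ?setIT.
move=> ->; apply: integral0_eq => w _.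
have m1 : measurable [set X i w].
  have := @measurable_rV_eq R n _ 'rV[R]_n id (cst (X i w)) (@measurable_id _ _ _) (measurable_cst _).
  by [].
transitivity (distribution P (X j) [set X i w]).
  transitivity (\int[distribution P (X j)]_y (\1_[set X i w] y)%:E)%E.
    apply: eq_integral => y _; rewrite !indicE; congr ((nat_of_bool _)%:R%:E).
    by apply/idP/idP; rewrite !inE /D /= => ->.
  by rewrite integral_indic ?setIT.
rewrite /distribution /pushforward hX// /vol.
rewrite (_ : lebesgue_rV _ = 0%E) ?mul0r//.
apply/eqP; rewrite eq_le measure_ge0 andbT -(lebesgue_rV_set1 (X i w) n0).
apply: le_measure; rewrite ?inE//.
exact: measurableI.
Qed.

(** Off the null event of coinciding points, [npoints] is a sum of indicators over indices; then the
    [Y] are integrated out given all of the [X]. *)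
Lemma prob_covered M :
  P (covered (fun i => X i) (fun i => Y i) N M k r) =
  (\int[P]_w ((1 - fine (muY (xsection uncovered w))) ^+ M)%:E)%E.
Proof.
transitivity (P [set w | forall j, (j < M)%N -> (~` uncovered) (w, Y j w)]).
  pose F i j := if i == j then set0 else [set w | X i w = X j w].
  have mF i j : measurable (F i j) by rewrite /F; case: ifP => // _; exact: measurable_rV_eq.
  have mZ : measurable (\bigcup_i \bigcup_j F i j).
    by apply: bigcupT_measurable => i; exact: bigcupT_measurable.
  apply: (measure_eq_mod_null _ _ mZ).
  - by apply: measurable_covered => i; exact: measurable_funP.
  - rewrite (_ : [set w | _] = \bigcap_(j in `I_M)
      [set w | (k <= \sum_(i < N) (X i w \in euclid_cball (Y j w) r))%N]).
      apply: fin_bigcap_measurable => [|j _]; first exact: finite_II.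
      apply: (@measurable_count_ge _ O (fun i w => X i w \in euclid_cball (Y j w) r)) => i.
      by apply: measurable_in_euclid_cball; exact: measurable_funP.
    by rewrite uncoveredC; apply/seteqP; split => w h j /=; exact: h.
  - apply: measure_negligible => //.
    apply: negligible_bigcup => i; apply: negligible_bigcup => j.
    rewrite /F; case: eqP => [_|/eqP ij]; first exact: negligible_set0.
    by exists [set w | X i w = X j w]; split => //; [exact: measurable_rV_eq|exact: prob_same_point].
  - rewrite uncoveredC; apply/seteqP.
    have new w i : (~` (\bigcup_i \bigcup_j F i j)) w -> X i w \notin first_points (fun i => X i w) i.
      move=> hw; rewrite notin_setE => -[j /= ji e]; apply: hw.
      by exists j => //; exists i => //; rewrite /F ltn_eqF.
    have npE w y : (~` (\bigcup_i \bigcup_j F i j)) w ->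
        npoints (first_points (fun i => X i w) N) (euclid_cball y r) =
        (\sum_(i < N) (X i w \in euclid_cball y r))%N.
      by move=> hw; rewrite npoints_first_points; apply: eq_bigr => i _; rewrite new// andbT.
    split => w [h hw]; split => //.
      by move=> j jM /=; rewrite -npE//; apply: h; exists j.
    by move=> _ [j jM <-]; rewrite npE//; exact: (h j jM).
rewrite (@conditionally_iid _ _ _ _ _ P Y SY muY).
- apply: eq_integral => w _.
  rewrite EFin_expe; congr (_ ^+ _)%E.
  have mx : measurable (xsection uncovered w).
    by apply: measurable_xsection; exact: measurable_uncovered.
  rewrite EFinB section_measure_fin; last exact: measurable_uncovered.
  by rewrite -probability_setC//; congr (muY _); apply/seteqP; split => y; rewrite /xsection /= ?inE.
- by move=> j; exact: family_measurable.
- by move=> j; apply: family_sub => i /= [->|ij]; [left|right; lia].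
- move=> j C mC; rewrite -xiY; apply: family_preimage => //=.
  by right; rewrite doubleS.
- move=> j E C hE mC; rewrite -xiY; apply: (family_indep _ hE mC) => /=.
  by rewrite odd_double /= => -[|]; [|lia].
- by move=> j C; exact: muYE.
- exact: measurable_uncoveredC_SY.
Qed.

Lemma covered_sigma M :
  sigma_of_family setT (interleave X Y) (covered (fun i => X i) (fun i => Y i) N M k r).
Proof.
apply: (@measurable_covered R n _ (g_sigma_algebraType (family setT)) (fun i => X i) _ (fun i => Y i)).
  by move=> i _ C mC; rewrite setTI -xiX; exact: family_preimage.
by move=> i _ C mC; rewrite setTI -xiY; exact: family_preimage.
Qed.

Let prob_in (D : set 'rV[R]_n) j : D `<=` A -> measurable D ->
  P (X j @^-1` D) = (vol D / vol A)%:E.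
Proof. by move=> DA mD; rewrite hX// (setIidl DA). Qed.

Let SX_indep j E C : <<s SX j >> E -> measurable C ->
  (P (E `&` X j @^-1` C) = P E * P (X j @^-1` C))%E.
Proof.
move=> hE mC; rewrite -xiX; apply: (family_indep _ hE mC) => /=.
by rewrite ltnn => -[].
Qed.

Let SX_preimage j C : measurable C -> <<s SX j.+1 >> (X j @^-1` C).
Proof.
move=> mC; rewrite -xiX; apply: family_preimage => //=.
by rewrite odd_double doubleS; split => //; lia.
Qed.

Let SX_sub j : <<s SX j >> `<=` <<s SX j.+1 >>.
Proof. by apply: family_sub => i /= [-> ij]; split => //; lia. Qed.

Lemma prob_uncovered2 y z : euclid_cball y r `<=` A -> euclid_cball z r `<=` A ->
  (P (ysection uncovered y `&` ysection uncovered z) <=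
   (\sum_(a < k) \sum_(b < k) trinom N a b (vol (euclid_cball y r) / vol A)
      (vol (euclid_cball z r `\` euclid_cball y r) / vol A))%:E)%E.
Proof.
move=> yA zA.
have my : measurable (euclid_cball y r) by exact: measurable_euclid_cball.
have mz : measurable (euclid_cball z r `\` euclid_cball y r) by exact: measurable_cballD.
rewrite -(@prob_count_lt _ O _ _ _ P X SX _ SX_sub SX_preimage SX_indep
   (euclid_cball y r) (euclid_cball z r `\` euclid_cball y r)).
- apply: le_measure; rewrite ?inE.
  + by apply: measurableI; apply: measurable_ysection; exact: measurable_uncovered.
  + have mc (D : set 'rV[R]_n) : measurable D -> measurable [set w | (count_in X D N w < k)%N].
      move=> mD; rewrite -[X in measurable X]setCK; apply: measurableC.
      have := @measurable_count_ge _ O (fun i w => X i w \in D) k N.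
      have mb i : measurable [set w | X i w \in D].
        rewrite (_ : [set w | _] = X i @^-1` D); last by apply/seteqP; split => w /=; rewrite in_setE.
        by rewrite -[X in measurable X]setTI; exact: measurable_funP.
      move=> /(_ mb); congr measurable; apply/seteqP; split => w /=; rewrite /count_in.
        by rewrite leqNgt => /negP.
      by move/negP; rewrite -leqNgt.
    exact: measurableI (mc _ my) (mc _ mz).
  + move=> w []; rewrite /ysection /= !inE /uncovered /= => h1 h2; split => //.
    apply: leq_ltn_trans h2; apply: leq_sum => i _.
    by case: (boolP (X i w \in _ `\` _)) => // /set_mem[h _]; rewrite (mem_set h).
- by move=> j; exact: family_measurable.
- exact: my.
- exact: mz.
- by apply/seteqP; split => // v [h1 [_ h2]].
- by move=> j; exact: prob_in.
- by move=> j; apply: prob_in => //; exact: subset_trans (@subDsetl _ _ _) zA.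
Qed.

(** Taking the second region empty lets the one-point and two-point probabilities share the
    trinomial bounds. *)
Lemma prob_uncovered y : (0 < k)%N -> euclid_cball y r `<=` A ->
  P (ysection uncovered y) =
   (\sum_(a < k) \sum_(b < k) trinom N a b (vol (euclid_cball y r) / vol A) 0)%:E.
Proof.
move=> k0 yA.
have my : measurable (euclid_cball y r) by exact: measurable_euclid_cball.
rewrite -(@prob_count_lt _ O _ _ _ P X SX _ SX_sub SX_preimage SX_indep
   (euclid_cball y r) set0).
- congr (P _); apply/seteqP; split => w; rewrite /ysection /= inE /uncovered /=; last by case.
  move=> h; split => //; rewrite /count_in big1// => i _.
  by rewrite in_set0.
- by move=> j; exact: family_measurable.
- exact: my.
- exact: measurable0.
- by rewrite setI0.
- by move=> j; exact: prob_in.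
- by move=> j; rewrite preimage_set0 measure0.
Qed.

End fixed_sizes.

End two_samples.

Lemma pois_lt0 (R : realType) k : (0 < k)%N -> pois_lt k (0 : R) = 1.
Proof.
case: k => // k _; rewrite /pois_lt big_ord_recl big1 ?addr0.
  by rewrite /pois oppr0 expR0 expr0 fact0 divr1 mulr1.
by move=> i _; rewrite /pois /= expr0n /= mulr0 mul0r.
Qed.

Lemma expR_le_1D3x (R : realType) (x : R) : 0 <= x <= 1 -> expR x <= 1 + 3 * x.
Proof.
move=> /andP[x0 x1]; apply: le_trans (expR_le_quadratic x1) _.
have : x ^+ 2 <= x by rewrite expr2 ler_piMr.
lra.
Qed.

(** * Estimates for fixed and for Poisson sample sizes *)

Section estimates.
Context {R : realType} {n : nat} {dO : measure_display} {O : measurableType dO}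
  (P : probability O R).
Variables (X Y : nat -> {RV P >-> 'rV[R]_n}) (A B : set 'rV[R]_n) (e S : R).
Hypothesis n0 : (0 < n)%N.
Hypothesis cA : compact A.
Hypothesis mB : measurable B.
Hypothesis BA : B `<=` A.
Hypothesis B0 : (0 < lebesgue_rV B)%E.
Hypothesis e0 : 0 < e.
Hypothesis eA : forall y, B y -> euclid_cball y e `<=` A.
Hypothesis hX : forall i, uniformly_distributed P (X i) A.
Hypothesis hY : forall i, uniformly_distributed P (Y i) B.
Hypothesis hXY : mutually_independent P (fun i => sigma_of (interleave X Y i)).
Hypothesis S0 : 0 <= S.
Hypothesis HS : forall (mu : probability 'rV[R]_n R) (M : R),
  (forall y s, 0 < s -> (mu (euclid_cball y s) <= (M * s ^+ n)%:E)%E) ->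
  forall y (r rh : R), 0 < r -> 0 < rh ->
  (\int[mu]_z (expR (- (8^-1 * (rh * euclid_norm (z - y) / r))) *
     (euclid_norm (z - y) <= 2 * r)%R%:R)%:E <= (S * M * (r / rh) ^+ n)%:E)%E.

Let mA : measurable A. Proof. exact: compact_measurable_rV. Qed.

Let A_lty : (lebesgue_rV A < +oo)%E. Proof. exact: compact_lebesgue_rV_lty. Qed.

Let B_lty : (lebesgue_rV B < +oo)%E.
Proof. by apply: le_lt_trans A_lty; apply: le_measure; rewrite ?inE. Qed.

Let volB_gt0 : 0 < vol B.
Proof. by rewrite /vol fine_gt0// B0 B_lty. Qed.

Lemma vol_le (C D : set 'rV[R]_n) : measurable C -> measurable D -> C `<=` D ->
  (lebesgue_rV D < +oo)%E -> vol C <= vol D.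
Proof.
move=> mC mD CD Doo; have CDle : (lebesgue_rV C <= lebesgue_rV D)%E by apply: le_measure; rewrite ?inE.
by rewrite /vol fine_le// ge0_fin_numE ?measure_ge0//; exact: le_lt_trans CDle Doo.
Qed.

Lemma volA_gt0 : 0 < vol A.
Proof. exact: lt_le_trans volB_gt0 (vol_le mB mA BA A_lty). Qed.

Let theta := unit_ball_vol R n.

Let theta_gt0 : 0 < theta. Proof. exact: unit_ball_vol_gt0. Qed.

Lemma vol_euclid_cball (y : 'rV[R]_n) r : 0 < r -> vol (euclid_cball y r) = theta * r ^+ n.
Proof. by move=> r0; rewrite /vol lebesgue_euclid_cball. Qed.

Let muY : probability 'rV[R]_n R := distribution P (Y 0).

Let muB : muY B = 1%E.
Proof.
by rewrite /muY /= /distribution /pushforward hY// setIid mulfV// gt_eqF.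
Qed.

Let muball y s : 0 < s -> (muY (euclid_cball y s) <= (theta / vol B * s ^+ n)%:E)%E.
Proof.
move=> s0; have my := measurable_euclid_cball y s.
rewrite /muY /= /distribution /pushforward hY// lee_fin mulrAC -(vol_euclid_cball y s0).
rewrite ler_wpM2r ?invr_ge0 ?(ltW volB_gt0)//; apply: vol_le => //.
  exact: measurableI.
exact: lebesgue_euclid_cball_lty.
Qed.

Variables (k : nat) (r t : R).
Hypotheses (k0 : (0 < k)%N) (r0 : 0 < r) (re : r <= e) (t0 : 0 < t).

(** [q] is the chance that one sample point falls into a given ball of radius [r] inside [A], and
    [rh] the mean number of those that do. *)
Let q := theta * r ^+ n / vol A.
Let rh := t * q.
Let p := pois_lt k rh.
Let c1 : R := k%:R * 2 ^+ k.

Let rA y : B y -> euclid_cball y r `<=` A.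
Proof. by move=> By z zy; apply: (eA By); exact: le_trans zy re. Qed.

Let q0 : 0 < q.
Proof. by rewrite /q divr_gt0 ?mulr_gt0 ?exprn_gt0//; exact: volA_gt0. Qed.

Let rh0 : 0 < rh. Proof. exact: mulr_gt0. Qed.

Let p0 : 0 <= p. Proof. by apply: pois_lt_ge0; exact: ltW. Qed.

Let c10 : 0 <= c1. Proof. by rewrite mulr_ge0 ?exprn_ge0. Qed.

Let delta (y z : 'rV[R]_n) : R := vol (euclid_cball z r `\` euclid_cball y r) / vol A.

Let delta_ge0 y z : 0 <= delta y z.
Proof. by rewrite divr_ge0 ?(ltW volA_gt0)// /vol fine_ge0// measure_ge0. Qed.

Let delta_le y z : delta y z <= q.
Proof.
rewrite /delta /q ler_wpM2r ?invr_ge0 ?(ltW volA_gt0)// -(vol_euclid_cball z r0).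
apply: vol_le; [exact: measurable_cballD|exact: measurable_euclid_cball|exact: subDsetl|].
exact: lebesgue_euclid_cball_lty.
Qed.

Let pois_delta y z : pois_lt k (t * delta y z) <=
  p + c1 * (expR (- (8^-1 * (rh * euclid_norm (z - y) / r))) * (euclid_norm (z - y) <= 2 * r)%R%:R).
Proof.
have -> : t * delta y z = t / vol A * vol (euclid_cball z r `\` euclid_cball y r).
  by rewrite /delta mulrA mulrAC.
apply: pois_lt_cballD_le => //; first by rewrite divr_ge0 ?(ltW t0) ?(ltW volA_gt0).
by rewrite /rh /q -/theta; field; rewrite gt_eqF// volA_gt0.
Qed.

Definition estimate_error (M eta : R) : R :=
  M * p * eta + 2 * (3 * eta * (M * p) ^+ 2 +
    (1 + eta) * c1 * (M * p) * (M * (S * (theta / vol B) * (r / rh) ^+ n))).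

(** [12 * k * q] bounds [expR (4 * k * q) - 1], the loss in the trinomial upper bound for two balls;
    the other summands of [eta] are the losses in [sum_binom_ge]. The first error term is the price
    of replacing [(1 - V) ^+ M] by [expR (- (M * V))]. *)
Lemma fixed_size_estimate (N M : nat) (eta : R) :
  t = N%:R -> 4 * k%:R * q <= 1 -> 2 * q <= 1 ->
  eta = 12 * k%:R * q + k%:R ^+ 2 / t + t * q ^+ 2 ->
  `|fine (P (covered (fun i => X i) (fun i => Y i) N M k r)) - expR (- (M%:R * p))| <=
  M%:R * ((1 + eta) * p * (p + c1 * (S * (theta / vol B) * (r / rh) ^+ n))) +
  estimate_error M%:R eta.
Proof.
move=> tN kq q2 etaE.
have N0 : (0 < N)%N by rewrite -(ltr_nat R) -tN.
have k0R : 0 <= k%:R :> R by [].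
have kq0 : 0 <= k%:R * q by rewrite mulr_ge0// ltW.
have e1 : 0 <= k%:R ^+ 2 / t by rewrite divr_ge0 ?sqr_ge0// ltW.
have e2 : 0 <= t * q ^+ 2 by rewrite mulr_ge0 ?sqr_ge0// ltW.
have eta0 : 0 <= eta by rewrite etaE; lra.
pose G := uncovered X N k r.
have mG : measurable G by exact: measurable_uncovered.
have q01 : 0 <= q by exact: ltW.
have HG1 y : B y -> ((p * (1 - eta))%:E <= P (ysection G y) <= (p * (1 + eta))%:E)%E.
  move=> By; rewrite (prob_uncovered n0 hX hXY)//; last exact: rA.
  rewrite vol_euclid_cball// -/q !lee_fin; apply/andP; split.
    rewrite sum_trinom0//; apply: le_trans (sum_binom_ge k N0 _); last by rewrite q01; lra.
    by rewrite -tN -/rh mulrC ler_wpM2r// etaE; lra.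
  apply: le_trans (@sum_trinom_le _ N k q 0 _ _ _) _ => //; first by lra.
  rewrite mulr0 pois_lt0// mulr1 addr0 -tN -/rh -/p mulrC ler_wpM2l//.
  apply: le_trans (expR_le_1D3x _) _; rewrite natrM; last by rewrite etaE; lra.
  by apply/andP; split; lra.
have HG2 y z : B y -> B z -> (P (ysection G y `&` ysection G z) <=
   ((1 + eta) * p * (p + c1 * (expR (- (8^-1 * (rh * euclid_norm (z - y) / r))) * (euclid_norm (z - y) <= 2 * r)%R%:R)))%:E)%E.
  move=> By Bz; apply: le_trans (prob_uncovered2 n0 hX hXY N k (rA By) (rA Bz)) _.
  rewrite vol_euclid_cball// -/q -/(delta y z) lee_fin.
  have d0 := delta_ge0 y z; have d1 := delta_le y z.
  apply: le_trans (@sum_trinom_le _ N k q (delta y z) _ _ _) _ => //; first by lra.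
  rewrite -tN -/rh -/p -mulrA.
  apply: ler_pM.
  - exact: expR_ge0.
  - by rewrite mulr_ge0//; apply: pois_lt_ge0; rewrite mulr_ge0// ltW.
  - have h : (2 * k)%:R * (q + delta y z) <= 4 * k%:R * q.
      by rewrite natrM; have := ler_wpM2l k0R d1; lra.
    have h0 : 0 <= (2 * k)%:R * (q + delta y z) by rewrite mulr_ge0// addr_ge0.
    apply: le_trans (expR_le_1D3x _) _; last by rewrite etaE; lra.
    by rewrite h0 (le_trans h kq).
  - by rewrite ler_wpM2l//; exact: pois_delta.
have HS' y := HS muball y r0 rh0.
have key := @key_estimate R n _ O P muY B G r (theta / vol B) rh p eta c1
  mG mB muB r0 rh0 p0 eta0 c10 muball HG1 HG2 S S0 HS' M%:R (ler0n _ _).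
have sec := @second_moment_le R n _ O P muY B G r (theta / vol B) rh p eta c1
  mG mB muB r0 rh0 p0 eta0 c10 muball HG2 S S0 HS'.
have bin := @binomial_moment_le _ _ _ P (fun w => fine (muY (xsection G w)))
  (measurable_section_measure muY mG) (section_measure01 muY mG) M.
rewrite (prob_covered mA n0 hX hY hXY) -/muY -/G.
rewrite -[fine _]/(\int[P]_w ((1 - fine (muY (xsection G w))) ^+ M))%R.
have M0 : 0 <= M%:R :> R by [].
have sec' := ler_wpM2l M0 sec.
rewrite -/(estimate_error M%:R eta) in key.
rewrite (le_trans (ler_distD (\int[P]_w expR (- (M%:R * fine (muY (xsection G w)))))%R _ _))//.
by apply: lerD => //; apply: le_trans bin _.
Qed.

Section poissonized.
Variables (Zt Zu : {RV P >-> nat}) (u : R).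
Hypothesis u0 : 0 < u.
Hypothesis q2 : 2 * q < 1.
Hypothesis Zt_law : forall j, P (Zt @^-1` [set j]) = (poisson_pmf t j)%:E.
Hypothesis Zu_law : forall j, P (Zu @^-1` [set j]) = (poisson_pmf u j)%:E.
Hypothesis Z_indep : forall i j E, sigma_of_family setT (interleave X Y) E ->
  P (Zt @^-1` [set i] `&` Zu @^-1` [set j] `&` E) =
  (P (Zt @^-1` [set i]) * P (Zu @^-1` [set j]) * P E)%E.

Let kappa : probability nat R := distribution P Zt.

(** The Poisson number of sample points becomes the first coordinate of the outcome, so that
    [key_estimate] applies to the product space [nat * O]. *)
Let G : set ((nat * O) * 'rV[R]_n) :=
  [set z | (uncovered X z.1.1 k r) (z.1.2, z.2)].

Let mG : measurable G.
Proof.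
rewrite (_ : G = \bigcup_N (((fun z : (nat * O) * 'rV[R]_n => z.1.1) @^-1` [set N]) `&`
    ((fun z : (nat * O) * 'rV[R]_n => (z.1.2, z.2)) @^-1` uncovered X N k r))); last first.
  by apply/seteqP; split => [z Gz|z [N _ [/= <-]]]//; exists z.1.1.
apply: bigcupT_measurable => N; apply: measurableI.
  have mf : measurable_fun setT (fun z : (nat * O) * 'rV[R]_n => z.1.1).
    by apply: measurableT_comp => //; exact: measurable_fst.
  by rewrite -[X in measurable X]setTI; exact: mf.
have mf : measurable_fun setT (fun z : (nat * O) * 'rV[R]_n => (z.1.2, z.2)).
  by apply: measurable_fun_pair => //; exact: measurableT_comp.
by rewrite -[X in measurable X]setTI; apply: mf => //; exact: measurable_uncovered.
Qed.

Let xsectionG N w : xsection G (N, w) = xsection (uncovered X N k r) w.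
Proof. by apply/seteqP; split => y; rewrite /xsection /= !inE. Qed.

Let ysectionG y N : xsection (ysection G y) N = ysection (uncovered X N k r) y.
Proof.
apply/seteqP; split => w; rewrite /xsection /ysection /=.
  by move=> /set_mem /= /set_mem h; exact/mem_set.
by move=> /set_mem h; apply/mem_set => /=; exact/mem_set.
Qed.

Let prodE (F : set (nat * O)) : measurable F ->
  ((kappa \x P) F = \sum_(N <oo) P (xsection F N) * (poisson_pmf t N)%:E)%E.
Proof.
move=> mF; rewrite -[LHS]/(\int[kappa]_N (P (xsection F N)))%E integral_nat//.
by apply: eq_eseriesr => N _; rewrite -Zt_law.
Qed.

(** Averaging the trinomial probabilities over the Poisson number gives exactly [p] for one ball,
    and exactly a product for two disjoint regions; hence [eta = 0]. *)
Let poisson_moment : `|\int[(kappa \x P)%E]_z expR (- (u * fine (muY (xsection G z)))) - expR (- (u * p))| <=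
  estimate_error u 0.
Proof.
have q01 : 0 <= q by exact: ltW.
have HG1 y : B y -> ((p * (1 - 0))%:E <= (kappa \x P) (ysection G y) <= (p * (1 + 0))%:E)%E.
  move=> By; rewrite subr0 addr0 mulr1.
  suff -> : ((kappa \x P) (ysection G y) = p%:E)%E by rewrite lexx.
  rewrite prodE; last exact: measurable_ysection.
  have h : q + 0 < 1 by rewrite addr0; apply: le_lt_trans q2; rewrite ler_peMl// ler1n.
  have := @sum_sum_trinom_poisson _ t q 0 k t0 q01 (lexx _) h.
  rewrite mulr0 pois_lt0// mulr1 -/rh -/p => <-.
  apply: eq_eseriesr => N _; rewrite EFinM; congr (_ * _)%E.
  have := prob_uncovered n0 hX hXY N k0 (rA By).
  rewrite vol_euclid_cball// -/q => <-.
  by rewrite ysectionG.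
have HG2 y z : B y -> B z -> ((kappa \x P) (ysection G y `&` ysection G z) <=
   ((1 + 0) * p * (p + c1 * (expR (- (8^-1 * (rh * euclid_norm (z - y) / r))) * (euclid_norm (z - y) <= 2 * r)%R%:R)))%:E)%E.
  move=> By Bz.
  have d0 := delta_ge0 y z; have d1 := delta_le y z.
  apply: (@le_trans _ _ (p * pois_lt k (t * delta y z))%:E); last first.
    by rewrite lee_fin addr0 mul1r ler_wpM2l//; exact: pois_delta.
  rewrite prodE; last by apply: measurableI; exact: measurable_ysection.
  have h : q + delta y z < 1.
    by apply: le_lt_trans q2; rewrite mulr_natl mulr2n lerD2l.
  rewrite -sum_sum_trinom_poisson//.
  apply: lee_nneseries => [N _|N _].
    by rewrite mule_ge0// lee_fin poisson_pmf_ge0.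
  rewrite EFinM lee_wpmul2r ?lee_fin ?poisson_pmf_ge0//.
  have := prob_uncovered2 n0 hX hXY N k (rA By) (rA Bz).
  rewrite vol_euclid_cball//; apply: le_trans.
  by rewrite xsectionI !ysectionG.
have HS' y := HS muball y r0 rh0.
exact: (@key_estimate R n _ (nat * O)%type (kappa \x P)%E muY B G r (theta / vol B) rh p 0 c1
  mG mB muB r0 rh0 p0 (lexx _) c10 muball HG1 HG2 S S0 HS' u (ltW u0)).
Qed.

Let V N w := fine (muY (xsection (uncovered X N k r) w)).

Let V01 N w : 0 <= V N w <= 1.
Proof. exact: section_measure01 (measurable_uncovered _ _ _ _) _. Qed.

Let measurable_V N : measurable_fun setT (V N).
Proof. exact: measurable_section_measure (measurable_uncovered _ _ _ _). Qed.

(** The event is split by the values of both counts, which are independent of the points. For fixed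
    [N] the sum over [M] is the Poisson generating function at [1 - V N w], equal to
    [expR (- (u * V N w))]. *)
Let prob_covered_random :
  (P [set w | covered (fun i => X i) (fun i => Y i) (Zt w) (Zu w) k r w] =
   \int[(kappa \x P)]_z (expR (- (u * fine (muY (xsection G z)))))%:E)%E.
Proof.
pose C N M := covered (fun i => X i) (fun i => Y i) N M k r.
have mC N M : measurable (C N M).
  by apply: measurable_covered => i; exact: measurable_funP.
have mZ (Z : {RV P >-> nat}) j : measurable (Z @^-1` [set j]).
  by rewrite -[X in measurable X]setTI; exact: measurable_funP.
pose D N M := Zt @^-1` [set N] `&` Zu @^-1` [set M] `&` C N M.
have mD N M : measurable (D N M) by apply: measurableI => //; exact: measurableI.
have -> : [set w | covered (fun i => X i) (fun i => Y i) (Zt w) (Zu w) k r w] =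
    \bigcup_N \bigcup_M D N M.
  apply/seteqP; split => [w Cw|w [N _ [M _ [[/= <- <-]]]]]//.
  by exists (Zt w) => //; exists (Zu w).
rewrite measure_semi_bigcup//; last 3 first.
- by move=> N; exact: bigcupT_measurable.
- apply/trivIsetP => i j _ _ /eqP ij; apply/seteqP; split => // w.
  by move=> [[M _ [[/= h1 _] _]] [M' _ [[/= h2 _] _]]]; apply: ij; rewrite -h1 -h2.
- by apply: bigcupT_measurable => N; exact: bigcupT_measurable.
rewrite fubini_tonelli1//=; last first.
  apply/measurable_EFinP; apply: measurableT_comp => //; apply: measurableT_comp => //.
  by apply: measurable_funM => //; exact: measurable_section_measure.
rewrite integral_nat; last by move=> N; apply: integral_ge0 => w _; rewrite lee_fin expR_ge0.
apply: eq_eseriesr => N _.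
transitivity (\int[P]_w (expR (- (u * V N w)))%:E * (poisson_pmf t N)%:E)%E; last first.
  by rewrite -Zt_law; congr (_ * _)%E; apply: eq_integral => w _; rewrite xsectionG.
rewrite measure_semi_bigcup//; last 2 first.
- apply/trivIsetP => i j _ _ /eqP ij; apply/seteqP; split => // w.
  by move=> [[[/= _ h1] _] [[/= _ h2] _]]; apply: ij; rewrite -h1 -h2.
- exact: bigcupT_measurable.
transitivity (\sum_(M <oo) (poisson_pmf t N)%:E * ((poisson_pmf u M)%:E * \int[P]_w ((1 - V N w) ^+ M)%:E))%E.
  apply: eq_eseriesr => M _; rewrite -(prob_covered mA n0 hX hY hXY).
  rewrite -Zt_law -Zu_law muleA; apply: Z_indep; exact: covered_sigma.
rewrite nneseriesZl; last first.
  move=> M _; rewrite mule_ge0 ?lee_fin ?poisson_pmf_ge0//; apply: integral_ge0 => w _.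
  by rewrite lee_fin exprn_ge0// subr_ge0; case/andP: (V01 N w).
rewrite muleC; congr (_ * _)%E.
transitivity (\sum_(M <oo) \int[P]_w (poisson_pmf u M * (1 - V N w) ^+ M)%:E)%E.
  apply: eq_eseriesr => M _; rewrite -ge0_integralZl//.
  - by apply/measurable_EFinP; apply: measurable_funX; exact: measurable_funB.
  - by move=> w _; rewrite lee_fin exprn_ge0// subr_ge0; case/andP: (V01 N w).
  - by rewrite lee_fin poisson_pmf_ge0.
rewrite -integral_nneseries//; last 2 first.
- move=> M; apply/measurable_EFinP; apply: measurable_funM => //.
  by apply: measurable_funX; exact: measurable_funB.
- move=> M w _; rewrite lee_fin mulr_ge0 ?poisson_pmf_ge0// exprn_ge0// subr_ge0.
  by case/andP: (V01 N w).
apply: eq_integral => w _; rewrite sum_poisson_pgf//.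
  by rewrite subKr.
by have /andP[h1 h2] := V01 N w; apply/andP; split; lra.
Qed.

Lemma poisson_estimate :
  `|fine (P [set w | covered (fun i => X i) (fun i => Y i) (Zt w) (Zu w) k r w]) -
    expR (- (u * p))| <= estimate_error u 0.
Proof. by rewrite prob_covered_random; exact: poisson_moment. Qed.

End poissonized.

End estimates.

(** * Error terms *)

Section error_bounds.
Context {R : realType}.
Variables (n K : nat) (beta vA vB theta e S Mt : R).
Hypotheses (n2 : (2 <= n)%N) (vA0 : 0 < vA) (vB0 : 0 < vB) (theta0 : 0 < theta)
  (e0 : 0 < e) (S0 : 0 <= S) (Mt0 : 0 <= Mt).

Let k := K.+1.

Lemma expRN_lipschitz (x y : R) : 0 <= x -> 0 <= y -> `|expR (- x) - expR (- y)| <= `|x - y|.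
Proof.
wlog xy : x y / x <= y => [H x0 y0|x0 y0].
  have [xy|xy] := leP x y; first exact: H.
  by rewrite distrC [leRHS]distrC; apply: H => //; exact: ltW.
have h1 : expR (- y) <= expR (- x) by rewrite ler_expR lerN2.
rewrite ger0_norm ?subr_ge0// distrC ger0_norm ?subr_ge0//.
have := expR_ge1Dx (x - y); have h2 : expR (- x) <= 1 by rewrite expR_le1; lra.
have -> : expR (- y) = expR (- x) * expR (x - y) by rewrite -expRD; congr expR; lra.
have h3 := expR_ge0 (- x).
move=> /(ler_wpM2l h3) h4.
have h5 : expR (- x) * (y - x) <= 1 * (y - x) by rewrite ler_wpM2r// subr_ge0.
lra.
Qed.

(** Since [q <= 12 / L] for such [L], the summand [48 * k] yields [4 * k * q <= 1], and the last one
    yields [r <= e]. *)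
Definition L_big : R := L_min K beta + 48 * k%:R + 12 * vA / (theta * e ^+ n).

Variables (t L r : R).
Hypotheses (tL : t = expR L) (LL : L_big <= L) (r0 : 0 < r).

Let q := theta * r ^+ n / vA.
Let rh := t * q.
Hypothesis rhE : rh = rho K beta L.
Let p := pois_lt k rh.
Let near := (r / rh) ^+ n.

Lemma L_min_le_L_big : L_min K beta <= L_big.
Proof.
rewrite /L_big -addrA lerDl addr_ge0//.
by rewrite divr_ge0 ?mulr_ge0 ?exprn_ge0// ltW.
Qed.

Let L_min_le : L_min K beta <= L. Proof. exact: le_trans L_min_le_L_big LL. Qed.

Let L4 : 4 <= L.
Proof.
apply: le_trans L_min_le; rewrite /L_min.
by have := sqr_ge0 (K%:R : R); have := normr_ge0 beta; lra.
Qed.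

Let Lk : 48 * k%:R <= L.
Proof.
apply: le_trans LL; rewrite /L_big.
have : 0 <= L_min K beta by rewrite /L_min; have := sqr_ge0 (K%:R : R); have := normr_ge0 beta; lra.
have : 0 <= 12 * vA / (theta * e ^+ n).
  by rewrite divr_ge0 ?mulr_ge0 ?exprn_ge0// ltW.
lra.
Qed.

Let Le : 12 * vA / (theta * e ^+ n) <= L.
Proof.
apply: le_trans LL; rewrite /L_big.
have : 0 <= L_min K beta by rewrite /L_min; have := sqr_ge0 (K%:R : R); have := normr_ge0 beta; lra.
have : 0 <= k%:R :> R by [].
lra.
Qed.

Let L0 : 0 < L. Proof. by apply: lt_le_trans L4. Qed.

Let L1 : 1 <= L. Proof. by apply: le_trans L4; rewrite ler1n. Qed.

Let t0 : 0 < t. Proof. by rewrite tL expR_gt0. Qed.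

Let t3 : L ^+ 3 <= 6 * t.
Proof.
have := expr_fact_le_expR 3 (ltW L0); rewrite -tL ler_pdivrMr ?fact_gt0R//.
by rewrite (_ : 3`! = 6)%N// mulrC.
Qed.

Let tL1 : L <= t.
Proof. by rewrite tL; have := expR_ge1Dx L; lra. Qed.

Let rh_lb : L / 2 <= rh. Proof. by rewrite rhE; have [_ ->] := rho_bounds L_min_le. Qed.

Let rh_ub : rh <= 2 * L. Proof. by rewrite rhE; have [_ _ ->] := rho_bounds L_min_le. Qed.

Let rh0 : 0 < rh. Proof. by apply: lt_le_trans rh_lb; rewrite divr_gt0. Qed.

Let rh1 : 1 <= rh. Proof. by apply: le_trans rh_lb; have := L4; lra. Qed.

Let qE : q = rh / t. Proof. by rewrite /rh mulrC mulKf// gt_eqF. Qed.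

Let q0 : 0 < q. Proof. by rewrite qE divr_gt0. Qed.

(** [rh <= 2 * L] is divided by [t >= L ^ 3 / 6], a single term of the exponential series. *)
Let q_le : q <= 12 / L ^+ 2.
Proof.
rewrite qE ler_pdivrMr// mulrAC ler_pdivlMr ?exprn_gt0//.
have := ler_wpM2r (sqr_ge0 L) rh_ub; move=> /le_trans; apply.
by move: t3; rewrite !exprS expr0 mulr1; lra.
Qed.

Let q_le1 : q <= 12 / L.
Proof.
apply: le_trans q_le _; rewrite ler_wpM2l// lef_pV2 ?posrE ?exprn_gt0//.
by rewrite expr2 ler_peMr// ltW.
Qed.

Lemma k_q_le : 4 * k%:R * q <= 1.
Proof.
have k0 : 0 <= 4 * k%:R :> R by [].
apply: le_trans (ler_wpM2l k0 q_le1) _.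
by rewrite mulrA ler_pdivrMr// mul1r; have := Lk; lra.
Qed.

Lemma two_q_lt : 2 * q < 1.
Proof.
have k1 : 1 <= k%:R :> R by rewrite ler1n.
have := ler_wpM2r (ltW q0) k1; have := k_q_le; have := q0; lra.
Qed.

Lemma r_le : r <= e.
Proof.
have n0 : (0 < n)%N by apply: leq_trans n2.
rewrite -(ler_pXn2r n0) ?nnegrE ?(ltW r0) ?(ltW e0)//.
have -> : r ^+ n = q * (vA / theta).
  by rewrite /q; field; rewrite !gt_eqF.
have vt : 0 < vA / theta by rewrite divr_gt0.
apply: le_trans (ler_wpM2r (ltW vt) q_le1) _.
have -> : 12 / L * (vA / theta) = 12 * vA / theta / L by ring.
have := Le; rewrite ler_pdivrMr ?mulr_gt0 ?exprn_gt0// => h.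
by rewrite !ler_pdivrMr//; apply: le_trans h _; rewrite (_ : L * _ = e ^+ n * L * theta)//; ring.
Qed.

(** [r ^+ n] is proportional to [rh / t], so [t * near] is proportional to [rh ^ (1 - n)]; the
    exponent is at most -1 by [n2], and [rh >= L / 2]. *)
Let near_le : t * near <= 2 * vA / theta / L.
Proof.
rewrite /near expr_div_n.
have n0 : (0 < n)%N by apply: leq_trans n2.
have -> : r ^+ n = rh / t * (vA / theta).
  by rewrite -qE /q; field; rewrite !gt_eqF.
have -> : n = n.-2.+2 by case: (n) n2 => [|[|]].
have -> : t * (rh / t * (vA / theta) / rh ^+ n.-2.+2) = vA / theta / rh ^+ n.-2.+1.
  rewrite !exprS; field.
  by rewrite !gt_eqF// ?exprn_gt0.
have h : rh <= rh ^+ n.-2.+1.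
  by rewrite exprS ler_peMr ?(ltW rh0)// exprn_ege1.
have vt : 0 < vA / theta by rewrite divr_gt0.
apply: (@le_trans _ _ (vA / theta / rh)).
  by rewrite ler_wpM2l ?(ltW vt)// lef_pV2 ?posrE ?exprn_gt0.
have -> : 2 * vA / theta / L = vA / theta / (L / 2) by field; rewrite !gt_eqF.
by rewrite ler_wpM2l ?(ltW vt)// lef_pV2 ?posrE// divr_gt0.
Qed.

Let near0 : 0 <= near.
Proof. by rewrite exprn_ge0// divr_ge0// ltW. Qed.

Let p0 : 0 <= p. Proof. by apply: pois_lt_ge0; exact: ltW. Qed.

(** [144 = 12 * 12] comes from [q <= 12 / L], and [24 = 2 * 12] from [t * q ^ 2 = rh * q <= 2 * L *
    (12 / L ^ 2)]. *)
Definition eta_bound : R := 144 * k%:R + k%:R ^+ 2 + 24.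

Lemma eta_le : 12 * k%:R * q + k%:R ^+ 2 / t + t * q ^+ 2 <= eta_bound / L.
Proof.
have k0 : 0 <= 12 * k%:R :> R by [].
have -> : eta_bound / L = 12 * k%:R * (12 / L) + k%:R ^+ 2 / L + 24 / L.
  by rewrite /eta_bound; ring.
apply: lerD; first apply: lerD.
- exact: ler_wpM2l.
- by rewrite ler_wpM2l ?sqr_ge0// lef_pV2 ?posrE.
- have h := ler_wpM2l (ltW rh0) q_le; rewrite expr2 mulrA -/rh.
  apply: le_trans h _; have := ler_wpM2r _ rh_ub => /(_ (12 / L ^+ 2)).
  rewrite divr_ge0 ?sqr_ge0// => /(_ isT) /le_trans; apply.
  by rewrite le_eqVlt; apply/orP; left; apply/eqP; field; rewrite gt_eqF.
Qed.

Variable C0 : R.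
Hypothesis C00 : 0 <= C0.
Hypothesis HC0 : `|expR L * pois_lt k (rho K beta L) -
    expR (- beta) / K`!%:R * (1 + K%:R ^+ 2 * ln L / L)| <= C0 / L.

Let c : R := expR (- beta) / K`!%:R.

Let c0 : 0 <= c. Proof. by rewrite divr_ge0 ?expR_ge0. Qed.

Definition tp_bound : R := c * (1 + K%:R ^+ 2) + C0.

Let lnL : 0 <= ln L / L <= 1.
Proof.
rewrite divr_ge0 ?ln_ge0 ?(ltW L0)//=.
by rewrite ler_pdivrMr// mul1r ltW// ln_sublinear.
Qed.

Let tp_le : t * p <= tp_bound.
Proof.
have := HC0; rewrite -tL -rhE -/p -/c ler_norml => /andP[_ h].
have h1 : C0 / L <= C0 by rewrite ler_pdivrMr// ler_peMr.
have /andP[l0 l1] := lnL.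
have h2 : c * (K%:R ^+ 2 * ln L / L) <= c * K%:R ^+ 2.
  by rewrite ler_wpM2l// -mulrA ler_piMr ?sqr_ge0.
rewrite /tp_bound; lra.
Qed.

Variable m : R.
Hypotheses (m0 : 0 <= m) (mt : m <= Mt * t).

Let mp_le : m * p <= Mt * tp_bound.
Proof.
apply: le_trans (ler_wpM2r p0 mt) _.
by rewrite -mulrA ler_wpM2l.
Qed.

Let mp0 : 0 <= m * p. Proof. exact: mulr_ge0. Qed.

Let tpb0 : 0 <= tp_bound.
Proof. by apply: le_trans tp_le; rewrite mulr_ge0// ltW. Qed.

Let mnear_le : m * near <= Mt * (2 * vA / theta) / L.
Proof.
apply: le_trans (ler_wpM2r near0 mt) _.
rewrite -[leLHS]mulrA (_ : _ / L = Mt * (2 * vA / theta / L)); last by ring.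
exact: ler_wpM2l.
Qed.

Let c1 : R := k%:R * 2 ^+ k.

Let c10 : 0 <= c1. Proof. by rewrite mulr_ge0 ?exprn_ge0. Qed.

Definition error_const : R :=
  Mt * tp_bound * eta_bound + 2 * (3 * eta_bound * (Mt * tp_bound) ^+ 2 +
    (1 + eta_bound) * c1 * (Mt * tp_bound) * (S * (theta / vB) * (Mt * (2 * vA / theta)))).

Let etab0 : 0 <= eta_bound.
Proof. by rewrite /eta_bound !addr_ge0 ?mulr_ge0 ?sqr_ge0. Qed.

Let etab1 eta : eta <= eta_bound / L -> eta <= eta_bound.
Proof. by move=> /le_trans; apply; rewrite ler_pdivrMr// ler_peMr. Qed.

Let s0 : 0 <= S * (theta / vB).
Proof. by rewrite mulr_ge0// divr_ge0// ltW. Qed.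

Lemma estimate_error_le eta : 0 <= eta <= eta_bound / L ->
  m * p * eta + 2 * (3 * eta * (m * p) ^+ 2 +
    (1 + eta) * c1 * (m * p) * (m * (S * (theta / vB) * near))) <= error_const / L.
Proof.
move=> /andP[h0 h1]; have h2 := etab1 h1.
have b0 : 0 <= Mt * tp_bound by rewrite mulr_ge0.
have -> : error_const / L = Mt * tp_bound * (eta_bound / L) +
  2 * (3 * (eta_bound / L) * (Mt * tp_bound) ^+ 2 + (1 + eta_bound) * c1 * (Mt * tp_bound) *
    (S * (theta / vB) * (Mt * (2 * vA / theta) / L))).
  by rewrite /error_const; ring.
apply: lerD; first exact: ler_pM.
rewrite ler_wpM2l//; apply: lerD.
  apply: ler_pM; rewrite ?sqr_ge0 ?mulr_ge0//; first by rewrite ler_wpM2l.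
  by rewrite lerXn2r ?nnegrE.
have e1 : 0 <= 1 + eta by rewrite addr_ge0.
apply: ler_pM.
- by rewrite mulr_ge0// mulr_ge0.
- by rewrite mulr_ge0// mulr_ge0.
- apply: ler_pM => //; first by rewrite mulr_ge0.
  by rewrite ler_wpM2r// lerD2l.
- by rewrite mulrCA ler_wpM2l.
Qed.

Definition second_const : R :=
  Mt * tp_bound * (1 + eta_bound) * (tp_bound + c1 * (S * (theta / vB) * (2 * vA / theta))).

(** [m * p] stays bounded. For the remaining factor the crude size [1 / L] is enough: it follows
    from the bounds on [t * p] and [t * near] through [L <= t] and [1 <= t]. *)
Lemma second_moment_error_le eta : 0 <= eta <= eta_bound / L ->
  m * ((1 + eta) * p * (p + c1 * (S * (theta / vB) * near))) <= second_const / L.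
Proof.
move=> /andP[h0 h1]; have h2 := etab1 h1.
have b0 : 0 <= Mt * tp_bound by rewrite mulr_ge0.
have e1 : 0 <= 1 + eta by rewrite addr_ge0.
have t1 : 1 <= t := le_trans L1 tL1.
have pL : p <= tp_bound / L.
  rewrite ler_pdivlMr// mulrC; apply: le_trans tp_le.
  by rewrite ler_wpM2r.
have nL : near <= 2 * vA / theta / L.
  by apply: le_trans near_le; rewrite ler_peMl.
have -> : m * ((1 + eta) * p * (p + c1 * (S * (theta / vB) * near))) =
  m * p * (1 + eta) * (p + c1 * (S * (theta / vB) * near)) by ring.
have -> : second_const / L = Mt * tp_bound * (1 + eta_bound) *
  (tp_bound / L + c1 * (S * (theta / vB) * (2 * vA / theta / L))).
  by rewrite /second_const; ring.
apply: ler_pM.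
- exact: mulr_ge0.
- by rewrite addr_ge0// mulr_ge0// mulr_ge0.
- by apply: ler_pM => //; rewrite lerD2l.
- by rewrite lerD// ler_wpM2l// ler_wpM2l.
Qed.

(** The two limiting exponentials merge into one whose exponent is [m / t] times the expansion of
    [t * p] in [HC0], and [expR (- x)] is 1-Lipschitz for [x >= 0]. *)
Lemma limit_error_le : `|expR (- (m * p)) -
   expR (- (m / t * expR (- beta) * K%:R ^+ 2 * ln L / (K`!%:R * L))) *
   expR (- (m / t * expR (- beta) / K`!%:R))| <= Mt * C0 / L.
Proof.
have kf := fact_gt0R (R := R) K.
have /andP[l0 l1] := lnL.
have -> : expR (- (m / t * expR (- beta) * K%:R ^+ 2 * ln L / (K`!%:R * L))) *
   expR (- (m / t * expR (- beta) / K`!%:R)) =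
   expR (- (m / t * (c * (1 + K%:R ^+ 2 * ln L / L)))).
  by rewrite -expRD; congr expR; rewrite /c; field; rewrite !gt_eqF.
have mt1 : 0 <= m / t by rewrite divr_ge0// ltW.
have x0 : 0 <= m / t * (c * (1 + K%:R ^+ 2 * ln L / L)).
  by rewrite mulr_ge0// mulr_ge0// addr_ge0// -mulrA mulr_ge0 ?sqr_ge0.
apply: le_trans (expRN_lipschitz mp0 x0) _.
have -> : m * p - m / t * (c * (1 + K%:R ^+ 2 * ln L / L)) =
  m / t * (t * p - c * (1 + K%:R ^+ 2 * ln L / L)).
  by field; rewrite !gt_eqF.
rewrite normrM ger0_norm// -[leRHS]mulrA; apply: ler_pM => //.
  by rewrite ler_pdivrMr.
by have := HC0; rewrite -tL -rhE.
Qed.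

End error_bounds.

Lemma exists_root (R : realType) n (c : R) : (0 < n)%N -> 0 < c ->
  exists2 r, 0 < r & r ^+ n = c.
Proof.
move=> n0 c0; exists (c `^ n%:R^-1); first exact: powR_gt0.
by rewrite -powR_mulrn ?powR_ge0// -powRrM mulVf ?powRr1 ?ltW// pnatr_eq0 -lt0n.
Qed.

Lemma eqaddO_le (R : realType) (T : Type) (F : filter_on T) (f g e : T -> R) C :
  (\forall x \near F, `|f x - g x| <= C * `|e x|) -> f = g +O_F e.
Proof.
move=> H; apply/eqaddOP; near=> M.
apply: filterS H => x /= h; apply: le_trans h _.
by rewrite ler_wpM2r//; near: M; apply: nbhs_pinfty_ge; rewrite num_real.
Unshelve. all: by end_near. Qed.

(** * Laws and independence of the Poisson counts, and conclusion *)

Section independent_counts.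
Context {R : realType} {dO : measure_display} {O : measurableType dO}
  (P : probability O R).

Lemma independent3_prob (G1 G2 G3 : set (set O)) E1 E2 E3 :
  independent3 P G1 G2 G3 -> G1 E1 -> G2 E2 -> G3 E3 ->
  P (E1 `&` E2 `&` E3) = (P E1 * P E2 * P E3)%E.
Proof.
move=> I h1 h2 h3.
pose i0 : 'I_3 := inord 0; pose i1 : 'I_3 := inord 1; pose i2 : 'I_3 := inord 2.
have v0 : i0 = 0%N :> nat by rewrite inordK.
have v1 : i1 = 1%N :> nat by rewrite inordK.
have v2 : i2 = 2%N :> nat by rewrite inordK.
pose E := tnth [tuple E1; E2; E3].
have e0 : E i0 = E1 by rewrite /E (tnth_nth set0) v0.
have e1 : E i1 = E2 by rewrite /E (tnth_nth set0) v1.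
have e2 : E i2 = E3 by rewrite /E (tnth_nth set0) v2.
have := I (i0 |` (i1 |` [fset i2]))%fset E.
rewrite !big_fsetU1 ?inE -?val_eqE /= ?v0 ?v1 ?v2//= big_seq_fset1 e0 e1 e2 muleA.
move=> <-.
  congr (P _); apply/seteqP; split => [w [[w1 w2] w3] i /=|w h].
    by rewrite !inE => /or3P[] /eqP ->; rewrite ?e0 ?e1 ?e2.
  split; first split.
  - by rewrite -e0; apply: h; rewrite /= !inE eqxx.
  - by rewrite -e1; apply: h; rewrite /= !inE eqxx orbT.
  - by rewrite -e2; apply: h; rewrite /= !inE eqxx !orbT.
by move=> i; rewrite !inE => /or3P[] /eqP ->; rewrite ?e0 ?e1 ?e2 (tnth_nth set0) ?v0 ?v1 ?v2.
Qed.

Lemma poisson_process_pmf (Z : R -> {RV P >-> nat}) t j :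
  unit_rate_poisson_process P (fun t => Z t) -> 0 < t ->
  P (Z t @^-1` [set j]) = (poisson_pmf t j)%:E.
Proof.
move=> HZ t0; rewrite -[t in RHS]subr0 -(poisson_process_law HZ)//.
congr (P _); apply/seteqP; split => w /=; rewrite (poisson_process_start HZ) subn0//.
Qed.

Lemma sigma_of_family_level (Z : R -> {RV P >-> nat}) t j : 0 <= t ->
  sigma_of_family [set t | 0 <= t] (fun t => Z t) (Z t @^-1` [set j]).
Proof.
move=> t0; apply: sub_sigma_algebra; exists t => //.
by exists [set j] => //; rewrite setTI.
Qed.

End independent_counts.

Theorem theorem2p1 (R : realType) (d : nat) (hd : (2 <= d)%N)
    (A B : set 'rV[R]_d)
    (hA : compact A) (hB : measurable B) (hBA : B `<=` A)
    (hBint : closure B `<=` interior A)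
    (hBR : riemann_measurable B) (hB0 : (0 < lebesgue_rV B)%E)
    (k : nat) (hk : (0 < k)%N) (tau beta : R) (htau : 0 < tau)
    (m : nat -> nat) (hm0 : forall n, (0 < n)%N -> (0 < m n)%N)
    (hm : (m n)%:R / n%:R @[n --> \oo] --> tau)
    (dO : measure_display) (Omega : measurableType dO) (P : probability Omega R)
    (X Y : nat -> {RV P >-> 'rV[R]_d})
    (hX : forall i, uniformly_distributed P (X i) A)
    (hY : forall i, uniformly_distributed P (Y i) B)
    (hXY : mutually_independent P (fun i => sigma_of (interleave X Y i))) :
  let theta := unit_ball_vol R d in
  let f0 := (vol A)^-1 in
  let calX n w := first_points (fun i => X i w) n in
  let calY n w := first_points (fun i => Y i w) n in
  ((fun n : nat =>
      fine (P [set w |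
        ((n%:R * theta * f0)%:E * knn_radius (calX n w) (calY (m n) w) k ^+ d
         - (ln n%:R)%:E - ((k%:R - 1) * ln (ln n%:R))%:E <= beta%:E)%E]))
   = (fun n : nat =>
        let tau_n := (m n)%:R / n%:R in
        expR (- (tau_n * expR (- beta) * (k%:R - 1) ^+ 2 * ln (ln n%:R)
                 / ((k.-1)`!%:R * ln n%:R)))
        * expR (- (tau_n * expR (- beta) / (k.-1)`!%:R)))
   +O_\oo (fun n : nat => (ln n%:R)^-1))
  /\
  (forall (Z Z' : R -> {RV P >-> nat}),
     unit_rate_poisson_process P (fun t => Z t) ->
     unit_rate_poisson_process P (fun t => Z' t) ->
     independent3 P
       (sigma_of_family [set t | 0 <= t] (fun t => Z t))
       (sigma_of_family [set t | 0 <= t] (fun t => Z' t))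
       (sigma_of_family [set: nat] (interleave X Y)) ->
   (fun t : R =>
      fine (P [set w |
        ((t * theta * f0)%:E
           * knn_radius (calX (Z t w) w) (calY (Z' (tau * t)%R w) w) k ^+ d
         - (ln t)%:E - ((k%:R - 1) * ln (ln t))%:E <= beta%:E)%E]))
   = (fun t : R =>
        expR (- (tau * expR (- beta) * (k%:R - 1) ^+ 2 * ln (ln t)
                 / ((k.-1)`!%:R * ln t)))
        * expR (- (tau * expR (- beta) / (k.-1)`!%:R)))
   +O_ (pinfty_nbhs R) (fun t : R => (ln t)^-1)).
Proof.
move=> theta f0 calX calY.
case: k hk => // K _ /=.
have -> : K.+1%:R - 1 = K%:R :> R by rewrite -natr1 addrK.
have d0 : (0 < d)%N by apply: leq_trans hd.
have mA := compact_measurable_rV hA.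
have vA0 : 0 < vol A := volA_gt0 hA hB hBA hB0.
have Boo : (lebesgue_rV B < +oo)%E.
  apply: le_lt_trans (compact_lebesgue_rV_lty hA).
  by apply: le_measure; rewrite ?inE.
have vB0 : 0 < vol B by rewrite /vol fine_gt0// hB0 Boo.
have theta0 : 0 < theta := unit_ball_vol_gt0 d0.
have [e e0 eA] := interior_margin hA hBint.
have kappa0 : 0 < 8^-1 :> R by rewrite invr_gt0.
have [S S0 HS] := shell_integral d kappa0.
have [C0 C00 HC0] := expR_pois_lt_rho K beta.
(* The maximum with 1 keeps [ln t] positive. *)
pose Lb := Num.max (L_big d K beta (vol A) theta e) 1.
(* Beyond the threshold, [r] solves [t * theta * f0 * r ^+ d = ln t + K * ln (ln t) + beta]. The
   equivalence with covering holds outcome by outcome for all sizes [N] and [M], hence also for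
   random ones. *)
have radius t (L := ln t) : expR Lb <= t -> exists r : R,
  [/\ 0 < L, t = expR L, L_big d K beta (vol A) theta e <= L &
  [/\ 0 < r, t * (theta * r ^+ d / vol A) = rho K beta L &
  forall N M (w : Omega),
  (((t * theta * f0)%:E * knn_radius (calX N w) (calY M w) K.+1 ^+ d
         - (ln t)%:E - (K%:R * ln (ln t))%:E <= beta%:E)%E : Prop) <->
    covered (fun i => X i) (fun i => Y i) N M K.+1 r w]].
  move=> tL; have t0 : 0 < t by apply: lt_le_trans tL; exact: expR_gt0.
  have tE : t = expR L by rewrite lnK.
  have LL : Lb <= L by rewrite -ler_expR -tE.
  have [L1 L2] : L_big d K beta (vol A) theta e <= L /\ 1 <= L.
    by move: LL; rewrite ge_max => /andP[].
  have L0 : 0 < L by apply: lt_le_trans L2.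
  have f00 : 0 < f0 by rewrite invr_gt0.
  have a0 : 0 < t * theta * f0 := mulr_gt0 (mulr_gt0 t0 theta0) f00.
  have rho0 : 0 < rho K beta L.
    have [|_ h _] := @rho_bounds R K beta L.
      exact: le_trans (L_min_le_L_big _ _ _ vA0 theta0 e0) L1.
    by apply: lt_le_trans h; rewrite divr_gt0.
  have [r r0 rE] : exists2 r, 0 < r & r ^+ d = rho K beta L / (t * theta * f0).
    by apply: exists_root => //; rewrite divr_gt0.
  have arE : t * theta * f0 * r ^+ d = ln t + K%:R * ln (ln t) + beta.
    by rewrite rE mulrC divfK// gt_eqF.
  exists r; split => //; split => //.
    by rewrite -[RHS]arE /f0; ring.
  by move=> N M w; exact: knn_event arE.
split.
  (* [m n / n] tends to [tau], so it is eventually at most [tau + 1]; the constants depend on this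
     bound only, while the ratio itself stays in the limit formula. *)
  pose Mt := tau + 1.
  have Mt0 : 0 <= Mt by rewrite addr_ge0// ltW.
  apply: (@eqaddO_le _ _ _ _ _ _ (second_const K beta (vol A) (vol B) theta S Mt C0 +
    error_const K beta (vol A) (vol B) theta S Mt C0 + Mt * C0)).
  near=> n.
  have nL : expR Lb <= n%:R by near: n; exact: nbhs_infty_ger.
  have mn : (m n)%:R / n%:R <= Mt by near: n; apply: cvgr_le hm _ _; rewrite ltrDl.
  have [r [L0 nE LL [r0 rhE ev]]] := radius _ nL.
  have n0 : 0 < n%:R :> R by apply: lt_le_trans nL; exact: expR_gt0.
  have mn' : (m n)%:R <= Mt * n%:R by rewrite -ler_pdivrMr.
  rewrite (_ : [set w | _] = covered (fun i => X i) (fun i => Y i) n (m n) K.+1 r); last first.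
    by apply/seteqP; split => w /= /ev.
  have re := r_le hd vA0 theta0 e0 nE LL r0 rhE.
  have q0 : 0 <= theta * r ^+ d / vol A.
    by rewrite divr_ge0 ?mulr_ge0 ?exprn_ge0// ltW.
  have est := @fixed_size_estimate _ _ _ _ _ _ _ _ _ _ _ d0 hA hB hBA hB0 eA hX hY hXY S0 HS
    K.+1 r n%:R isT r0 re n0 n (m n) _ erefl
    (k_q_le vA0 theta0 e0 nE LL rhE) (ltW (two_q_lt vA0 theta0 e0 nE LL rhE)) erefl.
  set eta := (X in estimate_error _ _ _ _ _ _ _ X) in est.
  have eta_bd : 0 <= eta <= eta_bound K / ln n%:R.
    rewrite (eta_le vA0 theta0 e0 nE LL rhE) andbT.
    have k0 : 0 <= 12 * K.+1%:R :> R by [].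
    have k1 : 0 <= K.+1%:R ^+ 2 / n%:R :> R by rewrite divr_ge0.
    exact: addr_ge0 (addr_ge0 (mulr_ge0 k0 q0) k1) (mulr_ge0 (ltW n0) (sqr_ge0 _)).
  have HC := HC0 _ (le_trans (L_min_le_L_big _ _ _ vA0 theta0 e0) LL).
  have e1 := second_moment_error_le hd vA0 vB0 theta0 e0 S0 Mt0 nE LL r0 rhE C00 HC
    (ler0n _ _) mn' eta_bd.
  have e2 := estimate_error_le hd vA0 vB0 theta0 e0 S0 Mt0 nE LL r0 rhE C00 HC
    (ler0n _ _) mn' eta_bd.
  have e3 := limit_error_le vA0 theta0 e0 nE LL rhE HC (ler0n _ _) mn'.
  rewrite [X in _ <= _ * X]ger0_norm ?invr_ge0 ?(ltW L0)//.
  (* The intermediate value is [expR (- (m * p))]: the moment estimates control the first distance,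
     the expansion of [p] the second. *)
  have dist := ler_distD (expR (- ((m n)%:R * pois_lt K.+1 (n%:R * (theta * r ^+ d / vol A))))).
  have total := lerD (le_trans est (lerD e1 e2)) e3.
  by rewrite -!mulrDl in total; exact: le_trans (dist _ _) total.
move=> Z Z' HZ HZ' HI.
apply: (@eqaddO_le _ _ _ _ _ _ (error_const K beta (vol A) (vol B) theta S tau C0 + tau * C0)).
near=> t.
have tL : expR Lb <= t by near: t; apply: nbhs_pinfty_ge; rewrite num_real.
have [r [L0 tE LL [r0 rhE ev]]] := radius _ tL.
have t0 : 0 < t by apply: lt_le_trans tL; exact: expR_gt0.
have u0 : 0 < tau * t by exact: mulr_gt0.
rewrite (_ : [set w | _] =
    [set w | covered (fun i => X i) (fun i => Y i) (Z t w) (Z' (tau * t) w) K.+1 r w]); last first.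
  by apply/seteqP; split => w /= /ev.
have re := r_le hd vA0 theta0 e0 tE LL r0 rhE.
have est := @poisson_estimate _ _ _ _ _ _ _ _ _ _ _ d0 hA hB hBA hB0 eA hX hY hXY S0 HS
  K.+1 r t isT r0 re t0 (Z t) (Z' (tau * t)) (tau * t) u0
  (two_q_lt vA0 theta0 e0 tE LL rhE) (fun j => poisson_process_pmf j HZ t0)
  (fun j => poisson_process_pmf j HZ' u0)
  (fun i j E hE => independent3_prob HI (sigma_of_family_level (Z := Z) i (ltW t0))
     (sigma_of_family_level (Z := Z') j (ltW u0)) hE).
have HC := HC0 _ (le_trans (L_min_le_L_big _ _ _ vA0 theta0 e0) LL).
have eta_bd : 0 <= (0 : R) <= eta_bound K / ln t.
  by rewrite lexx divr_ge0 ?(ltW L0)// /eta_bound !addr_ge0 ?mulr_ge0 ?sqr_ge0.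
have e2 := estimate_error_le hd vA0 vB0 theta0 e0 S0 (ltW htau) tE LL r0 rhE C00 HC
  (ltW u0) (lexx _) eta_bd.
have e3 := limit_error_le vA0 theta0 e0 tE LL rhE HC (ltW u0) (lexx _).
rewrite mulfK ?gt_eqF// in e3.
rewrite [X in _ <= _ * X]ger0_norm ?invr_ge0 ?(ltW L0)//.
have dist := ler_distD (expR (- (tau * t * pois_lt K.+1 (t * (theta * r ^+ d / vol A))))).
have total := lerD (le_trans est e2) e3.
by rewrite -mulrDl in total; exact: le_trans (dist _ _) total.
Unshelve. all: by end_near. Qed.
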